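(* Consider the initial value problem $$f_{xt}+ff_{xx}-f_x^{2}+\rho=I(t),\qquad \rho_t+f\rho_x=\rho f_x,\qquad I(t)=\int_0^1\rho\,dx-2\int_0^1 f_x^2\,dx,\qquad x\in[0,1],\ t>0,$$ with $f(0,x)=f_0(x)$, $\rho(0,x)=\rho_0(x)$. (1) Let $f_0$ and $\rho_0$ be nontrivial smooth initial data satisfying the Dirichlet boundary conditions, and consider the solution $(f,\rho)$ of the problem under the Dirichlet boundary conditions $f(t,0)=f(t,1)=0$, $\rho(t,0)=\rho(t,1)=0$. Suppose $\rho_0(x)\ge 0$ for all $x\in[0,1]$, and denote by $x_i^*$, $0\le i\le n$, the finite number of points in $[0,1]$ where $f_0'$ attains its greatest positive value. If the $x_i^*$ are located only at the boundary, i.e. every $x_i^*\in\{0,1\}$, and at each $x_i^*$ one has $f_0''(x_i^* )\ne 0$, then there exists a finite $t^*>0$ such that, for each $i$, $$\lim_{t\nearrow t^*}\int_0^t f_x(s,x_i^* )\,ds=+\infty,\qquad \lim_{t\nearrow t^*}|f_{xx}(t,x_i^* )|=+\infty.$$ (2) In contrast, if the points $x_i^*$ where $f_0'$ attains its greatest positive value are allowed to lie anywhere in $[0,1]$, then there exist nontrivial $f_0$ and $\rho_0\ge0$, satisfying the Dirichlet boundary conditions above, or the periodic boundary conditions $f(t,0)=f(t,1)$, $f_x(t,0)=f_x(t,1)$, $\rho(t,0)=\rho(t,1)$ with $\int_0^1 f_0(x)\,dx=0$, such that $f_0''(x_i^* )=0$ for at least one $i$ and the corresponding solution $(f,\rho)$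 of the problem persists for all time.
   Context: The unknowns are real-valued functions $f(t,x)$ and $\rho(t,x)$. The system arises from the inviscid 2D Boussinesq equations $u_t+(u\cdot\nabla)u=-\nabla p+\theta e_2$, $\nabla\cdot u=0$, $\theta_t+u\cdot\nabla\theta=0$ on $\{(x,y)\in[0,1]\times(0,+\infty)\}$ through $u(t,x,y)=(f(t,x),-yf_x(t,x))$, $\theta(t,x,y)=y\rho(t,x)$. The vorticity of $u$ is $-yf_{xx}(t,x)$, and $f_0''$ is referred to as the initial vorticity. In the periodic case the pressure is required to satisfy $p(t,1,y)=p(t,0,y)$; since $f_t+ff_x=-p_x$, this together with $\int_0^1 f_0\,dx=0$ means that $\int_0^1 f(t,x)\,dx=0$ for as long as $f$ is defined, and solutions in the periodic case are understood subject to this condition. *)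

(* Defs.v *)
From Stdlib Require Import Reals Lra List ClassicalEpsilon.
From Coquelicot Require Import Coquelicot.
Open Scope R_scope.

(* Functions of space are total functions R -> R of which only the values on
   [0,1] are used: derivatives in x are taken relative to [0,1], so that they
   are one-sided at the two end points. *)
Definition I01 (x : R) : Prop := 0 <= x <= 1.

Definition is_dx (g : R -> R) (x l : R) : Prop :=
  filterdiff g (within I01 (locally x)) (fun h : R => scal h l).

Definition ex_dx (g : R -> R) (x : R) : Prop := exists l, is_dx g x l.

(* Arbitrary where [ex_dx g x] fails, and for x outside [0,1]. *)
Definition dx (g : R -> R) (x : R) : R := epsilon (inhabits 0) (is_dx g x).

Lemma is_dx_iff (g : R -> R) (x l : R) :
  I01 x ->
  (is_dx g x l <->
   filterlim (fun y => (g y - g x) / (y - x))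
     (within (fun y => I01 y /\ y <> x) (locally x)) (locally l)).
Proof.
intros Hx; split.
- intros [_ H].
  assert (Hl : is_filter_lim (within I01 (locally x)) x).
  { intros P HP; unfold within; revert HP; apply filter_imp; auto. }
  specialize (H x Hl).
  intros P [eps HP].
  assert (He : 0 < eps / 2) by (destruct eps; simpl; lra).
  specialize (H (mkposreal _ He)).
  unfold filtermap, within in *.
  revert H; apply filter_imp; intros y Hy [Hy1 Hy2].
  specialize (Hy Hy1); apply HP.
  change (Rabs (minus ((g y - g x) / (y - x)) l) < eps).
  unfold minus, plus, opp, scal, norm in Hy; simpl in Hy.
  unfold mult, abs in Hy; simpl in Hy.
  unfold minus, plus, opp; simpl.
  assert (Hp : 0 < Rabs (y + - x)) by (apply Rabs_pos_lt; lra).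
  replace ((g y - g x) / (y - x) + - l)
    with ((g y + - g x + - ((y + - x) * l)) / (y + - x)) by (field; lra).
  unfold Rdiv; rewrite Rabs_mult, Rabs_inv.
  apply Rle_lt_trans with (eps / 2); [|destruct eps; simpl; lra].
  apply Rmult_le_reg_r with (Rabs (y + - x)); trivial.
  rewrite Rmult_assoc, Rinv_l by lra; lra.
- intros H; split.
  + exact (@is_linear_scal_l R_AbsRing R_NormedModule l).
  + intros z Hz.
    assert (Hzx : x = z).
    { apply (@is_filter_lim_unique R_AbsRing R_NormedModule
               (within I01 (locally x))).
      - apply Proper_StrongProper.
        split; [|apply within_filter, locally_filter].
        intros P [d Hd]; exists x; apply Hd; [apply ball_center|exact Hx].
      - intros P HP; unfold within; revert HP; apply filter_imp; auto.
      - exact Hz. }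
    subst z; intros eps.
    assert (Hb : locally l (ball l eps)) by (exists eps; auto).
    specialize (H _ Hb); unfold filtermap, within in *.
    revert H; apply filter_imp; intros y Hy Hy1.
    unfold minus, plus, opp, scal, norm; simpl.
    unfold mult, abs; simpl.
    destruct (Req_dec y x) as [->|Hne].
    + replace (g x + - g x + - ((x + - x) * l)) with 0 by ring.
      replace (x + - x) with 0 by ring.
      rewrite Rabs_R0; lra.
    + specialize (Hy (conj Hy1 Hne)).
      change (Rabs (minus ((g y - g x) / (y - x)) l) < eps) in Hy.
      unfold minus, plus, opp in Hy; simpl in Hy.
      replace (g y + - g x + - ((y + - x) * l))
        with (((g y - g x) / (y - x) + - l) * (y + - x)) by (field; lra).
      rewrite Rabs_mult.
      apply Rmult_le_compat_r; [apply Rabs_pos|lra].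
Qed.

Lemma dx_correct (g : R -> R) (x : R) : ex_dx g x -> is_dx g x (dx g x).
Proof. intros H; exact (epsilon_spec (inhabits 0) (is_dx g x) H). Qed.

Lemma is_dx_unique (g : R -> R) (x l : R) : I01 x -> is_dx g x l -> dx g x = l.
Proof.
intros Hx H.
assert (H' : is_dx g x (dx g x)) by (apply dx_correct; exists l; exact H).
apply (is_dx_iff g x l Hx) in H; apply (is_dx_iff g x _ Hx) in H'.
refine (@filterlim_locally_unique R R_AbsRing R_NormedModule _ _ _ _ _ H' H).
apply Proper_StrongProper; split; [|apply within_filter, locally_filter].
intros P [d Hd].
set (e := Rmin (d / 2) (1 / 2)).
assert (He : 0 < e) by (apply Rmin_pos; [destruct d; simpl|]; lra).
assert (He1 : e <= d / 2) by apply Rmin_l.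
assert (He2 : e <= 1 / 2) by apply Rmin_r.
assert (Hd0 : 0 < d) by (destruct d; simpl; lra).
unfold I01 in *.
destruct (Rle_dec x (1 / 2)) as [Hle|Hgt].
- exists (x + e); apply Hd; [|lra].
  change (Rabs (x + e + - x) < d); rewrite Rabs_pos_eq; lra.
- exists (x - e); apply Hd; [|lra].
  change (Rabs (x - e + - x) < d); rewrite Rabs_left1; lra.
Qed.

Definition smooth (g : R -> R) : Prop :=
  forall (n : nat) (x : R), I01 x -> ex_dx (Nat.iter n dx g) x.

Definition nontrivial (g : R -> R) : Prop := exists x, I01 x /\ g x <> 0.

Definition is_max_point (f0 : R -> R) (x : R) : Prop :=
  I01 x /\ 0 < dx f0 x /\ forall y, I01 y -> dx f0 y <= dx f0 x.

(* Boundary conditions are imposed on the profiles f(t,.) and rho(t,.). *)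
Definition boundary_condition := (R -> R) -> (R -> R) -> Prop.

Definition dirichlet : boundary_condition := fun g r =>
  g 0 = 0 /\ g 1 = 0 /\ r 0 = 0 /\ r 1 = 0.

(* The zero mean comes from p(t,1,y) = p(t,0,y) for the pressure p of the
   underlying Boussinesq flow. *)
Definition periodic : boundary_condition := fun g r =>
  g 0 = g 1 /\ dx g 0 = dx g 1 /\ r 0 = r 1 /\ RInt g 0 1 = 0.

Definition time_slab (T : Rbar) (p : R * R) : Prop :=
  0 <= fst p /\ Rbar_lt (Finite (fst p)) T /\ I01 (snd p).

Definition continuous_on_slab (T : Rbar) (u : R -> R -> R) : Prop :=
  continuous_on (time_slab T) (fun p : R * R => u (fst p) (snd p)).

Definition nonlocal_term (f rho : R -> R -> R) (t : R) : R :=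
  RInt (rho t) 0 1 - 2 * RInt (fun x => dx (f t) x ^ 2) 0 1.

(* Classical solutions on [0,T) x [0,1]. Continuity of f_xt and rho_t follows
   from the two equations. *)
Record is_solution (bc : boundary_condition) (f0 rho0 : R -> R) (T : Rbar)
    (f rho : R -> R -> R) : Prop := {
  sol_lifespan : Rbar_lt (Finite 0) T;
  sol_ex_dx : forall t x, time_slab T (t, x) ->
    ex_dx (f t) x /\ ex_dx (dx (f t)) x /\ ex_dx (rho t) x;
  sol_cont_f : continuous_on_slab T f;
  sol_cont_fx : continuous_on_slab T (fun t => dx (f t));
  sol_cont_fxx : continuous_on_slab T (fun t => dx (dx (f t)));
  sol_cont_rho : continuous_on_slab T rho;
  sol_cont_rhox : continuous_on_slab T (fun t => dx (rho t));
  sol_ex_dt : forall t x, 0 < t -> time_slab T (t, x) ->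
    ex_derive (fun s => dx (f s) x) t /\ ex_derive (fun s => rho s x) t;
  sol_eq_f : forall t x, 0 < t -> time_slab T (t, x) ->
    Derive (fun s => dx (f s) x) t + f t x * dx (dx (f t)) x
      - dx (f t) x ^ 2 + rho t x = nonlocal_term f rho t;
  sol_eq_rho : forall t x, 0 < t -> time_slab T (t, x) ->
    Derive (fun s => rho s x) t + f t x * dx (rho t) x = rho t x * dx (f t) x;
  sol_init : forall x, I01 x -> f 0 x = f0 x /\ rho 0 x = rho0 x;
  sol_bc : forall t, 0 <= t -> Rbar_lt (Finite t) T -> bc (f t) (rho t)
}.

(* The solution of the initial value problem, with maximal lifespan T. *)
Definition is_the_solution (bc : boundary_condition) (f0 rho0 : R -> R)
    (T : Rbar) (f rho : R -> R -> R) : Prop :=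
  is_solution bc f0 rho0 T f rho /\
  forall (T' : Rbar) (g sigma : R -> R -> R),
    is_solution bc f0 rho0 T' g sigma ->
    Rbar_le T' T /\
    forall t x, time_slab T' (t, x) -> g t x = f t x /\ sigma t x = rho t x.

(* Main.v *)
Require Import Defs.
From Stdlib Require Import Reals List Lra Lia Psatz ClassicalEpsilon.
From Coquelicot Require Import Coquelicot.
Open Scope R_scope.

(** Why the theorem is true.

    Write [gamma] for the particle flow of [f], so that [gamma_t = f (t, gamma)],
    and [w = 1 / gamma_x]. Along particle paths [f_x = - w_t / w] and
    [rho = rho0 / w], and the first equation becomes linear:
    [w_tt + I w = rho0], with [w = 1] and [w_t = - f0'] at time zero. Let [K]
    solve [K'' + I K = 0] with [K = 1], [K' = 0] initially, and use the slow time
    [s] with [dt = K^2 ds]. Then [w = K (1 - s f0' + g rho0)], where [g]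
    depends on [s] only and [g'' = K^3] with zero data. The flow maps [[0,1]] onto
    itself, so [1 / w] has integral one, that is,
    [K = int_0^1 1 / (1 - s f0' + g rho0)]. What remains is one scalar second
    order equation for [g], which is solved by Picard iteration as long as
    [s < 1 / M], with [M] the greatest value of [f0'] (lemmas [ivp_exists] and
    [coefficient_exists]). Going back from labels to positions yields a classical
    solution ([flow_is_solution]).

    Suppose that [M] is attained only at end points and with nonzero slope. Then
    [M - f0'] dominates a multiple of [x (1 - x)] ([parabola_lower_bound]), hence
    [K] grows at most like a logarithm of [1 - s M] ([K_bound]). So [K^2] is
    integrable up to [s = 1 / M], which is reached at a finite time [tstar]. At
    a maximum point [xs] the density vanishes, so [w = K (1 - s M)] tends to
    zero there, and the integral of [f_x] along [xs] is [- ln w]. Moreover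
    [f_xx = (f0'' - k rho0') / w] at [xs] with [k >= 0], and [f0'' rho0' <= 0]
    there, so that [f_xx] diverges too ([stretch_diverges],
    [vorticity_diverges]).

    Uniqueness among classical solutions is an energy estimate for the
    difference of two solutions, in [int (f_x - g_x)^2 + (rho - sigma)^2], that
    serves both boundary conditions ([difference_vanishes],
    [solutions_agree]). Since a solution living past [tstar] would have bounded
    [f_xx], the constructed one is maximal.

    For the second part there are explicit waves: with
    [theta = 2 pi x + (1 - c) t], the pair [f = (c - cos theta) / (2 pi)],
    [rho = 1 - cos theta] solves the system with [I = 0] for all time. It is
    stationary and satisfies the Dirichlet conditions for [c = 1]; it has zero
    mean for [c = 0]. Initially [f0' = sin (2 pi x)], whose maximum point [1/4] is
    interior and has [f0'' = 0]. *)

(** * Calculus with parameters *)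

Notation continuous_plusR := (@continuous_plus _ R_AbsRing R_NormedModule).
Notation continuous_minusR := (@continuous_minus _ R_AbsRing R_NormedModule).
Notation continuous_oppR := (@continuous_opp _ R_AbsRing R_NormedModule).
Notation continuous_multR := (@continuous_mult _ R_AbsRing).
Notation ex_derive_continuousR := (@ex_derive_continuous R_AbsRing R_NormedModule).
Notation is_derive_plusR := (@is_derive_plus R_AbsRing R_NormedModule).
Notation is_derive_minusR := (@is_derive_minus R_AbsRing R_NormedModule).
Notation is_derive_oppR := (@is_derive_opp R_AbsRing R_NormedModule).
Notation is_derive_constR := (@is_derive_const R_AbsRing R_NormedModule).
Notation RInt_minusR := (@RInt_minus R_CompleteNormedModule).
Notation RInt_plusR := (@RInt_plus R_CompleteNormedModule).
Notation RInt_scalR := (@RInt_scal R_CompleteNormedModule).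
Notation RInt_correctR := (@RInt_correct R_CompleteNormedModule).
Notation ex_RInt_continuousR := (@ex_RInt_continuous R_CompleteNormedModule).
Notation is_RInt_uniqueR := (@is_RInt_unique R_CompleteNormedModule).
Notation ex_RInt_plusR := (@ex_RInt_plus R_NormedModule).
Notation ex_RInt_minusR := (@ex_RInt_minus R_NormedModule).
Notation ex_RInt_scalR := (@ex_RInt_scal R_NormedModule).
Notation is_derive_RIntR := (@is_derive_RInt R_NormedModule).
Notation RInt_pointR := (RInt_point (V := R_CompleteNormedModule)).

Definition clamp (a b x : R) : R := Rmax a (Rmin b x).

Notation cl := (clamp 0 1).

Lemma clamp_bound (a b x : R) : a <= b -> a <= clamp a b x <= b.
Proof.
intros H; unfold clamp; split; [apply Rmax_l|].
apply Rmax_lub; [exact H|apply Rmin_l].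
Qed.

Lemma clamp_id (a b x : R) : a <= x <= b -> clamp a b x = x.
Proof.
intros [H1 H2]; unfold clamp.
rewrite Rmin_right by exact H2; apply Rmax_right; exact H1.
Qed.

Lemma cl_I01 (x : R) : I01 (cl x).
Proof. apply clamp_bound; lra. Qed.

Lemma clamp_lipschitz (a b x y : R) :
  Rabs (clamp a b x - clamp a b y) <= Rabs (x - y).
Proof.
unfold clamp, Rmax, Rmin.
repeat destruct (Rle_dec _ _); unfold Rabs;
  repeat destruct (Rcase_abs _); lra.
Qed.

Lemma continuous_of_lipschitz (f : R -> R) (x : R) :
  (forall y, Rabs (f y - f x) <= Rabs (y - x)) -> continuous f x.
Proof.
intros H; apply filterlim_locally; intros eps; exists eps; intros y Hy.
change (Rabs (y - x) < eps) in Hy; change (Rabs (f y - f x) < eps).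
specialize (H y); lra.
Qed.

Lemma continuous_clamp (a b x : R) : continuous (clamp a b) x.
Proof. apply continuous_of_lipschitz; intros y; apply clamp_lipschitz. Qed.

(** Joint continuity, as a predicate to which the composition rules for
    [continuous] apply. *)
Definition cont2 (u : R -> R -> R) (t x : R) : Prop :=
  continuous (fun p : R * R => u (fst p) (snd p)) (t, x).

Lemma cont2_iff (u : R -> R -> R) (t x : R) :
  cont2 u t x <-> continuity_2d_pt u t x.
Proof. symmetry; apply continuity_2d_pt_filterlim. Qed.

Lemma cont2_snd (u : R -> R -> R) (t x : R) :
  cont2 u t x -> continuous (u t) x.
Proof.
intros H.
apply (continuous_comp_2 (fun _ : R => t) (fun y : R => y) u x).
- apply continuous_const.
- apply continuous_id.
- exact H.
Qed.

Lemma cont2_fst (u : R -> R -> R) (t x : R) :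
  cont2 u t x -> continuous (fun s => u s x) t.
Proof.
intros H.
apply (continuous_comp_2 (fun s : R => s) (fun _ : R => x) u t).
- apply continuous_id.
- apply continuous_const.
- exact H.
Qed.

Lemma cont2_of_fst (f : R -> R) (t x : R) :
  continuous f t -> cont2 (fun s _ => f s) t x.
Proof.
intros H; unfold cont2.
apply (continuous_comp (fun p : R * R => fst p) f); [apply continuous_fst|exact H].
Qed.

Lemma cont2_of_snd (f : R -> R) (t x : R) :
  continuous f x -> cont2 (fun _ y => f y) t x.
Proof.
intros H; unfold cont2.
apply (continuous_comp (fun p : R * R => snd p) f); [apply continuous_snd|exact H].
Qed.

Lemma cont2_plus (u v : R -> R -> R) (t x : R) :
  cont2 u t x -> cont2 v t x -> cont2 (fun s y => u s y + v s y) t x.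
Proof. intros; unfold cont2 in *; apply continuous_plusR; assumption. Qed.

Lemma cont2_minus (u v : R -> R -> R) (t x : R) :
  cont2 u t x -> cont2 v t x -> cont2 (fun s y => u s y - v s y) t x.
Proof. intros; unfold cont2 in *; apply continuous_minusR; assumption. Qed.

Lemma cont2_opp (u : R -> R -> R) (t x : R) :
  cont2 u t x -> cont2 (fun s y => - u s y) t x.
Proof. intros; unfold cont2 in *; apply continuous_oppR; assumption. Qed.

Lemma cont2_mult (u v : R -> R -> R) (t x : R) :
  cont2 u t x -> cont2 v t x -> cont2 (fun s y => u s y * v s y) t x.
Proof. intros; unfold cont2 in *; apply continuous_multR; assumption. Qed.

Lemma cont2_pow (u : R -> R -> R) (n : nat) (t x : R) :
  cont2 u t x -> cont2 (fun s y => u s y ^ n) t x.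
Proof.
intros H; induction n as [|n IH].
- unfold cont2; simpl; apply continuous_const.
- exact (cont2_mult _ _ _ _ H IH).
Qed.

Lemma cont2_inv (u : R -> R -> R) (t x : R) :
  cont2 u t x -> u t x <> 0 -> cont2 (fun s y => / u s y) t x.
Proof.
intros H Hn; unfold cont2 in *.
apply (continuous_comp (fun p : R * R => u (fst p) (snd p)) Rinv); [exact H|].
apply continuous_Rinv; exact Hn.
Qed.

Lemma cont2_div (u v : R -> R -> R) (t x : R) :
  cont2 u t x -> cont2 v t x -> v t x <> 0 ->
  cont2 (fun s y => u s y / v s y) t x.
Proof. intros; apply cont2_mult; [|apply cont2_inv]; assumption. Qed.

Lemma cont2_const (c t x : R) : cont2 (fun _ _ => c) t x.
Proof. apply continuous_const. Qed.

Lemma cont2_comp (w : R -> R -> R) (u v : R -> R -> R) (t x : R) :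
  cont2 u t x -> cont2 v t x -> cont2 w (u t x) (v t x) ->
  cont2 (fun s y => w (u s y) (v s y)) t x.
Proof.
intros Hu Hv Hw; unfold cont2.
apply (continuous_comp_2 (fun p : R * R => u (fst p) (snd p))
         (fun p : R * R => v (fst p) (snd p)) w (t, x)); assumption.
Qed.

Ltac cont2_tac :=
  lazymatch goal with
  | |- cont2 (fun _ _ => ?c) _ _ => apply cont2_const
  | |- cont2 (fun s y => @?u s y + @?v s y) _ _ => apply (cont2_plus u v); cont2_tac
  | |- cont2 (fun s y => @?u s y - @?v s y) _ _ => apply (cont2_minus u v); cont2_tac
  | |- cont2 (fun s y => - @?u s y) _ _ => apply (cont2_opp u); cont2_tac
  | |- cont2 (fun s y => @?u s y * @?v s y) _ _ => apply (cont2_mult u v); cont2_tac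
  | |- cont2 (fun s y => @?u s y / @?v s y) _ _ => apply (cont2_div u v); cont2_tac
  | |- cont2 (fun s y => / @?u s y) _ _ => apply (cont2_inv u); cont2_tac
  | |- cont2 (fun s y => @?u s y ^ ?n) _ _ => apply (cont2_pow u n); cont2_tac
  | |- cont2 _ _ _ => try eassumption
  | _ => idtac
  end.

Ltac eq_R := lazymatch goal with |- @eq _ ?a ?b => change (@eq R a b) end.
Ltac ring_R := eq_R; ring.

Lemma RInt_cst (a b c : R) : RInt (fun _ => c) a b = (b - a) * c.
Proof. exact (RInt_const a b c). Qed.

Lemma ex_RInt_cont (f : R -> R) (a b : R) :
  (forall x, continuous f x) -> ex_RInt f a b.
Proof. intros H; apply ex_RInt_continuousR; auto. Qed.

Lemma is_derive_RInt_cont (f : R -> R) (a x : R) :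
  (forall y, continuous f y) -> is_derive (fun z => RInt f a z) x (f x).
Proof.
intros H; apply (is_derive_RIntR f _ a); [|apply H].
exists (mkposreal 1 Rlt_0_1); intros y _; apply RInt_correctR, ex_RInt_cont, H.
Qed.

Lemma continuous_of_is_derive (f : R -> R) (x l : R) :
  is_derive f x l -> continuous f x.
Proof.
intros H; apply ex_derive_continuousR.
exists l; exact H.
Qed.

(** Split the increment at [RInt (w t) 0 y]: the first part is controlled by
    uniform continuity of [w] near [t], the second by continuity of the
    primitive of the frozen integrand [w t]. *)
Lemma cont2_RInt (w : R -> R -> R) (t x : R) :
  locally t (fun s => forall a, cont2 w s a) ->
  cont2 (fun s y => RInt (w s) 0 y) t x.
Proof.
intros Hw; apply cont2_iff; intros eps.
assert (Hwt : forall a, cont2 w t a) by exact (locally_singleton _ _ Hw).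
set (B := Rabs x + 1).
assert (HB : 0 < B) by (unfold B; generalize (Rabs_pos x); lra).
assert (He1 : 0 < eps / (2 * B)) by (apply Rdiv_lt_0_compat; [apply cond_pos|lra]).
destruct (uniform_continuity_2d_1d' w (- B) B t
            (fun a _ => proj1 (cont2_iff w t a) (Hwt a)) (mkposreal _ He1))
  as [d1 Hd1].
assert (Hc : continuous (fun y => RInt (w t) 0 y) x).
{ apply continuous_of_is_derive with (w t x), is_derive_RInt_cont.
  intros y; apply cont2_snd, Hwt. }
assert (He2 : 0 < eps / 2) by (destruct eps; simpl; lra).
destruct (proj1 (filterlim_locally _ _) Hc (mkposreal _ He2)) as [d2 Hd2].
destruct Hw as [d3 Hd3].
assert (Hd : 0 < Rmin (Rmin d1 d2) (Rmin d3 1)).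
{ repeat apply Rmin_pos; try apply cond_pos; lra. }
exists (mkposreal _ Hd); simpl; intros s y Hs Hy.
destruct (Rmin_Rgt_l _ _ _ Hs) as [Hs12 Hs34]; destruct (Rmin_Rgt_l _ _ _ Hy) as [Hy12 Hy34].
destruct (Rmin_Rgt_l _ _ _ Hs12) as [Hs1 _]; destruct (Rmin_Rgt_l _ _ _ Hs34) as [Hs3 _].
destruct (Rmin_Rgt_l _ _ _ Hy12) as [_ Hy2]; destruct (Rmin_Rgt_l _ _ _ Hy34) as [_ Hy1].
specialize (Hd2 y Hy2); change (Rabs (RInt (w t) 0 y - RInt (w t) 0 x) < eps / 2) in Hd2.
assert (HyB : Rabs y <= B).
{ unfold B; replace y with ((y - x) + x) at 1 by ring.
  eapply Rle_trans; [apply Rabs_triang|lra]. }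
assert (Hi : forall a b, ex_RInt (w s) a b /\ ex_RInt (w t) a b).
{ intros a b; split; apply ex_RInt_cont; intros z; apply cont2_snd; [apply Hd3|apply Hwt]; auto. }
assert (H1 : Rabs (RInt (w s) 0 y - RInt (w t) 0 y) <= eps / 2).
{ replace (RInt (w s) 0 y - RInt (w t) 0 y)
    with (RInt (fun a => w s a - w t a) 0 y).
  2:{ apply RInt_minusR; apply Hi. }
  assert (Hex : forall a b, ex_RInt (fun a => w s a - w t a) a b).
  { intros a b; apply ex_RInt_minusR; apply Hi. }
  assert (Hpt : forall a, - B <= a <= B -> Rabs (w s a - w t a) <= eps / (2 * B)).
  { intros a Ha; left; apply (Hd1 a t a s); trivial.
    - generalize (cond_pos d1); lra.
    - apply Rabs_lt_between in Hs1; lra.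
    - rewrite Rminus_diag, Rabs_R0; apply cond_pos. }
  apply Rabs_le_between in HyB.
  assert (Hk : forall z, 0 <= z <= B -> z * (eps / (2 * B)) <= eps / 2).
  { intros z Hz; replace (eps / 2) with (B * (eps / (2 * B))) by (field; lra).
    apply Rmult_le_compat_r; lra. }
  destruct (Rle_dec 0 y) as [H0|H0].
  - eapply Rle_trans; [apply abs_RInt_le_const with (M := eps / (2 * B))|].
    + exact H0.
    + apply Hex.
    + intros a Ha; apply Hpt; lra.
    + rewrite Rminus_0_r; apply Hk; lra.
  - rewrite <- (opp_RInt_swap (fun a => w s a - w t a)) by apply Hex.
    change (opp ?z) with (- z); rewrite Rabs_Ropp.
    eapply Rle_trans; [apply abs_RInt_le_const with (M := eps / (2 * B))|].
    + lra.
    + apply Hex.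
    + intros a Ha; apply Hpt; lra.
    + apply Hk; lra. }
replace (RInt (w s) 0 y - RInt (w t) 0 x)
  with ((RInt (w s) 0 y - RInt (w t) 0 y) + (RInt (w t) 0 y - RInt (w t) 0 x)) by ring.
eapply Rle_lt_trans; [apply Rabs_triang|]; lra.
Qed.

Lemma continuous_RInt_param (w : R -> R -> R) (t x : R) :
  locally t (fun s => forall a, cont2 w s a) ->
  continuous (fun s => RInt (w s) 0 x) t.
Proof. intros H; exact (cont2_fst _ _ _ (cont2_RInt w t x H)). Qed.

Lemma is_derive_RInt_param_cont (w w' : R -> R -> R) (t x : R) :
  locally t (fun s => forall a,
    is_derive (fun r => w r a) s (w' s a) /\ cont2 w s a /\ cont2 w' s a) ->
  is_derive (fun s => RInt (w s) 0 x) t (RInt (w' t) 0 x).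
Proof.
intros H.
rewrite (RInt_ext (w' t) (fun a => Derive (fun s => w s a) t)).
2:{ intros a _; symmetry; apply is_derive_unique; apply (locally_singleton _ _ H). }
apply (is_derive_RInt_param w).
- revert H; apply filter_imp; intros s Hs a _; eexists; apply Hs.
- intros a _; apply continuity_2d_pt_ext_loc with w'.
  + destruct H as [d Hd]; exists d; intros s y Hs _; symmetry.
    apply is_derive_unique; apply Hd; exact Hs.
  + apply cont2_iff; apply (locally_singleton _ _ H).
- revert H; apply filter_imp; intros s Hs.
  apply ex_RInt_cont; intros a; apply cont2_snd, Hs.
Qed.

Lemma continuous_continuity_pt (f : R -> R) (x : R) :
  continuous f x -> continuity_pt f x.
Proof. intros H; apply continuity_pt_filterlim; exact H. Qed.

(** The fundamental theorem for functions that are merely continuous at the end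
    points, as solutions are at the initial time. *)
Lemma RInt_derive_open (F h : R -> R) (a b : R) :
  a <= b ->
  (forall x, a <= x <= b -> continuous F x) ->
  (forall x, continuous h x) ->
  (forall x, a < x < b -> is_derive F x (h x)) ->
  RInt h a b = F b - F a.
Proof.
intros Hab HF Hh Hd.
destruct (MVT_gen (fun x => F x - RInt h a x) a b (fun _ => 0)) as [c [_ Hc]].
- rewrite Rmin_left, Rmax_right by exact Hab; intros x Hx.
  replace 0 with (minus (h x) (h x)) by (unfold minus, plus, opp; simpl; ring).
  apply is_derive_minusR; [apply Hd, Hx|].
  apply is_derive_RInt_cont, Hh.
- rewrite Rmin_left, Rmax_right by exact Hab; intros x Hx.
  apply continuous_continuity_pt.
  apply continuous_minusR; [apply HF, Hx|].
  apply continuous_of_is_derive with (h x), is_derive_RInt_cont, Hh.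
- rewrite RInt_point in Hc; change zero with 0 in Hc; lra.
Qed.

(** Finitely many of the neighbourhoods on which [u] varies by less than 1
    cover the rectangle. *)
Lemma cont2_bounded (u : R -> R -> R) (a b : R) :
  (forall t x, cont2 u t x) ->
  exists C, 0 <= C /\ forall t x, a <= t <= b -> 0 <= x <= 1 -> Rabs (u t x) <= C.
Proof.
intros Hu.
assert (Hd : forall p : R * R, exists d : posreal, forall s y,
  Rabs (s - fst p) < d -> Rabs (y - snd p) < d ->
  Rabs (u s y) < Rabs (u (fst p) (snd p)) + 1).
{ intros [t x]; destruct (proj1 (cont2_iff u t x) (Hu t x) (mkposreal 1 Rlt_0_1)) as [d Hd].
  exists d; simpl in *; intros s y Hs Hy; specialize (Hd s y Hs Hy).
  replace (u s y) with ((u s y - u t x) + u t x) by ring.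
  eapply Rle_lt_trans; [apply Rabs_triang|lra]. }
pose (delta := fun p : R * R => proj1_sig (constructive_indefinite_description _ (Hd p))).
assert (Hdelta : forall p s y, Rabs (s - fst p) < delta p -> Rabs (y - snd p) < delta p ->
  Rabs (u s y) < Rabs (u (fst p) (snd p)) + 1).
{ intros p; unfold delta; destruct (constructive_indefinite_description _ (Hd p)); auto. }
destruct (classic (exists l : list (Compactness.Tn 2 R), forall x : Compactness.Tn 2 R,
  bounded_n 2 (a, (0, tt)) (b, (1, tt)) x ->
  exists t, In t l /\ bounded_n 2 (a, (0, tt)) (b, (1, tt)) t /\
    close_n 2 (delta (fst t, fst (snd t))) x t)) as [[l Hl]|Hn].
2:{ exfalso; exact (compactness_list 2 (a, (0, tt)) (b, (1, tt)) (fun t => delta (fst t, fst (snd t))) Hn). }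
assert (Hm : exists C, 0 <= C /\ forall t, In t l -> Rabs (u (fst t) (fst (snd t))) + 1 <= C).
{ clear Hl; induction l as [|q l [C [HC0 HC]]].
  - exists 0; split; [lra|intros t []].
  - exists (Rmax C (Rabs (u (fst q) (fst (snd q))) + 1)); split.
    + eapply Rle_trans; [exact HC0|apply Rmax_l].
    + intros t [<-|Ht]; [apply Rmax_r|].
      eapply Rle_trans; [apply HC, Ht|apply Rmax_l]. }
destruct Hm as [C [HC0 HC]]; exists C; split; [exact HC0|]; intros t x Ht Hx.
destruct (Hl (t, (x, tt))) as [[t0 [x0 []]] [Hin [_ Hcl]]]; [simpl; tauto|].
simpl in Hcl; left.
eapply Rlt_le_trans; [apply (Hdelta (t0, x0)); apply Hcl|].
exact (HC _ Hin).
Qed.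

Lemma nonincreasing_of_derive (f df : R -> R) (a b : R) :
  a <= b ->
  (forall x, a <= x <= b -> continuous f x) ->
  (forall x, a < x < b -> is_derive f x (df x)) ->
  (forall x, a < x < b -> df x <= 0) -> f b <= f a.
Proof.
intros Hab Hc Hd Hle.
destruct (Req_dec a b) as [<-|Hne]; [lra|].
destruct (MVT_gen f a b (fun x => Rmin (df x) 0)) as [c [_ H]].
- rewrite Rmin_left, Rmax_right by exact Hab; intros x Hx.
  rewrite Rmin_left by (apply Hle, Hx); apply Hd, Hx.
- rewrite Rmin_left, Rmax_right by exact Hab; intros x Hx.
  apply continuous_continuity_pt, Hc, Hx.
- assert (Rmin (df c) 0 <= 0) by apply Rmin_r; nra.
Qed.

(** [E t * exp (- C t)] is nonincreasing. *)
Lemma gronwall_zero (E E' : R -> R) (C T : R) :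
  0 <= T ->
  (forall t, 0 <= t <= T -> continuous E t) ->
  (forall t, 0 < t < T -> is_derive E t (E' t)) ->
  (forall t, 0 < t < T -> E' t <= C * E t) ->
  E 0 = 0 -> E T <= 0.
Proof.
intros HT Hc Hd Hle H0.
assert (H : E T * exp (- C * T) <= E 0 * exp (- C * 0)).
{ apply (nonincreasing_of_derive (fun t => E t * exp (- C * t))
           (fun t => (E' t - C * E t) * exp (- C * t)) 0 T HT).
  - intros t Ht; apply continuous_multR; [apply Hc, Ht|].
    apply ex_derive_continuousR; auto_derive; trivial.
  - intros t Ht; generalize (Hd t Ht); intros HE.
    evar_last; [apply (@is_derive_mult R_AbsRing E (fun t => exp (- C * t)));
      [exact HE|auto_derive; [trivial|reflexivity]|apply Rmult_comm]|].
    unfold plus, mult; simpl; ring.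
  - intros t Ht; generalize (Hle t Ht) (exp_pos (- C * t)); nra. }
rewrite H0 in H; generalize (exp_pos (- C * T)); nra.
Qed.

Lemma RInt_zero_nonneg (h : R -> R) (a b : R) :
  (forall x, continuous h x) -> (forall x, a <= x <= b -> 0 <= h x) ->
  RInt h a b <= 0 -> forall x, a < x < b -> h x = 0.
Proof.
intros Hc Hp H0 x Hx.
assert (Hex : forall c d, ex_RInt h c d) by (intros; apply ex_RInt_cont, Hc).
destruct (Req_dec (h x) 0) as [E|E]; [exact E|exfalso].
assert (Hpos : 0 < h x) by (generalize (Hp x); lra).
destruct (proj1 (filterlim_locally _ _) (Hc x) (mkposreal _ Hpos)) as [d Hd].
set (e := Rmin (d / 2) (b - x)).
assert (He : 0 < e) by (apply Rmin_pos; [destruct d; simpl|]; lra).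
assert (He1 : e <= d / 2) by apply Rmin_l.
assert (He2 : e <= b - x) by apply Rmin_r.
assert (H1 : 0 < RInt h x (x + e)).
{ apply RInt_gt_0; [lra| |intros; apply Hc].
  intros y Hy; assert (Hb : Rabs (h y - h x) < h x).
  { apply (Hd y); change (Rabs (y - x) < d); rewrite Rabs_pos_eq; [destruct d; simpl in *; lra|lra]. }
  apply Rabs_lt_between in Hb; lra. }
assert (H2 : 0 <= RInt h a x) by (apply RInt_ge_0; [lra|apply Hex|intros; apply Hp; lra]).
assert (H3 : 0 <= RInt h (x + e) b) by (apply RInt_ge_0; [lra|apply Hex|intros; apply Hp; lra]).
rewrite <- (RInt_Chasles h a x b) in H0 by apply Hex.
rewrite <- (RInt_Chasles h x (x + e) b) in H0 by apply Hex.
unfold plus in H0; simpl in H0; lra.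
Qed.

(** * Derivatives relative to the unit interval *)

Lemma is_dx_eps (g : R -> R) (x l : R) :
  I01 x ->
  (is_dx g x l <->
   forall eps : posreal, exists d : posreal, forall y, I01 y ->
     Rabs (y - x) < d -> Rabs (g y - g x - (y - x) * l) <= eps * Rabs (y - x)).
Proof.
intros Hx; split.
- intros [_ H] eps.
  assert (Hl : is_filter_lim (within I01 (locally x)) x).
  { intros P HP; unfold within; revert HP; apply filter_imp; auto. }
  destruct (H x Hl eps) as [d Hd]; exists d; intros y Hy Hyx.
  exact (Hd y Hyx Hy).
- intros H; apply (is_dx_iff g x l Hx); apply filterlim_locally; intros eps.
  assert (He : 0 < eps / 2) by (destruct eps; simpl; lra).
  destruct (H (mkposreal _ He)) as [d Hd]; exists d; intros y Hyx [Hy Hne].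
  specialize (Hd y Hy Hyx); simpl in Hd.
  assert (Hp : 0 < Rabs (y - x)) by (apply Rabs_pos_lt; lra).
  change (Rabs ((g y - g x) / (y - x) - l) < eps).
  replace ((g y - g x) / (y - x) - l)
    with ((g y - g x - (y - x) * l) / (y - x)) by (field; lra).
  unfold Rdiv; rewrite Rabs_mult, Rabs_inv.
  apply Rle_lt_trans with (eps / 2); [|destruct eps; simpl; lra].
  apply Rmult_le_reg_r with (Rabs (y - x)); trivial.
  rewrite Rmult_assoc, Rinv_l by lra; lra.
Qed.

Lemma is_derive_eps (g : R -> R) (x l : R) :
  is_derive g x l <->
  forall eps : posreal, exists d : posreal, forall y,
    Rabs (y - x) < d -> Rabs (g y - g x - (y - x) * l) <= eps * Rabs (y - x).
Proof.
split.
- intros [_ H] eps.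
  assert (Hl : is_filter_lim (locally x) x) by (intros P HP; exact HP).
  destruct (H x Hl eps) as [d Hd]; exists d; intros y Hy; exact (Hd y Hy).
- intros H; split; [apply @is_linear_scal_l|].
  intros z Hz; apply (@is_filter_lim_locally_unique R_AbsRing R_NormedModule) in Hz; subst z.
  intros eps; destruct (H eps) as [d Hd]; exists d; intros y Hy; exact (Hd y Hy).
Qed.

Lemma is_dx_ext (g h : R -> R) (x l : R) :
  I01 x -> (forall y, I01 y -> g y = h y) -> is_dx g x l -> is_dx h x l.
Proof.
intros Hx E H; apply is_dx_eps; trivial; intros eps.
destruct (proj1 (is_dx_eps g x l Hx) H eps) as [d Hd].
exists d; intros y Hy; rewrite <- !E by assumption; apply Hd, Hy.
Qed.

Lemma dx_ext (g h : R -> R) (x : R) :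
  I01 x -> (forall y, I01 y -> g y = h y) -> ex_dx g x -> dx g x = dx h x.
Proof.
intros Hx E H; symmetry; apply is_dx_unique; trivial.
apply is_dx_ext with g; trivial; apply dx_correct, H.
Qed.

Lemma is_dx_of_derive (g : R -> R) (x l : R) :
  I01 x -> is_derive g x l -> is_dx g x l.
Proof.
intros Hx H; apply is_dx_eps; trivial; intros eps.
destruct (proj1 (is_derive_eps g x l) H eps) as [d Hd]; exists d; auto.
Qed.

Lemma is_derive_of_dx (g : R -> R) (x l : R) :
  0 < x < 1 -> is_dx g x l -> is_derive g x l.
Proof.
intros Hx H; apply is_derive_eps; intros eps.
assert (Hx' : I01 x) by (unfold I01; lra).
destruct (proj1 (is_dx_eps g x l Hx') H eps) as [d Hd].
assert (Hp : 0 < Rmin d (Rmin x (1 - x))).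
{ repeat apply Rmin_pos; [apply cond_pos|lra|lra]. }
exists (mkposreal _ Hp); simpl; intros y Hy.
destruct (Rmin_Rgt_l _ _ _ Hy) as [H1 H23]; destruct (Rmin_Rgt_l _ _ _ H23) as [H2 H3].
apply Hd; [|exact H1].
apply Rabs_lt_between in H2; apply Rabs_lt_between in H3; unfold I01; lra.
Qed.

Lemma continuous_cl_of_dx (g : R -> R) :
  (forall x, I01 x -> ex_dx g x) -> forall x, continuous (fun y => g (cl y)) x.
Proof.
intros Hg x; apply filterlim_locally; intros eps.
destruct (Hg (cl x) (cl_I01 x)) as [l Hl].
destruct (proj1 (is_dx_eps g _ l (cl_I01 x)) Hl (mkposreal 1 Rlt_0_1)) as [d Hd].
set (k := Rabs l + 1).
assert (Hk : 0 < k) by (unfold k; generalize (Rabs_pos l); lra).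
assert (Hp : 0 < Rmin d (eps / k)).
{ apply Rmin_pos; [apply cond_pos|apply Rdiv_lt_0_compat; [apply cond_pos|exact Hk]]. }
exists (mkposreal _ Hp); intros y Hy; change (Rabs (y - x) < Rmin d (eps / k)) in Hy.
change (Rabs (g (cl y) - g (cl x)) < eps).
assert (H1 : Rabs (cl y - cl x) <= Rabs (y - x)) by apply clamp_lipschitz.
assert (Hy1 : Rabs (cl y - cl x) < d) by (eapply Rle_lt_trans; [exact H1|]; eapply Rlt_le_trans; [exact Hy|apply Rmin_l]).
assert (Hy2 : Rabs (cl y - cl x) < eps / k) by (eapply Rle_lt_trans; [exact H1|]; eapply Rlt_le_trans; [exact Hy|apply Rmin_r]).
specialize (Hd _ (cl_I01 y) Hy1); simpl in Hd.
replace (g (cl y) - g (cl x))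
  with ((g (cl y) - g (cl x) - (cl y - cl x) * l) + (cl y - cl x) * l) by ring.
eapply Rle_lt_trans; [apply Rabs_triang|]; rewrite Rabs_mult.
apply Rle_lt_trans with (Rabs (cl y - cl x) * k); [unfold k; lra|].
apply Rmult_lt_reg_r with (/ k); [apply Rinv_0_lt_compat, Hk|].
rewrite Rmult_assoc, Rinv_r by lra; rewrite Rmult_1_r; exact Hy2.
Qed.

(** A function on the unit interval and its derivative give a function on the
    line that is differentiable, in the ordinary sense, at the points of the
    interval; the end points need no separate treatment afterwards. *)
Definition affine_extension (g : R -> R) (x : R) : R :=
  g (cl x) + (x - cl x) * dx g (cl x).

Lemma affine_extension_id (g : R -> R) (x : R) :
  I01 x -> affine_extension g x = g x.
Proof.
intros H; unfold affine_extension; rewrite clamp_id by exact H; ring.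
Qed.

Lemma is_derive_affine_extension (g : R -> R) (x : R) :
  (forall y, I01 y -> ex_dx g y) ->
  (forall y, continuous (fun z => dx g (cl z)) y) ->
  I01 x -> is_derive (affine_extension g) x (dx g x).
Proof.
intros Hg Hc Hx; apply is_derive_eps; intros eps.
assert (He : 0 < eps / 2) by (destruct eps; simpl; lra).
destruct (proj1 (is_dx_eps g x _ Hx) (dx_correct g x (Hg x Hx)) (mkposreal _ He)) as [d1 Hd1].
destruct (proj1 (filterlim_locally _ _) (Hc x) (mkposreal _ He)) as [d2 Hd2].
assert (Hd : 0 < Rmin d1 d2) by (apply Rmin_pos; apply cond_pos).
exists (mkposreal _ Hd); simpl; intros y Hy.
rewrite (affine_extension_id g x Hx); unfold affine_extension.
assert (H1 : Rabs (cl y - x) <= Rabs (y - x)).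
{ rewrite <- (clamp_id 0 1 x) at 1 by exact Hx; apply clamp_lipschitz. }
assert (H2 : Rabs (y - cl y) <= Rabs (y - x)).
{ revert Hx; unfold I01, clamp, Rmax, Rmin; intros Hx.
  repeat destruct (Rle_dec _ _); unfold Rabs; repeat destruct (Rcase_abs _); lra. }
assert (Hy1 : Rabs (cl y - x) < d1) by (eapply Rle_lt_trans; [exact H1|]; eapply Rlt_le_trans; [exact Hy|apply Rmin_l]).
assert (Hy2 : Rabs (y - x) < d2) by (eapply Rlt_le_trans; [exact Hy|apply Rmin_r]).
specialize (Hd1 _ (cl_I01 y) Hy1); simpl in Hd1.
specialize (Hd2 _ Hy2); change (Rabs (dx g (cl y) - dx g (cl x)) < eps / 2) in Hd2.
rewrite (clamp_id 0 1 x Hx) in Hd2.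
replace (g (cl y) + (y - cl y) * dx g (cl y) - g x - (y - x) * dx g x)
  with ((g (cl y) - g x - (cl y - x) * dx g x)
        + (y - cl y) * (dx g (cl y) - dx g x)) by ring.
eapply Rle_trans; [apply Rabs_triang|]; rewrite (Rabs_mult (y - cl y)).
assert (Rabs (y - cl y) * Rabs (dx g (cl y) - dx g x) <= Rabs (y - x) * (eps / 2)).
{ apply Rmult_le_compat; try apply Rabs_pos; lra. }
nra.
Qed.

(** * Uniqueness of classical solutions *)

Arguments sol_lifespan {_ _ _ _ _ _}.
Arguments sol_ex_dx {_ _ _ _ _ _}.
Arguments sol_cont_f {_ _ _ _ _ _}.
Arguments sol_cont_fx {_ _ _ _ _ _}.
Arguments sol_cont_fxx {_ _ _ _ _ _}.
Arguments sol_cont_rho {_ _ _ _ _ _}.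
Arguments sol_cont_rhox {_ _ _ _ _ _}.
Arguments sol_ex_dt {_ _ _ _ _ _}.
Arguments sol_eq_f {_ _ _ _ _ _}.
Arguments sol_eq_rho {_ _ _ _ _ _}.
Arguments sol_init {_ _ _ _ _ _}.
Arguments sol_bc {_ _ _ _ _ _}.

Lemma cont2_of_slab (T : Rbar) (u : R -> R -> R) (t1 : R) :
  continuous_on_slab T u -> 0 <= t1 -> Rbar_lt t1 T ->
  forall t x, cont2 (fun s y => u (clamp 0 t1 s) (cl y)) t x.
Proof.
intros Hu H0 HT t x.
assert (HD : forall s y, time_slab T (clamp 0 t1 s, cl y)).
{ intros s y; assert (H := clamp_bound 0 t1 s H0); split; [|split]; simpl.
  - apply H.
  - apply (Rbar_le_lt_trans (Finite _) (Finite t1) T); [apply H|exact HT].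
  - apply cl_I01. }
unfold cont2.
apply (filterlim_comp _ _ _ (fun p : R * R => (clamp 0 t1 (fst p), cl (snd p)))
         (fun p : R * R => u (fst p) (snd p)) _ (within (time_slab T) (locally (clamp 0 t1 t, cl x)))).
- intros P HP; unfold within in HP.
  assert (Hf : continuous (fun p : R * R => (clamp 0 t1 (fst p), cl (snd p))) (t, x)).
  { intros Q [d Hd]; exists d; intros q [Hq1 Hq2]; apply Hd; split; simpl.
    - eapply Rle_lt_trans; [apply clamp_lipschitz|exact Hq1].
    - eapply Rle_lt_trans; [apply clamp_lipschitz|exact Hq2]. }
  specialize (Hf _ HP); unfold filtermap in *.
  revert Hf; apply filter_imp; intros q Hq; apply Hq, HD.
- exact (Hu (clamp 0 t1 t, cl x) (HD t x)).
Qed.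

(** Expand the nonnegative integral of [(p - c)^2], where [c] is the integral
    of [p]; an interval of length at most 1 leaves no constant. *)
Lemma sq_RInt_le (p : R -> R) (a b : R) :
  (forall x, continuous p x) -> a <= b -> b - a <= 1 ->
  RInt p a b ^ 2 <= RInt (fun x => p x ^ 2) a b.
Proof.
intros Hp Hab H1; pose (c := RInt p a b : R); change (RInt p a b) with c.
assert (Hp2 : forall x, continuous (fun x => p x ^ 2) x).
{ intros x; simpl; apply continuous_multR; [apply Hp|].
  apply continuous_multR; [apply Hp|apply continuous_const]. }
assert (H : 0 <= RInt (fun x => p x ^ 2 + (- (2 * c) * p x + c ^ 2)) a b).
{ apply RInt_ge_0; trivial.
  - apply ex_RInt_cont; intros x.
    apply continuous_plusR; [apply Hp2|].
    apply continuous_plusR; [|apply continuous_const].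
    apply continuous_multR; [apply continuous_const|apply Hp].
  - intros x _; replace (p x ^ 2 + _) with ((p x - c) ^ 2) by ring; apply pow2_ge_0. }
rewrite RInt_plusR in H.
2:{ apply ex_RInt_cont, Hp2. }
2:{ apply ex_RInt_plusR; [|apply ex_RInt_const].
    apply ex_RInt_scalR, ex_RInt_cont, Hp. }
rewrite RInt_plusR in H.
2:{ apply ex_RInt_scalR, ex_RInt_cont, Hp. }
2:{ apply ex_RInt_const. }
rewrite (RInt_scalR p) in H by (apply ex_RInt_cont, Hp).
rewrite RInt_const in H.
unfold plus, scal in H; simpl in H; unfold mult in H; simpl in H; fold c in H.
assert (Hc : 0 <= (1 - (b - a)) * c ^ 2) by (apply Rmult_le_pos; [lra|apply pow2_ge_0]).
assert (Hlin : forall I : R, 0 <= I + (- (2 * c) * c + (b - a) * c ^ 2) -> c ^ 2 <= I).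
{ intros I HI; clear H Hp2; clearbody c; nra. }
apply Hlin; exact H.
Qed.

(** In the periodic case the difference has zero mean, so its primitive takes
    equal values at both ends and has a critical point. *)
Lemma bc_pinned_difference (bc : boundary_condition) (f g r s F : R -> R) :
  bc = dirichlet \/ bc = periodic -> bc f r -> bc g s ->
  (forall x, continuous F x) -> (forall x, I01 x -> F x = f x - g x) ->
  (forall x, continuous (fun y => f (cl y)) x) ->
  (forall x, continuous (fun y => g (cl y)) x) ->
  exists x0, I01 x0 /\ F x0 = 0.
Proof.
intros [-> | ->] Hf Hg HF E Cf Cg.
- exists 0; assert (H0 : I01 0) by (unfold I01; lra); split; trivial.
  rewrite E by exact H0; destruct Hf, Hg; lra.
- destruct Hf as (_ & _ & _ & Hf), Hg as (_ & _ & _ & Hg).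
  destruct (MVT_gen (fun x => RInt F 0 x) 0 1 F) as [c [Hc H]].
  + intros x _; apply is_derive_RInt_cont, HF.
  + intros x _; apply continuous_continuity_pt, continuous_of_is_derive with (F x).
    apply is_derive_RInt_cont, HF.
  + rewrite Rmin_left, Rmax_right in Hc by lra; exists c; split; [exact Hc|].
    rewrite RInt_point in H; change zero with 0 in H.
    enough (HI : RInt F 0 1 = 0) by lra.
    rewrite (RInt_ext F (fun x => f (cl x) - g (cl x))).
    * rewrite (RInt_minusR (fun x => f (cl x)) (fun x => g (cl x))) by (apply ex_RInt_cont; assumption).
      rewrite (RInt_ext (fun x => f (cl x)) f), (RInt_ext (fun x => g (cl x)) g).
      -- rewrite Hf, Hg; unfold minus, plus, opp; simpl; ring.
      -- rewrite Rmin_left, Rmax_right by lra; intros x Hx; rewrite clamp_id; trivial; lra.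
      -- rewrite Rmin_left, Rmax_right by lra; intros x Hx; rewrite clamp_id; trivial; lra.
    * rewrite Rmin_left, Rmax_right by lra; intros x Hx.
      rewrite clamp_id by lra; apply E; unfold I01; lra.
Qed.

Lemma two_mul_le (C k a b : R) : Rabs k <= C -> 2 * (k * a * b) <= C * (a ^ 2 + b ^ 2).
Proof.
intros H; apply Rabs_le_between in H.
assert (0 <= (C - k) * (a + b) ^ 2) by (apply Rmult_le_pos; [lra|apply pow2_ge_0]).
assert (0 <= (C + k) * (a - b) ^ 2) by (apply Rmult_le_pos; [lra|apply pow2_ge_0]).
nra.
Qed.

(** What is left of the energy balance once total derivatives are removed:
    each term is quadratic in [F], [p], [r] with a bounded coefficient. *)
Lemma energy_source_le (C F p r fx gx gxx sx s : R) :
  Rabs fx <= C -> Rabs gx <= C -> Rabs gxx <= C -> Rabs sx <= C -> Rabs s <= C ->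
  fx * (p ^ 2 + r ^ 2) + 2 * p * (- F * gxx + (fx + gx) * p - r)
    + 2 * r * (- F * sx + r * fx + s * p)
  <= (7 * C + 1) * (p ^ 2 + r ^ 2) + 2 * C * F ^ 2.
Proof.
intros H1 H2 H3 H4 H5.
assert (A1 : 2 * ((- gxx) * p * F) <= C * (p ^ 2 + F ^ 2)) by (apply two_mul_le; rewrite Rabs_Ropp; exact H3).
assert (A2 : 2 * ((- sx) * r * F) <= C * (r ^ 2 + F ^ 2)) by (apply two_mul_le; rewrite Rabs_Ropp; exact H4).
assert (A3 : 2 * (s * r * p) <= C * (r ^ 2 + p ^ 2)) by (apply two_mul_le; exact H5).
assert (A4 : 2 * ((- (1)) * p * r) <= 1 * (p ^ 2 + r ^ 2)) by (apply two_mul_le; rewrite Rabs_Ropp, Rabs_R1; lra).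
apply Rabs_le_between in H1; apply Rabs_le_between in H2.
assert (P := pow2_ge_0 p); assert (Q := pow2_ge_0 r).
assert (B1 : fx * p ^ 2 <= C * p ^ 2) by (apply Rmult_le_compat_r; lra).
assert (B2 : gx * p ^ 2 <= C * p ^ 2) by (apply Rmult_le_compat_r; lra).
assert (B3 : fx * r ^ 2 <= C * r ^ 2) by (apply Rmult_le_compat_r; lra).
assert (C0 : 0 <= C) by lra.
assert (0 <= C * p ^ 2) by (apply Rmult_le_pos; lra).
assert (0 <= C * r ^ 2) by (apply Rmult_le_pos; lra).
lra.
Qed.

(** The linear problem solved by the difference [F] of two velocities and the
    difference [q] of two densities, with [p = F_x]. The energy
    [int p^2 + q^2] obeys Gronwall's inequality: transport by [f] integrates to
    zero because the flux through the ends balances, the spatially constant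
    forcing [dI] drops out because [F] takes equal values at both ends, and [F]
    itself is controlled by the energy because it vanishes somewhere. *)
Lemma difference_vanishes (t1 : R) (f fx gx gxx s sx F p px q qx : R -> R -> R) (dI : R -> R) :
  0 < t1 ->
  (forall t x, cont2 f t x) -> (forall t x, cont2 fx t x) ->
  (forall t x, cont2 gx t x) -> (forall t x, cont2 gxx t x) ->
  (forall t x, cont2 s t x) -> (forall t x, cont2 sx t x) ->
  (forall t x, cont2 F t x) -> (forall t x, cont2 p t x) ->
  (forall t x, cont2 px t x) -> (forall t x, cont2 q t x) ->
  (forall t x, cont2 qx t x) -> (forall t, continuous dI t) ->
  (forall t x, 0 < t < t1 -> is_derive (fun r => p r x) t
     (- f t x * px t x - F t x * gxx t x + (fx t x + gx t x) * p t x - q t x + dI t)) ->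
  (forall t x, 0 < t < t1 -> is_derive (fun r => q r x) t
     (- f t x * qx t x - F t x * sx t x + q t x * fx t x + s t x * p t x)) ->
  (forall t x, 0 < x < 1 -> is_derive (F t) x (p t x)) ->
  (forall t x, 0 < x < 1 -> is_derive (f t) x (fx t x)) ->
  (forall t x, 0 < x < 1 -> is_derive (p t) x (px t x)) ->
  (forall t x, 0 < x < 1 -> is_derive (q t) x (qx t x)) ->
  (forall t, f t 1 * (p t 1 ^ 2 + q t 1 ^ 2) = f t 0 * (p t 0 ^ 2 + q t 0 ^ 2)) ->
  (forall t, F t 1 = F t 0) ->
  (forall t, exists x0, I01 x0 /\ F t x0 = 0) ->
  (forall x, 0 < x < 1 -> p 0 x = 0 /\ q 0 x = 0) ->
  forall x, I01 x -> F t1 x = 0 /\ q t1 x = 0.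
Proof.
intros Ht1 Cf Cfx Cgx Cgxx Cs Csx CF Cp Cpx Cq Cqx CdI Dp Dq DF Df Dpx Dqx Hbf HbF Hzero Hinit x1 Hx1.
pose (e := fun t x => p t x ^ 2 + q t x ^ 2).
assert (Ce : forall t x, cont2 e t x) by (intros; apply cont2_plus; apply cont2_pow; auto).
pose (E := fun t => RInt (e t) 0 1).
assert (HFE : forall t y, 0 <= y <= 1 -> F t y ^ 2 <= E t).
{ intros t y Hy; destruct (Hzero t) as [x0 [Hx0 HF0]]; unfold I01 in Hx0.
  assert (CFs : forall z, continuous (F t) z) by (intros; apply cont2_snd, CF).
  assert (Cps : forall z, continuous (p t) z) by (intros; apply cont2_snd, Cp).
  assert (Cp2 : forall a b, ex_RInt (fun z => p t z ^ 2) a b).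
  { intros; apply ex_RInt_cont; intros; apply (cont2_snd (fun t y => p t y ^ 2)), cont2_pow, Cp. }
  assert (Hsub : forall a b, 0 <= a -> a <= b -> b <= 1 -> (F t b - F t a) ^ 2 <= E t).
  { intros a b Ha Hab Hb.
    rewrite <- (RInt_derive_open (F t) (p t) a b) by (auto; intros; apply DF; lra).
    eapply Rle_trans; [apply sq_RInt_le; trivial; lra|].
    apply Rle_trans with (RInt (fun z => p t z ^ 2) 0 1).
    - rewrite <- (RInt_Chasles (fun z => p t z ^ 2) 0 a 1) by apply Cp2.
      rewrite <- (RInt_Chasles (fun z => p t z ^ 2) a b 1) by apply Cp2.
      assert (0 <= RInt (fun z => p t z ^ 2) 0 a) by (apply RInt_ge_0; trivial; intros; apply pow2_ge_0).
      assert (0 <= RInt (fun z => p t z ^ 2) b 1) by (apply RInt_ge_0; trivial; intros; apply pow2_ge_0).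
      unfold plus; simpl in *; lra.
    - apply RInt_le; [lra|apply Cp2| |].
      + apply ex_RInt_cont; intros; apply cont2_snd, Ce.
      + intros z _; unfold e; assert (H := pow2_ge_0 (q t z)); lra. }
  destruct (Rle_dec x0 y) as [Hle|Hgt].
  - replace (F t y ^ 2) with ((F t y - F t x0) ^ 2) by (rewrite HF0; ring).
    apply Hsub; lra.
  - replace (F t y ^ 2) with ((F t x0 - F t y) ^ 2) by (rewrite HF0; ring).
    apply Hsub; lra. }
assert (Hbd : exists C, 0 <= C /\ forall t y, 0 <= t <= t1 -> 0 <= y <= 1 ->
  Rabs (fx t y) <= C /\ Rabs (gx t y) <= C /\ Rabs (gxx t y) <= C
  /\ Rabs (sx t y) <= C /\ Rabs (s t y) <= C).
{ destruct (cont2_bounded fx 0 t1 Cfx) as (C1 & P1 & Q1).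
  destruct (cont2_bounded gx 0 t1 Cgx) as (C2 & P2 & Q2).
  destruct (cont2_bounded gxx 0 t1 Cgxx) as (C3 & P3 & Q3).
  destruct (cont2_bounded sx 0 t1 Csx) as (C4 & P4 & Q4).
  destruct (cont2_bounded s 0 t1 Cs) as (C5 & P5 & Q5).
  exists (C1 + C2 + C3 + C4 + C5); split; [lra|]; intros t y Ht Hy.
  specialize (Q1 t y Ht Hy); specialize (Q2 t y Ht Hy); specialize (Q3 t y Ht Hy);
  specialize (Q4 t y Ht Hy); specialize (Q5 t y Ht Hy).
  repeat split; lra. }
destruct Hbd as (C & HC0 & HC).
pose (pt := fun t x => - f t x * px t x - F t x * gxx t x + (fx t x + gx t x) * p t x - q t x + dI t).
pose (qt := fun t x => - f t x * qx t x - F t x * sx t x + q t x * fx t x + s t x * p t x).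
pose (e' := fun t x => 2 * p t x * pt t x + 2 * q t x * qt t x).
assert (Ce' : forall t x, cont2 e' t x).
{ intros t x; assert (CI := cont2_of_fst dI t x (CdI t)).
  specialize (Cf t x); specialize (Cpx t x); specialize (CF t x); specialize (Cgxx t x);
  specialize (Cfx t x); specialize (Cgx t x); specialize (Cp t x); specialize (Cq t x);
  specialize (Cqx t x); specialize (Csx t x); specialize (Cs t x).
  unfold e', pt, qt; cont2_tac. }
assert (DE : forall t, 0 < t < t1 -> is_derive E t (RInt (e' t) 0 1)).
{ intros t Ht; apply (is_derive_RInt_param_cont e e').
  assert (Hl : locally t (fun r => 0 < r < t1)).
  { apply (open_and (fun r => 0 < r) (fun r => r < t1)); [apply open_gt|apply open_lt|exact Ht]. }
  revert Hl; apply filter_imp; intros r Hr a; split; [|split; auto].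
  unfold e, e'; evar_last.
  { apply (is_derive_plusR (fun r => p r a ^ 2) (fun r => q r a ^ 2)).
    - apply is_derive_pow, Dp, Hr.
    - apply is_derive_pow, Dq, Hr. }
  unfold plus, pt, qt; simpl; ring. }
assert (HE' : forall t, 0 < t < t1 -> RInt (e' t) 0 1 <= (9 * C + 1) * E t).
{ intros t Ht.
  (* [e' = source - flux'], and [flux] takes equal values at both ends *)
  pose (H := fun y => f t y * (p t y ^ 2 + q t y ^ 2) - 2 * dI t * F t y).
  pose (h := fun y => fx t y * (p t y ^ 2 + q t y ^ 2)
              + f t y * (2 * p t y * px t y + 2 * q t y * qx t y) - 2 * dI t * p t y).
  pose (src := fun y => fx t y * (p t y ^ 2 + q t y ^ 2)
     + 2 * p t y * (- F t y * gxx t y + (fx t y + gx t y) * p t y - q t y)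
     + 2 * q t y * (- F t y * sx t y + q t y * fx t y + s t y * p t y)).
  assert (Ch : forall y, continuous h y).
  { intros y; specialize (Cfx t y); specialize (Cf t y);
    specialize (Cp t y); specialize (Cpx t y); specialize (Cq t y); specialize (Cqx t y).
    apply (cont2_snd (fun t' y => fx t' y * (p t' y ^ 2 + q t' y ^ 2)
              + f t' y * (2 * p t' y * px t' y + 2 * q t' y * qx t' y) - 2 * dI t * p t' y)); cont2_tac. }
  assert (Csrc : forall y, continuous src y).
  { intros y; specialize (Cfx t y); specialize (Cgx t y); specialize (CF t y); specialize (Cgxx t y);
    specialize (Cp t y); specialize (Csx t y); specialize (Cq t y); specialize (Cs t y).
    apply (cont2_snd (fun t y => fx t y * (p t y ^ 2 + q t y ^ 2)
     + 2 * p t y * (- F t y * gxx t y + (fx t y + gx t y) * p t y - q t y)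
     + 2 * q t y * (- F t y * sx t y + q t y * fx t y + s t y * p t y))); cont2_tac. }
  assert (Hh : RInt h 0 1 = 0).
  { rewrite (RInt_derive_open H h 0 1); [|lra| |exact Ch|].
    - unfold H; rewrite HbF, Hbf; ring_R.
    - intros y _; specialize (Cf t y); specialize (CF t y); specialize (Cp t y); specialize (Cq t y).
      apply (cont2_snd (fun t' y => f t' y * (p t' y ^ 2 + q t' y ^ 2) - 2 * dI t * F t' y)); cont2_tac.
    - intros y Hy; unfold H, h; evar_last.
      { apply is_derive_minusR.
        - apply (@is_derive_mult R_AbsRing (f t) (fun y => p t y ^ 2 + q t y ^ 2)); [apply Df, Hy| |apply Rmult_comm].
          apply (is_derive_plusR (fun y => p t y ^ 2) (fun y => q t y ^ 2)).
          + apply is_derive_pow, Dpx, Hy.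
          + apply is_derive_pow, Dqx, Hy.
        - apply is_derive_scal, DF, Hy. }
      unfold minus, plus, opp, mult; simpl; unfold mult, scal; simpl; unfold mult; simpl; ring. }
  rewrite (RInt_ext (e' t) (fun y => src y - h y)).
  2:{ intros y _; unfold e', src, h, pt, qt; ring_R. }
  rewrite (RInt_minusR src h) by (apply ex_RInt_cont; assumption).
  rewrite Hh; unfold minus, plus, opp; simpl; rewrite Ropp_0, Rplus_0_r.
  apply Rle_trans with (RInt (fun y => scal (7 * C + 1) (e t y) + 2 * C * E t) 0 1).
  - apply RInt_le; [lra|apply ex_RInt_cont, Csrc| |].
    + apply ex_RInt_cont; intros y; specialize (Ce t y).
      apply (cont2_snd (fun t' y => (7 * C + 1) * e t' y + 2 * C * E t)); clearbody e E; cont2_tac.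
    + intros y Hy; destruct (HC t y) as (A1 & A2 & A3 & A4 & A5); try lra.
      eapply Rle_trans; [apply (energy_source_le C); assumption|].
      assert (HF := HFE t y); unfold scal; simpl; unfold mult; simpl.
      apply Rplus_le_compat_l, Rmult_le_compat_l; [lra|apply HF; lra].
  - rewrite (RInt_plusR (fun y => scal (7 * C + 1) (e t y)) (fun _ => 2 * C * E t)).
    + rewrite RInt_scalR.
      * rewrite RInt_const; unfold plus, scal; simpl; unfold mult; simpl; fold (E t).
        apply Req_le; ring.
      * apply ex_RInt_cont; intros y; apply cont2_snd, Ce.
    + apply ex_RInt_scalR, ex_RInt_cont; intros y; apply cont2_snd, Ce.
    + apply ex_RInt_const. }
assert (CE : forall t, continuous E t).
{ intros t; apply continuous_RInt_param, filter_forall; auto. }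
assert (HE : E t1 <= 0).
{ apply (gronwall_zero E (fun t => RInt (e' t) 0 1) (9 * C + 1) t1); auto; [lra|].
  unfold E; rewrite (RInt_ext _ (fun _ => 0)).
  - rewrite RInt_cst; ring_R.
  - rewrite Rmin_left, Rmax_right by lra; intros y Hy.
    unfold e; destruct (Hinit y Hy) as [-> ->]; ring_R. }
split.
- assert (H := HFE t1 x1 Hx1); assert (H2 := pow2_ge_0 (F t1 x1)).
  apply Rsqr_0_uniq; unfold Rsqr; simpl in *; lra.
- (* the energy density vanishes inside, hence up to the boundary *)
  assert (Hin : forall y, 0 < y < 1 -> q t1 y = 0).
  { intros y Hy; assert (He : e t1 y = 0).
    { apply (RInt_zero_nonneg (e t1) 0 1); trivial.
      - intros z; apply cont2_snd, Ce.
      - intros z _; unfold e; generalize (pow2_ge_0 (p t1 z)) (pow2_ge_0 (q t1 z)); lra. }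
    unfold e in He; generalize (pow2_ge_0 (p t1 y)) (pow2_ge_0 (q t1 y)); intros.
    apply Rsqr_0_uniq; unfold Rsqr; simpl in *; lra. }
  destruct (Req_dec (q t1 x1) 0) as [Z|Z]; [exact Z|exfalso].
  assert (Hp : 0 < Rabs (q t1 x1)) by (apply Rabs_pos_lt, Z).
  destruct (proj1 (filterlim_locally _ _) (cont2_snd _ _ _ (Cq t1 x1)) (mkposreal _ Hp)) as [d Hd].
  set (k := Rmin (d / 2) (1 / 2)).
  assert (Hk : 0 < k) by (apply Rmin_pos; [destruct d; simpl|]; lra).
  assert (Hk1 : k <= d / 2) by apply Rmin_l.
  assert (Hk2 : k <= 1 / 2) by apply Rmin_r.
  assert (Hd0 : 0 < d) by (destruct d; simpl; lra).
  assert (Hz : exists z, 0 < z < 1 /\ Rabs (z - x1) < d).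
  { unfold I01 in Hx1; destruct (Rle_dec x1 (1 / 2)) as [Hle|Hgt].
    - exists (x1 + k / 2); split; [lra|rewrite Rabs_pos_eq; lra].
    - exists (x1 - k / 2); split; [lra|rewrite Rabs_left1; lra]. }
  destruct Hz as (z & Hz & Hzd).
  specialize (Hd z Hzd); change (Rabs (q t1 z - q t1 x1) < Rabs (q t1 x1)) in Hd.
  rewrite (Hin z Hz), Rminus_0_l, Rabs_Ropp in Hd; lra.
Qed.

(** Clamping both variables makes everything continuous on the whole plane, so
    that integrals with parameters can be handled up to the boundary of the
    slab; the equations persist in its interior. *)
Lemma solution_clamped (bc : boundary_condition) (f0 rho0 : R -> R) (T : Rbar)
    (f rho : R -> R -> R) (t1 : R) :
  is_solution bc f0 rho0 T f rho -> 0 < t1 -> Rbar_lt t1 T ->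
  let ct := clamp 0 t1 in
  let ff := fun t x => f (ct t) (cl x) in
  let fx := fun t x => dx (f (ct t)) (cl x) in
  let fxx := fun t x => dx (dx (f (ct t))) (cl x) in
  let r := fun t x => rho (ct t) (cl x) in
  let rx := fun t x => dx (rho (ct t)) (cl x) in
  let I := fun t => RInt (r t) 0 1 - 2 * RInt (fun x => fx t x ^ 2) 0 1 in
  ((forall t x, cont2 ff t x) /\ (forall t x, cont2 fx t x) /\ (forall t x, cont2 fxx t x) /\
   (forall t x, cont2 r t x) /\ (forall t x, cont2 rx t x) /\ (forall t, continuous I t)) /\
  ((forall t x, 0 < x < 1 -> is_derive (ff t) x (fx t x)) /\
   (forall t x, 0 < x < 1 -> is_derive (fx t) x (fxx t x)) /\
   (forall t x, 0 < x < 1 -> is_derive (r t) x (rx t x)) /\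
   (forall t x, 0 < t < t1 -> is_derive (fun s => fx s x) t
      (- ff t x * fxx t x + fx t x ^ 2 - r t x + I t)) /\
   (forall t x, 0 < t < t1 -> is_derive (fun s => r s x) t
      (- ff t x * rx t x + r t x * fx t x))) /\
  (forall t, bc (f (ct t)) (rho (ct t))).
Proof.
intros Hf Ht1 HT; cbv zeta.
assert (H0 : 0 <= t1) by lra.
assert (Hct : forall s, 0 <= clamp 0 t1 s <= t1) by (intros s; apply clamp_bound; lra).
assert (Hslab : forall s y, time_slab T (clamp 0 t1 s, cl y)).
{ intros s y; split; [|split]; simpl; [apply Hct| |apply cl_I01].
  apply (Rbar_le_lt_trans (Finite _) (Finite t1) T); [apply Hct|exact HT]. }
assert (Hcts : forall s, 0 < s < t1 -> locally s (fun r => clamp 0 t1 r = r)).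
{ intros s Hs; assert (Hl : locally s (fun r => 0 < r < t1)).
  { apply (open_and (fun r => 0 < r) (fun r => r < t1)); [apply open_gt|apply open_lt|exact Hs]. }
  revert Hl; apply filter_imp; intros r Hr; apply clamp_id; lra. }
assert (Cfx := cont2_of_slab _ _ _ (sol_cont_fx Hf) H0 HT).
assert (Cr := cont2_of_slab _ _ _ (sol_cont_rho Hf) H0 HT).
assert (Dsp : forall (u : R -> R) y, ex_dx u y -> 0 < y < 1 ->
  is_derive (fun z => u (cl z)) y (dx u (cl y))).
{ intros u y Hu Hy; assert (Hy' : I01 y) by (unfold I01; lra).
  rewrite (clamp_id _ _ _ Hy').
  apply is_derive_of_dx; trivial; apply (is_dx_ext u); trivial.
  - intros z Hz; rewrite clamp_id by exact Hz; reflexivity.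
  - apply dx_correct, Hu. }
assert (Hex : forall s y, 0 < y < 1 -> ex_dx (f (clamp 0 t1 s)) y /\
  ex_dx (dx (f (clamp 0 t1 s))) y /\ ex_dx (rho (clamp 0 t1 s)) y).
{ intros s y Hy; apply (sol_ex_dx Hf).
  assert (S := Hslab s y); rewrite (clamp_id 0 1 y) in S by lra; exact S. }
repeat match goal with |- _ /\ _ => split end.
- apply (cont2_of_slab _ _ _ (sol_cont_f Hf) H0 HT).
- exact Cfx.
- apply (cont2_of_slab _ _ _ (sol_cont_fxx Hf) H0 HT).
- exact Cr.
- apply (cont2_of_slab _ _ _ (sol_cont_rhox Hf) H0 HT).
- intros t; apply continuous_minusR.
  + apply (continuous_RInt_param (fun t x => rho (clamp 0 t1 t) (cl x))).
    apply filter_forall; auto.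
  + apply continuous_multR; [apply continuous_const|].
    apply (continuous_RInt_param (fun t x => dx (f (clamp 0 t1 t)) (cl x) ^ 2)).
    apply filter_forall; intros; apply (cont2_pow (fun t x => dx (f (clamp 0 t1 t)) (cl x))), Cfx.
- intros t x Hx; apply Dsp, Hx; apply (Hex t x Hx).
- intros t x Hx; apply (Dsp (dx (f (clamp 0 t1 t)))), Hx; apply (Hex t x Hx).
- intros t x Hx; apply Dsp, Hx; apply (Hex t x Hx).
- intros t x Ht; assert (Et : clamp 0 t1 t = t) by (apply clamp_id; lra).
  assert (S := Hslab t x); rewrite Et in *.
  destruct (sol_ex_dt Hf t (cl x) (proj1 Ht) S) as [D _].
  assert (E := sol_eq_f Hf t (cl x) (proj1 Ht) S).
  apply (is_derive_ext_loc (fun s => dx (f s) (cl x))).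
  { generalize (Hcts t Ht); apply filter_imp; intros s Hs; rewrite Hs; reflexivity. }
  replace (_ + _ - _ + _) with (Derive (fun s => dx (f s) (cl x)) t); [apply Derive_correct, D|].
  assert (Hn : nonlocal_term f rho t = RInt (fun y => rho t (cl y)) 0 1
     - 2 * RInt (fun y => dx (f t) (cl y) ^ 2) 0 1).
  { unfold nonlocal_term; f_equal; [|f_equal]; apply RInt_ext; rewrite Rmin_left, Rmax_right by lra;
      intros y Hy; rewrite clamp_id; trivial; lra. }
  rewrite Hn in E.
  set (A := RInt _ 0 1) in *; set (B := RInt _ 0 1) in *; clearbody A B; lra.
- intros t x Ht; assert (Et : clamp 0 t1 t = t) by (apply clamp_id; lra).
  assert (S := Hslab t x); rewrite Et in *.
  destruct (sol_ex_dt Hf t (cl x) (proj1 Ht) S) as [_ D].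
  assert (E := sol_eq_rho Hf t (cl x) (proj1 Ht) S).
  apply (is_derive_ext_loc (fun s => rho s (cl x))).
  { generalize (Hcts t Ht); apply filter_imp; intros s Hs; rewrite Hs; reflexivity. }
  replace (- _ * _ + _) with (Derive (fun s => rho s (cl x)) t); [apply Derive_correct, D|lra].
- intros t; apply (sol_bc Hf); [apply Hct|apply (Hslab t 0)].
Qed.

(** The differences solve the linear problem above; the difference of the
    nonlocal terms is the forcing [dI]. *)
Lemma solutions_agree (bc : boundary_condition) (f0 rho0 : R -> R) (T T' : Rbar)
    (f rho g sig : R -> R -> R) :
  bc = dirichlet \/ bc = periodic ->
  is_solution bc f0 rho0 T f rho -> is_solution bc f0 rho0 T' g sig ->
  forall t x, time_slab T (t, x) -> time_slab T' (t, x) ->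
    f t x = g t x /\ rho t x = sig t x.
Proof.
intros Hbc Hf Hg t1 x1 (H0 & HT & Hx1) (_ & HT' & _); simpl in *.
destruct (Req_dec t1 0) as [->|Hn].
{ destruct (sol_init Hf x1 Hx1) as [-> ->].
  destruct (sol_init Hg x1 Hx1) as [-> ->]; tauto. }
assert (Ht1 : 0 < t1) by lra.
destruct (solution_clamped _ _ _ _ _ _ t1 Hf Ht1 HT) as
  ((Cf & Cfx & Cfxx & Cr & Crx & CI) & (Df & Dfx & Dr & Dtf & Dtr) & Bf).
destruct (solution_clamped _ _ _ _ _ _ t1 Hg Ht1 HT') as
  ((Cg & Cgx & Cgxx & Cs & Csx & CJ) & (Dg & Dgx & Ds & Dtg & Dts) & Bg).
assert (c1 : cl 1 = 1) by (apply clamp_id; lra).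
assert (c0 : cl 0 = 0) by (apply clamp_id; lra).
assert (Ect0 : clamp 0 t1 0 = 0) by (apply clamp_id; lra).
assert (Ect1 : clamp 0 t1 t1 = t1) by (apply clamp_id; lra).
assert (Hi : forall y, I01 y -> f 0 y = g 0 y /\ rho 0 y = sig 0 y).
{ intros y Hy.
  destruct (sol_init Hf y Hy) as [-> ->].
  destruct (sol_init Hg y Hy) as [-> ->]; tauto. }
assert (Hdx0 : forall y, I01 y -> dx (f 0) y = dx (g 0) y).
{ intros y Hy; apply dx_ext; [exact Hy|intros z Hz; apply Hi, Hz|].
  apply (sol_ex_dx Hf 0 y); split; [simpl; lra|split; [apply (sol_lifespan Hf)|exact Hy]]. }
set (ct := clamp 0 t1) in *.
assert (Hd : forall u v : R -> R -> R, (forall t x, cont2 u t x) -> (forall t x, cont2 v t x) ->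
  forall t x, cont2 (fun t x => u t x - v t x) t x) by (intros; apply cont2_minus; auto).
destruct (difference_vanishes t1
  (fun t x => f (ct t) (cl x)) (fun t x => dx (f (ct t)) (cl x))
  (fun t x => dx (g (ct t)) (cl x)) (fun t x => dx (dx (g (ct t))) (cl x))
  (fun t x => sig (ct t) (cl x)) (fun t x => dx (sig (ct t)) (cl x))
  (fun t x => f (ct t) (cl x) - g (ct t) (cl x))
  (fun t x => dx (f (ct t)) (cl x) - dx (g (ct t)) (cl x))
  (fun t x => dx (dx (f (ct t))) (cl x) - dx (dx (g (ct t))) (cl x))
  (fun t x => rho (ct t) (cl x) - sig (ct t) (cl x))
  (fun t x => dx (rho (ct t)) (cl x) - dx (sig (ct t)) (cl x))
  (fun t => (RInt (fun x => rho (ct t) (cl x)) 0 1 - 2 * RInt (fun x => dx (f (ct t)) (cl x) ^ 2) 0 1)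
    - (RInt (fun x => sig (ct t) (cl x)) 0 1 - 2 * RInt (fun x => dx (g (ct t)) (cl x) ^ 2) 0 1)))
  with x1 as [H1 H2]; trivial.
- exact (Hd _ _ Cf Cg).
- exact (Hd _ _ Cfx Cgx).
- exact (Hd _ _ Cfxx Cgxx).
- exact (Hd _ _ Cr Cs).
- exact (Hd _ _ Crx Csx).
- intros t; apply continuous_minusR; [apply CI|apply CJ].
- intros t x Ht; evar_last.
  + apply is_derive_minusR; [apply Dtf, Ht|apply Dtg, Ht].
  + unfold minus, plus, opp; simpl.
    repeat match goal with |- context [RInt ?h 0 1] => generalize (RInt h 0 1) end.
    intros; simpl in *; ring_R.
- intros t x Ht; evar_last.
  + apply is_derive_minusR; [apply Dtr, Ht|apply Dts, Ht].
  + unfold minus, plus, opp; simpl; ring_R.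
- intros t x Hx; apply is_derive_minusR; [apply Df, Hx|apply Dg, Hx].
- intros t x Hx; apply is_derive_minusR; [apply Dfx, Hx|apply Dgx, Hx].
- intros t x Hx; apply is_derive_minusR; [apply Dr, Hx|apply Ds, Hx].
- intros t; generalize (Bf t) (Bg t); rewrite c0, c1; destruct Hbc as [-> | ->].
  + intros (-> & -> & _) _; ring.
  + intros (-> & -> & -> & _) (_ & -> & -> & _); ring.
- intros t; generalize (Bf t) (Bg t); rewrite c0, c1; destruct Hbc as [-> | ->].
  + intros (-> & -> & _) (-> & -> & _); ring.
  + intros (-> & _) (-> & _); ring.
- intros t; apply (bc_pinned_difference bc _ _ _ _ _ Hbc (Bf t) (Bg t)).
  + intros z; apply (cont2_snd _ _ _ (Hd _ _ Cf Cg t z)).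
  + intros z Hz; rewrite clamp_id by exact Hz; reflexivity.
  + intros z; exact (cont2_snd _ _ _ (Cf t z)).
  + intros z; exact (cont2_snd _ _ _ (Cg t z)).
- intros x _; rewrite Ect0; destruct (Hi _ (cl_I01 x)) as [_ ->].
  rewrite (Hdx0 _ (cl_I01 x)); split; ring.
- rewrite Ect1, (clamp_id _ _ _ Hx1) in H1, H2; lra.
Qed.

(** * A global solution *)

Lemma dx_of_derive (g G : R -> R) (x l : R) :
  I01 x -> (forall y, I01 y -> g y = G y) -> is_derive G x l ->
  is_dx g x l /\ dx g x = l.
Proof.
intros Hx E H; assert (Hd : is_dx g x l).
{ apply (is_dx_ext G); [exact Hx|intros y Hy; symmetry; apply E, Hy|].
  apply is_dx_of_derive; trivial. }
split; [exact Hd|apply is_dx_unique; trivial].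
Qed.

Lemma smooth_of_derivatives (g : R -> R) (G : nat -> R -> R) :
  (forall x, g x = G 0%nat x) ->
  (forall n x, is_derive (G n) x (G (S n) x)) -> smooth g.
Proof.
intros E HG.
assert (H : forall n x, I01 x -> Nat.iter n dx g x = G n x).
{ induction n as [|n IH]; intros x Hx; [apply E|].
  exact (proj2 (dx_of_derive _ _ x _ Hx IH (HG n x))). }
intros n x Hx; exists (G (S n) x).
exact (proj1 (dx_of_derive _ _ x _ Hx (H n) (HG n x))).
Qed.

Lemma cos_quarter_shift (y : R) : cos (y + PI / 2) = - sin y.
Proof. rewrite cos_plus, cos_PI2, sin_PI2; ring. Qed.

Lemma smooth_cos (g : R -> R) (a b k : R) :
  (forall x, g x = a + b * cos (k * x)) -> smooth g.
Proof.
intros E; apply smooth_of_derivatives with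
  (fun (n : nat) (x : R) => match n with O => a | S _ => 0 end + b * k ^ n * cos (k * x + INR n * (PI / 2))).
- intros x; rewrite E; simpl; do 2 f_equal; [ring|f_equal; ring].
- intros n x; rewrite S_INR.
  replace (k * x + (INR n + 1) * (PI / 2)) with ((k * x + INR n * (PI / 2)) + PI / 2) by ring.
  rewrite cos_quarter_shift; auto_derive; [trivial|simpl; ring].
Qed.

(** [1 - sin y = 2 sin^2 (y / 2 - pi / 4)], and the angle on the right stays
    in an interval where [sin] vanishes only at [0]. *)
Lemma sin_eq_1 (y : R) : 0 <= y <= 2 * PI -> sin y = 1 -> y = PI / 2.
Proof.
intros Hy H; assert (HP := PI_RGT_0).
set (z := y / 2 - PI / 4).
assert (Hz : sin z ^ 2 = 0).
{ assert (E : sin y = 1 - 2 * sin z * sin z).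
  { rewrite <- cos_2a_sin; rewrite <- (cos_shift y), <- cos_neg; f_equal; unfold z; field. }
  simpl; lra. }
assert (Hs : sin z = 0) by (apply Rsqr_0_uniq; unfold Rsqr; simpl in Hz; lra).
destruct (Rtotal_order z 0) as [Hlt|[H0|Hgt]].
- assert (0 < sin (- z)) by (apply sin_gt_0; unfold z in *; lra).
  rewrite sin_neg in *; lra.
- unfold z in H0; lra.
- assert (0 < sin z) by (apply sin_gt_0; unfold z in *; lra); lra.
Qed.

Section Wave.

Variable c : R.

Definition wave_phase (t x : R) : R := 2 * PI * x + (1 - c) * t.
Definition wave_f (t x : R) : R := (c - cos (wave_phase t x)) / (2 * PI).
Definition wave_rho (t x : R) : R := 1 - cos (wave_phase t x).

Lemma wave_phase_1 (t : R) : wave_phase t 1 = wave_phase t 0 + 2 * PI.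
Proof. unfold wave_phase; ring. Qed.

Lemma wave_dx_f (t x : R) : I01 x ->
  is_dx (wave_f t) x (sin (wave_phase t x)) /\ dx (wave_f t) x = sin (wave_phase t x).
Proof.
intros Hx; apply dx_of_derive with (wave_f t); trivial.
unfold wave_f, wave_phase; assert (H := PI_RGT_0); auto_derive; [trivial|field; lra].
Qed.

Lemma wave_dxx_f (t x : R) : I01 x ->
  is_dx (dx (wave_f t)) x (2 * PI * cos (wave_phase t x)) /\
  dx (dx (wave_f t)) x = 2 * PI * cos (wave_phase t x).
Proof.
intros Hx; apply dx_of_derive with (fun y => sin (wave_phase t y)); trivial.
- intros y Hy; apply wave_dx_f, Hy.
- unfold wave_phase; auto_derive; [trivial|ring].
Qed.

Lemma wave_dx_rho (t x : R) : I01 x ->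
  is_dx (wave_rho t) x (2 * PI * sin (wave_phase t x)) /\
  dx (wave_rho t) x = 2 * PI * sin (wave_phase t x).
Proof.
intros Hx; apply dx_of_derive with (wave_rho t); trivial.
unfold wave_rho, wave_phase; auto_derive; [trivial|ring].
Qed.

Lemma RInt_wave_cos (t : R) : RInt (fun x => cos (wave_phase t x)) 0 1 = 0.
Proof.
assert (H := PI_RGT_0).
rewrite (RInt_derive_open (fun x => sin (wave_phase t x) / (2 * PI))).
- rewrite wave_phase_1, sin_plus, cos_2PI, sin_2PI; unfold Rdiv; ring_R.
- lra.
- intros x _; apply ex_derive_continuousR; unfold wave_phase; auto_derive; trivial.
- intros x; apply ex_derive_continuousR; unfold wave_phase; auto_derive; trivial.
- intros x _; unfold wave_phase; auto_derive; [trivial|field; lra].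
Qed.

Lemma RInt_wave_sin2 (t : R) : RInt (fun x => sin (wave_phase t x) ^ 2) 0 1 = 1 / 2.
Proof.
assert (H := PI_RGT_0).
rewrite (RInt_derive_open (fun x => x / 2 - sin (wave_phase t x) * cos (wave_phase t x) / (4 * PI))).
- rewrite wave_phase_1, sin_plus, cos_plus, cos_2PI, sin_2PI; eq_R; field; lra.
- lra.
- intros x _; apply ex_derive_continuousR; unfold wave_phase; auto_derive; trivial.
- intros x; apply ex_derive_continuousR; unfold wave_phase; auto_derive; trivial.
- intros x _; unfold wave_phase; auto_derive; [trivial|].
  set (z := 2 * PI * x + (1 - c) * t).
  assert (E := sin2_cos2 z); unfold Rsqr in E.
  replace (sin z ^ 2) with ((1 + (sin z * sin z - cos z * cos z)) / 2) by (simpl; lra).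
  field; lra.
Qed.

Lemma RInt_wave_rho (t : R) : RInt (wave_rho t) 0 1 = 1.
Proof.
unfold wave_rho.
rewrite (RInt_minusR (fun _ => 1) (fun x => cos (wave_phase t x))).
- rewrite RInt_wave_cos, RInt_const; unfold minus, plus, opp, scal; simpl; unfold mult; simpl; ring_R.
- apply ex_RInt_const.
- apply ex_RInt_cont; intros x; apply ex_derive_continuousR; unfold wave_phase; auto_derive; trivial.
Qed.

Lemma wave_nonlocal (t : R) : nonlocal_term wave_f wave_rho t = 0.
Proof.
unfold nonlocal_term; rewrite RInt_wave_rho.
rewrite (RInt_ext (fun x => dx (wave_f t) x ^ 2) (fun x => sin (wave_phase t x) ^ 2)).
- rewrite RInt_wave_sin2; lra.
- rewrite Rmin_left, Rmax_right by lra; intros x Hx.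
  destruct (wave_dx_f t x) as [_ ->]; [unfold I01; lra|reflexivity].
Qed.

Lemma cont2_wave (h : R -> R) (t x : R) :
  (forall z, continuous h z) -> cont2 (fun s y => h (wave_phase s y)) t x.
Proof.
intros Hh; unfold cont2, wave_phase.
apply (continuous_comp (fun p : R * R => 2 * PI * snd p + (1 - c) * fst p) h); [|apply Hh].
apply continuous_plusR.
- apply continuous_multR; [apply continuous_const|apply continuous_snd].
- apply continuous_multR; [apply continuous_const|apply continuous_fst].
Qed.

Lemma slab_continuous_ext (T : Rbar) (u v : R -> R -> R) :
  (forall t x, time_slab T (t, x) -> v t x = u t x) ->
  (forall t x, time_slab T (t, x) -> cont2 v t x) -> continuous_on_slab T u.
Proof.
intros E H; unfold continuous_on_slab.
apply (continuous_on_ext _ (fun p => v (fst p) (snd p))).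
- intros [t x] Hp; apply E, Hp.
- apply continuous_on_forall; intros [t x] Hp; exact (H t x Hp).
Qed.

(** Both equations reduce to [sin^2 + cos^2 = 1]; the nonlocal term is
    [1 - 2 / 2 = 0]. *)
Lemma wave_is_solution (bc : boundary_condition) :
  (forall t, bc (wave_f t) (wave_rho t)) ->
  is_solution bc (wave_f 0) (wave_rho 0) p_infty wave_f wave_rho.
Proof.
intros Hbc; assert (HP := PI_RGT_0).
assert (Csin : forall z, continuous sin z) by (intros z; apply continuous_sin).
assert (Ccos : forall z, continuous cos z) by (intros z; apply continuous_cos).
split.
- exact I.
- intros t x (_ & _ & Hx); simpl in Hx; split; [|split]; eexists.
  + apply wave_dx_f, Hx.
  + apply wave_dxx_f, Hx.
  + apply wave_dx_rho, Hx.
- apply slab_continuous_ext with wave_f; trivial; intros t x _.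
  assert (C := cont2_wave cos t x Ccos); unfold wave_f; cont2_tac; lra.
- apply slab_continuous_ext with (fun t x => sin (wave_phase t x)).
  + intros t x (_ & _ & Hx); symmetry; apply wave_dx_f, Hx.
  + intros t x _; apply (cont2_wave sin t x Csin).
- apply slab_continuous_ext with (fun t x => 2 * PI * cos (wave_phase t x)).
  + intros t x (_ & _ & Hx); symmetry; apply wave_dxx_f, Hx.
  + intros t x _; assert (C := cont2_wave cos t x Ccos); cont2_tac.
- apply slab_continuous_ext with wave_rho; trivial; intros t x _.
  assert (C := cont2_wave cos t x Ccos); unfold wave_rho; cont2_tac.
- apply slab_continuous_ext with (fun t x => 2 * PI * sin (wave_phase t x)).
  + intros t x (_ & _ & Hx); symmetry; apply wave_dx_rho, Hx.
  + intros t x _; assert (C := cont2_wave sin t x Csin); cont2_tac.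
- intros t x Ht (_ & _ & Hx); split.
  + apply (ex_derive_ext (fun s => sin (wave_phase s x))).
    * intros s; symmetry; apply wave_dx_f, Hx.
    * unfold wave_phase; auto_derive; trivial.
  + unfold wave_rho, wave_phase; auto_derive; trivial.
- intros t x Ht (_ & _ & Hx).
  rewrite wave_nonlocal.
  rewrite (Derive_ext _ (fun s => sin (wave_phase s x))) by (intros s; apply wave_dx_f, Hx).
  rewrite (proj2 (wave_dx_f t x Hx)), (proj2 (wave_dxx_f t x Hx)).
  rewrite (is_derive_unique _ _ ((1 - c) * cos (wave_phase t x))).
  + unfold wave_f, wave_rho; set (z := wave_phase t x).
    assert (E := sin2_cos2 z); unfold Rsqr in E.
    replace (sin z ^ 2) with (1 - cos z * cos z) by (simpl; lra); field; lra.
  + unfold wave_phase; auto_derive; [trivial|ring].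
- intros t x Ht (_ & _ & Hx).
  rewrite (proj2 (wave_dx_f t x Hx)), (proj2 (wave_dx_rho t x Hx)).
  rewrite (is_derive_unique _ _ ((1 - c) * sin (wave_phase t x))).
  + unfold wave_f, wave_rho; field; lra.
  + unfold wave_rho, wave_phase; auto_derive; [trivial|ring].
- intros x _; split; reflexivity.
- intros t _ _; apply Hbc.
Qed.

End Wave.

(** For [c = 1] the wave is stationary and vanishes at both ends; for [c = 0]
    it is the same profile seen from a frame in which the velocity has zero
    mean, so that it travels. *)
Lemma global_solution_exists (bc : boundary_condition) :
  bc = dirichlet \/ bc = periodic ->
  exists (f0 rho0 : R -> R) (xs : list R) (f rho : R -> R -> R),
    smooth f0 /\ smooth rho0 /\ nontrivial f0 /\ nontrivial rho0 /\
    bc f0 rho0 /\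
    (forall x, I01 x -> 0 <= rho0 x) /\
    (forall x, In x xs <-> is_max_point f0 x) /\
    (exists x, In x xs /\ dx (dx f0) x = 0) /\
    is_the_solution bc f0 rho0 p_infty f rho.
Proof.
intros Hbc; assert (HP := PI_RGT_0).
assert (Hc : exists c, 0 <= c /\ forall t, bc (wave_f c t) (wave_rho c t)).
{ destruct Hbc as [-> | ->].
  - exists 1; split; [lra|intros t].
    assert (Hz : forall x, wave_phase 1 t x = 2 * PI * x) by (intros; unfold wave_phase; ring).
    unfold dirichlet, wave_f, wave_rho; rewrite !Hz.
    rewrite Rmult_0_r, Rmult_1_r, cos_0, cos_2PI; repeat split; field; lra.
  - exists 0; split; [lra|intros t].
    assert (Hp : cos (wave_phase 0 t 1) = cos (wave_phase 0 t 0)).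
    { rewrite wave_phase_1, cos_plus, cos_2PI, sin_2PI; ring. }
    split; [|split; [|split]].
    + unfold wave_f; rewrite Hp; reflexivity.
    + rewrite (proj2 (wave_dx_f 0 t 0 ltac:(unfold I01; lra))), (proj2 (wave_dx_f 0 t 1 ltac:(unfold I01; lra))).
      rewrite wave_phase_1, sin_plus, cos_2PI, sin_2PI; ring.
    + unfold wave_rho; rewrite Hp; reflexivity.
    + rewrite (RInt_ext _ (fun x => scal (- / (2 * PI)) (cos (wave_phase 0 t x)))).
      * rewrite RInt_scalR, RInt_wave_cos.
        -- unfold scal; simpl; unfold mult; simpl; ring.
        -- apply ex_RInt_cont; intros x; apply ex_derive_continuousR; unfold wave_phase; auto_derive; trivial.
      * intros x _; unfold wave_f, scal; simpl; unfold mult; simpl.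
        eq_R; field; lra. }
destruct Hc as (c & Hc0 & Hc).
assert (Hz : forall x, wave_phase c 0 x = 2 * PI * x) by (intros; unfold wave_phase; ring).
assert (Hq : wave_phase c 0 (1 / 4) = PI / 2) by (rewrite Hz; field).
assert (Hh : wave_phase c 0 (1 / 2) = PI) by (rewrite Hz; field).
assert (I4 : I01 (1 / 4)) by (unfold I01; lra).
exists (wave_f c 0), (wave_rho c 0), (1 / 4 :: nil), (wave_f c), (wave_rho c).
split; [|split; [|split; [|split; [|split; [|split; [|split; [|split]]]]]]].
- apply (smooth_cos _ (c / (2 * PI)) (- / (2 * PI)) (2 * PI)).
  intros x; unfold wave_f; rewrite Hz; field; lra.
- apply (smooth_cos _ 1 (- (1)) (2 * PI)).
  intros x; unfold wave_rho; rewrite Hz; ring.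
- exists (1 / 2); split; [unfold I01; lra|]; unfold wave_f; rewrite Hh, cos_PI.
  apply Rgt_not_eq, Rdiv_lt_0_compat; lra.
- exists (1 / 2); split; [unfold I01; lra|]; unfold wave_rho; rewrite Hh, cos_PI; lra.
- apply Hc.
- intros x _; unfold wave_rho; assert (H := COS_bound (wave_phase c 0 x)); lra.
- intros x; split.
  + intros [<-|[]]; split; [exact I4|].
    rewrite (proj2 (wave_dx_f c 0 _ I4)), Hq, sin_PI2; split; [lra|].
    intros y Hy; rewrite (proj2 (wave_dx_f c 0 y Hy)); apply SIN_bound.
  + intros (Hx & _ & Hmax); left.
    specialize (Hmax _ I4); rewrite (proj2 (wave_dx_f c 0 _ I4)), Hq, sin_PI2, (proj2 (wave_dx_f c 0 x Hx)), Hz in Hmax.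
    assert (E : 2 * PI * x = PI / 2).
    { apply sin_eq_1; [unfold I01 in Hx; nra|].
      apply Rle_antisym; [apply SIN_bound|exact Hmax]. }
    apply Rmult_eq_reg_l with (2 * PI); lra.
- exists (1 / 4); split; [left; reflexivity|].
  rewrite (proj2 (wave_dxx_f c 0 _ I4)), Hq, cos_PI2; ring.
- assert (Hsol := wave_is_solution c bc Hc); split; [exact Hsol|].
  intros T' g sig Hg; split; [destruct T'; exact I|].
  intros t x Hs; apply (solutions_agree bc _ _ _ _ _ _ _ _ Hbc Hg Hsol t x Hs).
  destruct Hs as (H0 & _ & Hx); repeat split; assumption || apply Hx.
Qed.

(** * A second order initial value problem *)

(** Freezing the primitive for negative arguments makes it continuous on both
    sides of [0], although the data only concern positive arguments. *)
Definition prim (u : R -> R) (s : R) : R := RInt u 0 (Rmax 0 s).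

Definition cont_below (b : R) (u : R -> R) : Prop := forall s, s < b -> continuous u s.

Lemma ex_RInt_below (b : R) (u : R -> R) (s s' : R) :
  cont_below b u -> s < b -> s' < b -> ex_RInt u s s'.
Proof.
intros Hu Hs Hs'; apply ex_RInt_continuousR.
intros z Hz; apply Hu; apply Rle_lt_trans with (Rmax s s'); [apply Hz|].
apply Rmax_lub_lt; assumption.
Qed.

Lemma is_derive_RInt_below (b : R) (u : R -> R) (s : R) :
  0 < b -> cont_below b u -> s < b -> is_derive (fun z => RInt u 0 z) s (u s).
Proof.
intros Hb Hu Hs; apply (is_derive_RIntR u _ 0); [|apply Hu, Hs].
generalize (open_lt b s Hs); apply filter_imp; intros z Hz.
apply RInt_correctR, (ex_RInt_below b); assumption.
Qed.

Lemma is_derive_prim (b : R) (u : R -> R) (s : R) :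
  0 < b -> cont_below b u -> 0 < s < b -> is_derive (prim u) s (u s).
Proof.
intros Hb Hu Hs; apply (is_derive_ext_loc (fun z => RInt u 0 z)).
- generalize (open_gt 0 s (proj1 Hs)); apply filter_imp; intros z Hz.
  unfold prim; rewrite Rmax_right by lra; reflexivity.
- apply (is_derive_RInt_below b); trivial; apply Hs.
Qed.

Lemma prim_nonpos (u : R -> R) (s : R) : s <= 0 -> prim u s = 0.
Proof. intros H; unfold prim; rewrite Rmax_left by exact H; exact (RInt_pointR 0 u). Qed.

Lemma cont_below_prim (b : R) (u : R -> R) :
  0 < b -> cont_below b u -> cont_below b (prim u).
Proof.
intros Hb Hu s Hs.
apply (continuous_comp (Rmax 0) (fun z => RInt u 0 z)).
- apply continuous_of_lipschitz; intros y; unfold Rmax.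
  repeat destruct (Rle_dec _ _); unfold Rabs; repeat destruct (Rcase_abs _); lra.
- apply continuous_of_is_derive with (u (Rmax 0 s)).
  apply (is_derive_RInt_below b); trivial; apply Rmax_lub_lt; assumption.
Qed.

(** Each integration gains a factor [1 / m] in the norm weighted by
    [exp (- m s)]. *)
Lemma prim_contracts (b m A : R) (u v : R -> R) (s1 : R) :
  0 < b -> cont_below b u -> cont_below b v -> 0 < m -> 0 <= A -> s1 < b ->
  (forall s, 0 <= s <= s1 -> Rabs (u s - v s) <= A * exp (m * s)) ->
  forall s, 0 <= s <= s1 -> Rabs (prim u s - prim v s) <= A / m * exp (m * s).
Proof.
intros Hb Hu Hv Hm HA Hs1 H s Hs; unfold prim; rewrite Rmax_right by apply Hs.
assert (Eu : ex_RInt u 0 s) by (apply (ex_RInt_below b); trivial; lra).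
assert (Ev : ex_RInt v 0 s) by (apply (ex_RInt_below b); trivial; lra).
replace (RInt u 0 s - RInt v 0 s) with (RInt (fun z => u z - v z) 0 s)
  by (apply (RInt_minusR u v); assumption).
assert (Euv : ex_RInt (fun z => u z - v z) 0 s) by (apply (ex_RInt_minusR u v); assumption).
assert (Ce : forall z, continuous (fun z => A * exp (m * z)) z).
{ intros z; apply ex_derive_continuousR; auto_derive; trivial. }
eapply Rle_trans; [apply abs_RInt_le; [lra|exact Euv]|].
apply Rle_trans with (RInt (fun z => A * exp (m * z)) 0 s).
- apply RInt_le; [lra| |apply ex_RInt_cont, Ce|intros z Hz; apply H; lra].
  apply ex_RInt_norm, Euv.
- rewrite (RInt_derive_open (fun z => A / m * exp (m * z))); [|lra| |exact Ce|].
  + rewrite Rmult_0_r, exp_0; assert (0 <= A / m); [|lra].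
    apply Rmult_le_pos; [exact HA|left; apply Rinv_0_lt_compat, Hm].
  + intros z _; apply ex_derive_continuousR; auto_derive; trivial.
  + intros z _; auto_derive; [trivial|field; lra].
Qed.

Lemma exp_mono (x y : R) : x <= y -> exp x <= exp y.
Proof.
intros [H| ->]; [left; apply exp_increasing, H|apply Rle_refl].
Qed.

Lemma geometric_cauchy (x : nat -> R) (A : R) :
  (forall n, Rabs (x (S n) - x n) <= A * (1 / 2) ^ n) ->
  exists l : R, is_lim_seq x l /\ forall n, Rabs (l - x n) <= 2 * A * (1 / 2) ^ n.
Proof.
intros H.
assert (Hp : forall n, 0 < (1 / 2) ^ n) by (intros; apply pow_lt; lra).
assert (HA : 0 <= A) by (specialize (H 0%nat); simpl in H; generalize (Rabs_pos (x 1%nat - x 0%nat)); lra).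
assert (Hk : forall k n, Rabs (x (n + k)%nat - x n) <= 2 * A * (1 / 2) ^ n - 2 * A * (1 / 2) ^ (n + k)).
{ induction k as [|k IH]; intros n.
  - rewrite Nat.add_0_r, Rminus_diag, Rabs_R0; lra.
  - replace (n + S k)%nat with (S (n + k)) by lia.
    replace (x (S (n + k)) - x n) with ((x (S (n + k)) - x (n + k)%nat) + (x (n + k)%nat - x n)) by ring.
    eapply Rle_trans; [apply Rabs_triang|].
    specialize (IH n); specialize (H (n + k)%nat); simpl (_ ^ S _); lra. }
assert (Hc : ex_finite_lim_seq x).
{ apply ex_lim_seq_cauchy_corr; intros eps.
  assert (Hl : is_lim_seq (fun n => 2 * A * (1 / 2) ^ n) 0).
  { replace (Finite 0) with (Rbar_mult (2 * A) 0) by (simpl; f_equal; ring).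
    apply is_lim_seq_scal_l, is_lim_seq_geom; rewrite Rabs_pos_eq; lra. }
  apply is_lim_seq_spec in Hl; destruct (Hl (mkposreal _ (is_pos_div_2 eps))) as [N HN].
  exists N.
  assert (HN2 : forall n, (N <= n)%nat -> Rabs (x n - x N) < eps / 2).
  { intros n Hn; replace n with (N + (n - N))%nat by lia.
    eapply Rle_lt_trans; [apply Hk|].
    specialize (HN N (Nat.le_refl N)); simpl in HN.
    rewrite Rminus_0_r, Rabs_pos_eq in HN by (specialize (Hp N); apply Rmult_le_pos; lra).
    assert (0 <= 2 * A * (1 / 2) ^ (N + (n - N))) by (apply Rmult_le_pos; [lra|left; apply Hp]); lra. }
  intros n p Hn Hp'; replace (x n - x p) with ((x n - x N) - (x p - x N)) by ring.
  eapply Rle_lt_trans; [apply Rabs_triang|]; rewrite Rabs_Ropp.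
  assert (h1 := HN2 n Hn); assert (h2 := HN2 p Hp'); lra. }
destruct Hc as [l Hl]; exists l; split; [exact Hl|]; intros n.
assert (Hl2 : is_lim_seq (fun k => Rabs (x (k + n)%nat - x n)) (Rabs (l - x n))).
{ apply (is_lim_seq_abs (fun k => x (k + n)%nat - x n) (l - x n)).
  apply (is_lim_seq_minus _ _ l (x n)).
  - apply (is_lim_seq_incr_n x n), Hl.
  - apply is_lim_seq_const.
  - reflexivity. }
assert (Hle : Rbar_le (Rabs (l - x n)) (2 * A * (1 / 2) ^ n)); [|exact Hle].
refine (is_lim_seq_le _ (fun _ => 2 * A * (1 / 2) ^ n) _ _ _ Hl2 (is_lim_seq_const _)).
intros k; rewrite Nat.add_comm; eapply Rle_trans; [apply Hk|].
assert (0 <= 2 * A * (1 / 2) ^ (n + k)) by (apply Rmult_le_pos; [lra|left; apply Hp]); lra.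
Qed.

(** Picard iteration for [g'' = k (s, g)] with zero data. The Lipschitz constant
    may blow up at [b], so the contraction is applied on each [[0,s1]] with
    its own exponential weight; the iterates do not depend on [s1]. *)
Lemma ivp_exists (b : R) (k : R -> R -> R) :
  0 < b ->
  (forall u, cont_below b u -> cont_below b (fun s => k s (u s))) ->
  (forall s1, 0 < s1 < b -> exists L, 0 < L /\
     forall s y z, 0 <= s <= s1 -> Rabs (k s y - k s z) <= L * Rabs (y - z)) ->
  exists g g1 : R -> R,
    cont_below b g /\ cont_below b g1 /\
    (forall s, s <= 0 -> g s = 0 /\ g1 s = 0) /\
    (forall s, 0 < s < b -> is_derive g s (g1 s)) /\
    (forall s, 0 < s < b -> is_derive g1 s (k s (g s))).
Proof.
intros Hb Hk HL.
pose (Phi := fun u => prim (prim (fun s => k s (u s)))).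
assert (CPhi : forall u, cont_below b u -> cont_below b (Phi u)).
{ intros u Hu; unfold Phi; do 2 (apply cont_below_prim; [exact Hb|]); apply Hk, Hu. }
assert (Hctr : forall s1, 0 < s1 < b -> exists m, 0 < m /\
  forall u v A, cont_below b u -> cont_below b v -> 0 <= A ->
  (forall s, 0 <= s <= s1 -> Rabs (u s - v s) <= A * exp (m * s)) ->
  forall s, 0 <= s <= s1 -> Rabs (Phi u s - Phi v s) <= A / 2 * exp (m * s)).
{ intros s1 Hs1; destruct (HL s1 Hs1) as (L & HL0 & HLip).
  exists (2 * L + 1); split; [lra|]; intros u v A Hu Hv HA H s Hs.
  set (m := 2 * L + 1) in *.
  assert (Hm : 1 < m) by (unfold m; lra).
  eapply Rle_trans.
  - apply (prim_contracts b m (A * L / m) (prim (fun s => k s (u s))) (prim (fun s => k s (v s))) s1);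
      try apply cont_below_prim; try apply Hk; try lra; trivial.
    + apply Rmult_le_pos; [apply Rmult_le_pos; lra|left; apply Rinv_0_lt_compat; lra].
    + apply (prim_contracts b m (A * L)); try apply Hk; try lra; trivial; [apply Rmult_le_pos; lra|].
      intros z Hz; eapply Rle_trans; [apply HLip, Hz|].
      specialize (H z Hz); replace (A * L * exp (m * z)) with (L * (A * exp (m * z))) by ring.
      apply Rmult_le_compat_l; lra.
  - apply Rmult_le_compat_r; [left; apply exp_pos|].
    apply Rmult_le_reg_r with (m * m); [nra|].
    replace (A * L / m / m * (m * m)) with (A * L) by (field; lra).
    replace (A / 2 * (m * m)) with (A * (m * m / 2)) by field.
    apply Rmult_le_compat_l; [exact HA|unfold m; nra]. }
pose (phi := fun n => Nat.iter n Phi (fun _ => 0)).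
assert (Cphi : forall n, cont_below b (phi n)).
{ induction n as [|n IH]; [intros s _; apply continuous_const|apply CPhi, IH]. }
assert (Hneg : forall n s, s <= 0 -> phi n s = 0).
{ intros [|n] s Hs; [reflexivity|apply prim_nonpos, Hs]. }
assert (Hstep : forall s1, 0 < s1 < b -> exists m B, 0 < m /\ 0 <= B /\
  forall n s, s <= s1 -> Rabs (phi (S n) s - phi n s) <= B * (1 / 2) ^ n * exp (m * Rmax 0 s)).
{ intros s1 Hs1; destruct (Hctr s1 Hs1) as (m & Hm & HPhi).
  assert (HB : exists B, 0 <= B /\ forall s, 0 <= s <= s1 -> Rabs (phi 1%nat s) <= B).
  { destruct (continuity_ab_maj (fun s => Rabs (phi 1%nat s)) 0 s1) as [z [Hz _]]; [lra| |].
    - intros s Hs; apply continuous_continuity_pt.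
      apply (continuous_comp (phi 1%nat) Rabs); [apply Cphi; lra|].
      apply continuous_Rabs.
    - exists (Rabs (phi 1%nat z)); split; [apply Rabs_pos|exact Hz]. }
  destruct HB as (B & HB0 & HB); exists m, B; split; [exact Hm|split; [exact HB0|]].
  assert (Hpos : forall n s, 0 <= s <= s1 -> Rabs (phi (S n) s - phi n s) <= B * (1 / 2) ^ n * exp (m * s)).
  { induction n as [|n IH]; intros s Hs.
    - change (phi 0%nat s) with 0; rewrite Rminus_0_r, pow_O, Rmult_1_r.
      eapply Rle_trans; [apply HB, Hs|].
      assert (1 <= exp (m * s)) by (rewrite <- exp_0; apply exp_mono; apply Rmult_le_pos; lra).
      nra.
    - replace (B * (1 / 2) ^ S n) with (B * (1 / 2) ^ n / 2) by (simpl; field).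
      apply (HPhi (phi (S n)) (phi n)); trivial.
      apply Rmult_le_pos; [exact HB0|apply pow_le; lra]. }
  intros n s Hs; destruct (Rle_dec 0 s) as [H0|H0].
  - rewrite Rmax_right by exact H0; apply Hpos; lra.
  - rewrite !Hneg, Rminus_diag, Rabs_R0 by lra.
    apply Rmult_le_pos; [apply Rmult_le_pos; [exact HB0|apply pow_le; lra]|left; apply exp_pos]. }
pose (g := fun s => real (Lim_seq (fun n => phi n s))).
assert (Hg : forall s1, 0 < s1 < b -> exists m B, 0 < m /\ 0 <= B /\
  forall n s, s <= s1 -> Rabs (g s - phi n s) <= B * (1 / 2) ^ n * exp (m * Rmax 0 s)).
{ intros s1 Hs1; destruct (Hstep s1 Hs1) as (m & B & Hm & HB & H).
  exists m, (2 * B); split; [exact Hm|split; [lra|]]; intros n s Hs.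
  destruct (geometric_cauchy (fun n => phi n s) (B * exp (m * Rmax 0 s))) as (l & Hl & Hln).
  - intros j; eapply Rle_trans; [apply H, Hs|right; ring].
  - unfold g; rewrite (is_lim_seq_unique _ _ Hl); simpl.
    eapply Rle_trans; [apply Hln|right; ring]. }
assert (Hsmall : forall M, 0 <= M -> forall eps : posreal, exists n, M * (1 / 2) ^ n < eps).
{ intros M HM eps.
  assert (Hl : is_lim_seq (fun n => M * (1 / 2) ^ n) 0).
  { replace (Finite 0) with (Rbar_mult M 0) by (simpl; f_equal; ring).
    apply is_lim_seq_scal_l, is_lim_seq_geom; rewrite Rabs_pos_eq; lra. }
  apply is_lim_seq_spec in Hl; destruct (Hl eps) as [N HN]; exists N.
  specialize (HN N (Nat.le_refl N)); rewrite Rminus_0_r in HN.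
  eapply Rle_lt_trans; [apply Rle_abs|exact HN]. }
assert (Hmid : forall s, s < b -> exists s1, 0 < s1 < b /\ s < s1).
{ intros s Hs; exists ((Rmax 0 s + b) / 2).
  assert (0 <= Rmax 0 s) by apply Rmax_l; assert (s <= Rmax 0 s) by apply Rmax_r.
  assert (Rmax 0 s < b) by (apply Rmax_lub_lt; assumption); lra. }
assert (Cg : cont_below b g).
{ intros s Hs; destruct (Hmid s Hs) as (s1 & Hs1 & Hss1).
  destruct (Hg s1 Hs1) as (m & B & Hm & HB & H).
  apply filterlim_locally; intros eps.
  assert (HM : 0 <= B * exp (m * s1)) by (apply Rmult_le_pos; [exact HB|left; apply exp_pos]).
  assert (He : 0 < eps / 3) by (destruct eps; simpl; lra).
  destruct (Hsmall _ HM (mkposreal _ He)) as [n Hn]; simpl in Hn.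
  assert (Hu : forall z, z <= s1 -> Rabs (g z - phi n z) < eps / 3).
  { intros z Hz; eapply Rle_lt_trans; [apply H, Hz|]; eapply Rle_lt_trans; [|exact Hn].
    replace (B * exp (m * s1) * (1 / 2) ^ n) with (B * (1 / 2) ^ n * exp (m * s1)) by ring.
    apply Rmult_le_compat_l; [apply Rmult_le_pos; [exact HB|apply pow_le; lra]|].
    apply exp_mono, Rmult_le_compat_l; [lra|apply Rmax_lub; lra]. }
  assert (Hlt : locally s (fun z => z < s1)) by (apply open_lt, Hss1).
  generalize (filter_and _ _ Hlt (proj1 (filterlim_locally _ _) (Cphi n s Hs) (mkposreal _ He))).
  apply filter_imp; intros z [Hz Hb2].
  change (Rabs (phi n z - phi n s) < eps / 3) in Hb2; change (Rabs (g z - g s) < eps).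
  assert (h1 := Hu z (Rlt_le _ _ Hz)); assert (h2 := Hu s (Rlt_le _ _ Hss1)).
  replace (g z - g s) with ((g z - phi n z) + (phi n z - phi n s) - (g s - phi n s)) by ring.
  eapply Rle_lt_trans; [apply Rabs_triang|]; rewrite Rabs_Ropp.
  assert (h3 := Rabs_triang (g z - phi n z) (phi n z - phi n s)); lra. }
assert (Hfix : forall s, s < b -> g s = Phi g s).
{ intros s Hs; destruct (Rle_dec s 0) as [Hs0|Hs0].
  { unfold Phi; rewrite (prim_nonpos _ s Hs0); unfold g.
    rewrite (Lim_seq_ext _ (fun _ => 0)) by (intros; apply Hneg, Hs0).
    rewrite Lim_seq_const; reflexivity. }
  destruct (Hmid s Hs) as (s1 & Hs1 & Hss1).
  destruct (Hstep s1 Hs1) as (m0 & B0 & _).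
  destruct (Hctr s1 Hs1) as (m & Hm & HPhi).
  destruct (Hg s1 Hs1) as (m' & B & Hm' & HB & H).
  apply Rminus_diag_uniq.
  destruct (Req_dec (g s - Phi g s) 0) as [Z|Z]; [exact Z|exfalso].
  assert (Hp : 0 < Rabs (g s - Phi g s)) by (apply Rabs_pos_lt, Z).
  set (M := B * exp (m' * s1)).
  assert (HM : 0 <= M) by (apply Rmult_le_pos; [exact HB|left; apply exp_pos]).
  assert (Hu : forall n z, z <= s1 -> Rabs (g z - phi n z) <= M * (1 / 2) ^ n).
  { intros n z Hz; eapply Rle_trans; [apply H, Hz|].
    unfold M; replace (B * exp (m' * s1) * (1 / 2) ^ n) with (B * (1 / 2) ^ n * exp (m' * s1)) by ring.
    apply Rmult_le_compat_l; [apply Rmult_le_pos; [exact HB|apply pow_le; lra]|].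
    apply exp_mono, Rmult_le_compat_l; [lra|apply Rmax_lub; lra]. }
  set (M2 := M + M * exp (m * s)).
  assert (HM2 : 0 <= M2) by (unfold M2; apply Rplus_le_le_0_compat; [exact HM|apply Rmult_le_pos; [exact HM|left; apply exp_pos]]).
  destruct (Hsmall M2 HM2 (mkposreal _ Hp)) as [n Hn]; simpl in Hn.
  assert (H1 := Hu (S n) s (Rlt_le _ _ Hss1)).
  assert (H2 : Rabs (Phi g s - Phi (phi n) s) <= M * (1 / 2) ^ n / 2 * exp (m * s)).
  { apply (HPhi g (phi n)); trivial; [apply Rmult_le_pos; [exact HM|apply pow_le; lra]| |lra].
    intros z Hz; eapply Rle_trans; [apply Hu; lra|].
    assert (1 <= exp (m * z)) by (rewrite <- exp_0; apply exp_mono; apply Rmult_le_pos; lra).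
    assert (0 <= M * (1 / 2) ^ n) by (apply Rmult_le_pos; [exact HM|apply pow_le; lra]).
    nra. }
  change (Phi (phi n) s) with (phi (S n) s) in H2.
  assert (Rabs (g s - Phi g s) <= M2 * (1 / 2) ^ n); [|lra].
  replace (g s - Phi g s) with ((g s - phi (S n) s) - (Phi g s - phi (S n) s)) by ring.
  eapply Rle_trans; [apply Rabs_triang|]; rewrite Rabs_Ropp.
  unfold M2; simpl (_ ^ S _) in H1.
  assert (0 <= M * (1 / 2) ^ n) by (apply Rmult_le_pos; [exact HM|apply pow_le; lra]).
  assert (He := exp_pos (m * s)); nra. }
assert (Ckg : cont_below b (fun s => k s (g s))) by apply Hk, Cg.
exists g, (prim (fun s => k s (g s))); split; [exact Cg|split; [|split; [|split]]].
- apply cont_below_prim; assumption.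
- intros s Hs; split; [|apply prim_nonpos, Hs].
  rewrite Hfix by lra; apply prim_nonpos, Hs.
- intros s Hs; apply (is_derive_ext_loc (Phi g)).
  + generalize (open_lt b s (proj2 Hs)); apply filter_imp; intros z Hz; symmetry; apply Hfix, Hz.
  + apply (is_derive_prim b (prim (fun s => k s (g s)))); trivial; apply cont_below_prim; assumption.
- intros s Hs; apply (is_derive_prim b (fun s => k s (g s))); assumption.
Qed.

(** * Inverse and implicit functions of one variable *)

(** Where [N] vanishes, the increment of [phi] contributes to [N * phi] only at
    second order. *)
Lemma is_derive_mult_continuous (N phi : R -> R) (s a : R) :
  N s = 0 -> is_derive N s a -> continuous phi s ->
  is_derive (fun z => N z * phi z) s (a * phi s).
Proof.
intros H0 HN Hphi; apply is_derive_eps; intros eps.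
set (A := Rabs a + 1); set (B := Rabs (phi s) + 1).
assert (HA : 0 < A) by (unfold A; generalize (Rabs_pos a); lra).
assert (HB : 0 < B) by (unfold B; generalize (Rabs_pos (phi s)); lra).
assert (He1 : 0 < eps / (2 * B)) by (apply Rdiv_lt_0_compat; [apply cond_pos|lra]).
assert (He2 : 0 < Rmin 1 (eps / (2 * A))) by (apply Rmin_pos; [lra|apply Rdiv_lt_0_compat; [apply cond_pos|lra]]).
destruct (proj1 (is_derive_eps N s a) HN (mkposreal _ He1)) as [d1 Hd1].
destruct (proj1 (filterlim_locally _ _) Hphi (mkposreal _ He2)) as [d2 Hd2].
assert (Hd : 0 < Rmin d1 d2) by (apply Rmin_pos; apply cond_pos).
exists (mkposreal _ Hd); simpl; intros z Hz.
assert (h1 := Hd1 z (Rlt_le_trans _ _ _ Hz (Rmin_l _ _))); simpl in h1.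
assert (h2 := Hd2 z (Rlt_le_trans _ _ _ Hz (Rmin_r _ _))).
change (Rabs (phi z - phi s) < Rmin 1 (eps / (2 * A))) in h2.
assert (h3 : Rabs (phi z - phi s) <= 1) by (left; eapply Rlt_le_trans; [exact h2|apply Rmin_l]).
assert (h4 : Rabs (phi z - phi s) <= eps / (2 * A)) by (left; eapply Rlt_le_trans; [exact h2|apply Rmin_r]).
rewrite H0 in *; rewrite Rmult_0_l, Rminus_0_r; rewrite Rminus_0_r in h1.
replace (N z * phi z - (z - s) * (a * phi s))
  with ((N z - (z - s) * a) * phi z + (z - s) * (a * (phi z - phi s))) by ring.
eapply Rle_trans; [apply Rabs_triang|]; rewrite !Rabs_mult.
assert (hB : Rabs (phi z) <= B).
{ unfold B; replace (phi z) with ((phi z - phi s) + phi s) by ring.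
  eapply Rle_trans; [apply Rabs_triang|lra]. }
assert (g1 : Rabs (N z - (z - s) * a) * Rabs (phi z) <= eps / (2 * B) * Rabs (z - s) * B).
{ apply Rmult_le_compat; try apply Rabs_pos; assumption. }
assert (g2 : Rabs a * Rabs (phi z - phi s) <= A * (eps / (2 * A))).
{ apply Rmult_le_compat; try apply Rabs_pos; [unfold A; lra|assumption]. }
replace (eps / (2 * B) * Rabs (z - s) * B) with (eps / 2 * Rabs (z - s)) in g1 by (field; lra).
replace (A * (eps / (2 * A))) with (eps / 2) in g2 by (field; lra).
assert (Hp := Rabs_pos (z - s)).
assert (Rabs (z - s) * (Rabs a * Rabs (phi z - phi s)) <= Rabs (z - s) * (eps / 2)) by (apply Rmult_le_compat_l; assumption).
lra.
Qed.

(** [h z - h s] is, up to sign, the increment of [G] in its first variable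
    divided by the slope of the chord of [G z] between [h s] and [h z]; that
    slope is a value of [J] near [(s, h s)], so it tends to [J s (h s)]. *)
Lemma is_derive_implicit (G J : R -> R -> R) (h : R -> R) (s x a : R) :
  locally s (fun z => G z (h z) = x /\ forall y, is_derive (G z) y (J z y)) ->
  continuous h s -> is_derive (fun z => G z (h s)) s a ->
  cont2 J s (h s) -> J s (h s) <> 0 ->
  is_derive h s (- a / J s (h s)).
Proof.
intros HG Hh Ha HJ HJ0; set (y0 := h s) in *.
assert (Hslope : forall z, exists j, (forall y, is_derive (G z) y (J z y)) ->
  G z (h z) - G z y0 = j * (h z - y0) /\ exists xi, Rabs (xi - y0) <= Rabs (h z - y0) /\ j = J z xi).
{ intros z.
  destruct (classic (forall y, is_derive (G z) y (J z y))) as [D|D]; [|exists 0; tauto].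
  destruct (MVT_gen (G z) y0 (h z) (J z)) as [xi [Hxi E]].
  - intros y _; apply D.
  - intros y _; apply continuous_continuity_pt, continuous_of_is_derive with (J z y), D.
  - exists (J z xi); intros _; split; [exact E|exists xi; split; [|reflexivity]].
    revert Hxi; unfold Rmin, Rmax; destruct (Rle_dec _ _); unfold Rabs;
      repeat destruct (Rcase_abs _); lra. }
pose (j := fun z => proj1_sig (constructive_indefinite_description _ (Hslope z))).
assert (Hj : forall z, (forall y, is_derive (G z) y (J z y)) ->
  G z (h z) - G z y0 = j z * (h z - y0) /\ exists xi, Rabs (xi - y0) <= Rabs (h z - y0) /\ j z = J z xi).
{ intros z; unfold j; destruct (constructive_indefinite_description _ (Hslope z)) as [q Hq]; exact Hq. }
assert (Hjs : j s = J s y0).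
{ destruct (Hj s) as [_ [xi [Hxi ->]]]; [apply (locally_singleton _ _ HG)|].
  fold y0 in Hxi; rewrite Rminus_diag, Rabs_R0 in Hxi.
  f_equal; apply Rminus_diag_uniq; destruct (Req_dec (xi - y0) 0) as [Z|Z]; [exact Z|].
  apply Rabs_pos_lt in Z; lra. }
assert (Cj : continuous j s).
{ apply filterlim_locally; intros eps.
  destruct (proj1 (cont2_iff J s y0) HJ eps) as [d Hd].
  assert (Hl : locally s (fun z => Rabs (z - s) < d)) by (exists d; auto).
  generalize (filter_and _ _ Hl (filter_and _ _ HG (proj1 (filterlim_locally _ _) Hh d))).
  apply filter_imp; intros z (Hz & [_ D] & Hhz).
  change (Rabs (h z - y0) < d) in Hhz; change (Rabs (j z - j s) < eps).
  destruct (Hj z D) as [_ [xi [Hxi ->]]]; rewrite Hjs; apply Hd; lra. }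
assert (D : is_derive (fun z => y0 + (G z y0 - x) * (- / j z)) s (- a / J s y0)).
{ replace (- a / J s y0) with (0 + a * (- / j s)) by (rewrite Hjs; field; exact HJ0).
  apply (is_derive_plusR (fun _ => y0)); [apply is_derive_constR|].
  apply (is_derive_mult_continuous (fun z => G z y0 - x) (fun z => - / j z)).
  - change (G s (h s) - x = 0); rewrite (proj1 (locally_singleton _ _ HG)); ring.
  - replace a with (a - 0) by ring.
    apply (is_derive_minusR (fun z => G z y0) (fun _ => x));
      [exact Ha|apply is_derive_constR].
  - apply continuous_oppR.
    apply (continuous_comp j Rinv); [exact Cj|apply continuous_Rinv; rewrite Hjs; exact HJ0]. }
revert D; apply is_derive_ext_loc.
assert (Hne : locally s (fun z => j z <> 0)).
{ apply (Cj (fun y => y <> 0)), open_neq; rewrite Hjs; exact HJ0. }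
generalize (filter_and _ _ Hne HG); apply filter_imp; intros z (Hz & E & D).
destruct (Hj z D) as [E2 _]; rewrite E in E2.
replace (G z y0 - x) with (- (j z * (h z - y0))) by lra.
eq_R; field; exact Hz.
Qed.

Lemma is_derive_inverse (F dF h : R -> R) (t : R) :
  locally t (fun z => F (h z) = z) -> continuous h t ->
  is_derive F (h t) (dF (h t)) -> dF (h t) <> 0 ->
  is_derive h t (/ dF (h t)).
Proof.
intros HF Hh HD Hne; set (y0 := h t) in *.
pose (slope := fun y => match Req_EM_T y y0 with left _ => dF y0 | right _ => (F y - F y0) / (y - y0) end).
assert (Hsl : forall y, F y - F y0 = slope y * (y - y0)).
{ intros y; unfold slope; destruct (Req_EM_T y y0) as [->|Hn]; [ring|field; lra]. }
assert (Hs0 : slope y0 = dF y0) by (unfold slope; destruct (Req_EM_T y0 y0); tauto).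
assert (Cs : continuous slope y0).
{ apply filterlim_locally; intros eps.
  assert (He : 0 < eps / 2) by (destruct eps; simpl; lra).
  destruct (proj1 (is_derive_eps F y0 _) HD (mkposreal _ He)) as [d Hd]; exists d; intros y Hy.
  change (Rabs (slope y - slope y0) < eps); rewrite Hs0; unfold slope.
  destruct (Req_EM_T y y0) as [E|Hn]; [rewrite Rminus_diag, Rabs_R0; apply cond_pos|].
  specialize (Hd y Hy); simpl in Hd.
  assert (Hp : 0 < Rabs (y - y0)) by (apply Rabs_pos_lt; lra).
  apply Rle_lt_trans with (eps / 2); [|destruct eps; simpl; lra].
  apply Rmult_le_reg_r with (Rabs (y - y0)); [exact Hp|]; rewrite <- Rabs_mult.
  replace (((F y - F y0) / (y - y0) - dF y0) * (y - y0)) with (F y - F y0 - (y - y0) * dF y0) by (field; lra).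
  exact Hd. }
assert (Csh : continuous (fun z => slope (h z)) t) by (apply (continuous_comp h slope); [exact Hh|exact Cs]).
assert (D : is_derive (fun z => y0 + (z - t) * (/ slope (h z))) t (/ dF y0)).
{ replace (/ dF y0) with (0 + 1 * / slope (h t)) by (fold y0; rewrite Hs0; ring).
  apply (is_derive_plusR (fun _ => y0)); [apply is_derive_constR|].
  apply (is_derive_mult_continuous (fun z => z - t) (fun z => / slope (h z))).
  - ring.
  - auto_derive; [trivial|ring].
  - apply (continuous_comp (fun z => slope (h z)) Rinv); [exact Csh|].
    apply continuous_Rinv; fold y0; rewrite Hs0; exact Hne. }
revert D; apply is_derive_ext_loc.
assert (Hn : locally t (fun z => slope (h z) <> 0)).
{ apply (Csh (fun y => y <> 0)), open_neq; fold y0; rewrite Hs0; exact Hne. }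
assert (E0 : F y0 = t) by exact (locally_singleton _ _ HF).
generalize (filter_and _ _ Hn HF); apply filter_imp; intros z (Hz & E).
assert (E2 := Hsl (h z)); rewrite E, E0 in E2; rewrite E2.
eq_R; field; exact Hz.
Qed.

Lemma increasing_of_derive (F dF : R -> R) (P : R -> Prop) :
  (forall x y z, P x -> P z -> x <= y <= z -> P y) ->
  (forall x, P x -> is_derive F x (dF x) /\ 0 < dF x) ->
  forall x y, P x -> P y -> x < y -> F x < F y.
Proof.
intros HP HF x y Hx Hy Hxy.
assert (Hm : forall z, Rmin x y <= z <= Rmax x y -> P z).
{ rewrite Rmin_left, Rmax_right by lra; intros z Hz; apply (HP x z y); assumption. }
destruct (MVT_gen F x y dF) as [z [Hz E]].
- intros z Hz; apply HF, Hm; lra.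
- intros z Hz; apply continuous_continuity_pt, continuous_of_is_derive with (dF z), HF, Hm, Hz.
- assert (H := proj2 (HF z (Hm z Hz))); nra.
Qed.

Lemma surjective_of_derive (F dF : R -> R) (m : R) :
  0 < m -> (forall x, is_derive F x (dF x) /\ m <= dF x) ->
  forall x, exists y, F y = x.
Proof.
intros Hm HF x.
assert (CF : continuity F).
{ intros y; apply continuous_continuity_pt, continuous_of_is_derive with (dF y), HF. }
assert (Hgr : forall a b, a <= b -> m * (b - a) <= F b - F a).
{ intros a b Hab; destruct (MVT_gen F a b dF) as [z [_ E]].
  - intros z _; apply HF.
  - intros z _; apply CF.
  - rewrite E; apply Rmult_le_compat_r; [lra|apply HF]. }
set (y := Rabs (x - F 0) / m).
assert (Hy : m * y = Rabs (x - F 0)) by (unfold y; field; lra).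
assert (Hy0 : 0 <= y) by (apply Rmult_le_pos; [apply Rabs_pos|left; apply Rinv_0_lt_compat, Hm]).
assert (H1 := Hgr 0 y Hy0); assert (H2 := Hgr (- y) 0 ltac:(lra)).
assert (H3 : - Rabs (x - F 0) <= x - F 0 <= Rabs (x - F 0)) by (apply Rabs_le_between, Rle_refl).
destruct (IVT_gen F (- y) y x CF) as [z [_ Hz]]; [|exists z; exact Hz].
split; [eapply Rle_trans; [apply Rmin_l|]; lra|eapply Rle_trans; [|apply Rmax_r]; lra].
Qed.

(** * The solution in Lagrangian variables *)

Lemma continuous_Rmax_0 (s : R) : continuous (Rmax 0) s.
Proof.
apply continuous_of_lipschitz; intros y; unfold Rmax.
repeat destruct (Rle_dec _ _); unfold Rabs; repeat destruct (Rcase_abs _); lra.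
Qed.

Lemma continuous_cl_bounded (h : R -> R) :
  (forall a, continuous (fun a => h (cl a)) a) ->
  exists B, 0 <= B /\ forall a, Rabs (h (cl a)) <= B.
Proof.
intros H; destruct (continuity_ab_maj (fun a => Rabs (h (cl a))) 0 1) as [z [Hz _]]; [lra| |].
- intros s _; apply continuous_continuity_pt.
  apply (continuous_comp (fun a => h (cl a)) Rabs); [apply H|apply continuous_Rabs].
- exists (Rabs (h (cl z))); split; [apply Rabs_pos|intros a].
  assert (Hz' := Hz (cl a) (cl_I01 a)); simpl in Hz'.
  rewrite (clamp_id 0 1 (cl a) (cl_I01 a)) in Hz'; exact Hz'.
Qed.

Lemma is_derive_cst (c t : R) : is_derive (fun _ : R => c) t 0.
Proof. apply is_derive_constR. Qed.

Section Lagrangian.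

Variables (u du r dr : R -> R) (M : R).
Hypothesis M_pos : 0 < M.
Hypothesis u_le : forall x, I01 x -> u x <= M.
Hypothesis r_ge : forall x, I01 x -> 0 <= r x.
Hypothesis u_derive : forall x, I01 x -> is_derive u x (du x).
Hypothesis r_derive : forall x, I01 x -> is_derive r x (dr x).
Hypothesis du_cont : forall x, continuous (fun a => du (cl a)) x.
Hypothesis dr_cont : forall x, continuous (fun a => dr (cl a)) x.

Lemma cont_cl_of_derive (h dh : R -> R) :
  (forall x, I01 x -> is_derive h x (dh x)) -> forall x, continuous (fun a => h (cl a)) x.
Proof.
intros H x; apply (continuous_comp (clamp 0 1) h); [apply continuous_clamp|].
apply continuous_of_is_derive with (dh (cl x)), H, cl_I01.
Qed.

Let u_cont : forall x, continuous (fun a => u (cl a)) x := cont_cl_of_derive u du u_derive.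
Let r_cont : forall x, continuous (fun a => r (cl a)) x := cont_cl_of_derive r dr r_derive.

(** * The equation for the coefficient [g] *)

(** Truncating at 0 keeps the denominator positive for all [y] and all
    [s < / M], so that the equation for [g] has a right-hand side defined
    without restriction on [g]. *)
Definition gen_den (s y a : R) : R := 1 - Rmax 0 s * u (cl a) + Rmax 0 y * r (cl a).

Lemma time_factor_pos (s : R) : s < / M -> 0 < 1 - Rmax 0 s * M.
Proof.
intros H; assert (Hs : Rmax 0 s < / M) by (apply Rmax_lub_lt; [apply Rinv_0_lt_compat, M_pos|exact H]).
apply (Rmult_lt_compat_r M) in Hs; [rewrite Rinv_l in Hs|]; lra.
Qed.

Lemma gen_den_ge (s y a : R) : 1 - Rmax 0 s * M <= gen_den s y a.
Proof.
unfold gen_den.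
assert (0 <= Rmax 0 s) by apply Rmax_l; assert (0 <= Rmax 0 y) by apply Rmax_l.
assert (Hu := u_le _ (cl_I01 a)); assert (Hr := r_ge _ (cl_I01 a)).
assert (0 <= Rmax 0 y * r (cl a)) by (apply Rmult_le_pos; assumption).
assert (Rmax 0 s * u (cl a) <= Rmax 0 s * M) by (apply Rmult_le_compat_l; assumption); lra.
Qed.

Lemma continuous_inv_gen_den (s y a : R) : s < / M -> continuous (fun a => / gen_den s y a) a.
Proof.
intros Hs; apply (cont2_snd (fun _ a => / gen_den s y a) 0 a).
assert (C3 := cont2_of_snd _ 0 a (u_cont a)); assert (C4 := cont2_of_snd _ 0 a (r_cont a)).
apply cont2_inv; [unfold gen_den; cont2_tac|].
assert (H1 := gen_den_ge s y a); assert (H2 := time_factor_pos s Hs); lra.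
Qed.

(** Labels enter the equation only through an integral, so it is a scalar one.
    On [[0,s1]] the denominator is at least [1 - s1 M], which gives the Lipschitz
    constant; it degenerates as [s1] tends to [/ M]. *)
Lemma coefficient_exists : exists g g1 : R -> R,
  cont_below (/ M) g /\ cont_below (/ M) g1 /\
  (forall s, s <= 0 -> g s = 0 /\ g1 s = 0) /\
  (forall s, s < / M -> 0 <= g s) /\ (forall s, s < / M -> 0 <= g1 s) /\
  (forall s, 0 < s < / M -> is_derive g s (g1 s)) /\
  (forall s, 0 < s < / M -> is_derive g1 s
     (RInt (fun a => / (1 - Rmax 0 s * u (cl a) + g s * r (cl a))) 0 1 ^ 3)).
Proof.
assert (Hb : 0 < / M) by (apply Rinv_0_lt_compat, M_pos).
assert (Hcont : forall v, cont_below (/ M) v -> forall s, s < / M -> forall a,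
  cont2 (fun z a => / gen_den z (v z) a) s a).
{ intros v Hv s Hs a.
  assert (C1 := cont2_of_fst (Rmax 0) s a (continuous_Rmax_0 s)).
  assert (C2 : cont2 (fun z _ => Rmax 0 (v z)) s a).
  { apply (cont2_of_fst (fun z => Rmax 0 (v z))), (continuous_comp v (Rmax 0)); [apply Hv, Hs|apply continuous_Rmax_0]. }
  assert (C3 := cont2_of_snd _ s a (u_cont a)); assert (C4 := cont2_of_snd _ s a (r_cont a)).
  apply cont2_inv; [unfold gen_den; cont2_tac|].
  assert (H1 := gen_den_ge s (v s) a); assert (H2 := time_factor_pos s Hs); lra. }
destruct (ivp_exists (/ M) (fun s y => RInt (fun a => / gen_den s y a) 0 1 ^ 3) Hb)
  as (g & g1 & Cg & Cg1 & H0 & Dg & Dg1).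
3:{ assert (mono : forall h dh : R -> R, cont_below (/ M) h ->
      (forall s, 0 < s < / M -> is_derive h s (dh s) /\ 0 <= dh s) ->
      (forall s, s <= 0 -> h s = 0) -> forall s, s < / M -> 0 <= h s).
    { intros h dh Ch Dh Hz s Hs; destruct (Rle_dec s 0) as [L|L]; [rewrite Hz; lra|].
      rewrite <- (Ropp_involutive (h s)); apply Ropp_0_ge_le_contravar, Rle_ge.
      rewrite <- Ropp_0, <- (Hz 0 (Rle_refl 0)).
      apply (nonincreasing_of_derive (fun z => - h z) (fun z => - dh z) 0 s); [lra| | |].
      - intros z Hz'; apply continuous_oppR, Ch; lra.
      - intros z Hz'; apply is_derive_oppR, Dh; lra.
      - intros z Hz'; assert (H := proj2 (Dh z ltac:(lra))); lra. }
    assert (P1 : forall s, s < / M -> 0 <= g1 s).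
    { apply (mono g1 (fun s => RInt (fun a => / gen_den s (g s) a) 0 1 ^ 3) Cg1); [|intros; apply H0; assumption].
      intros s Hs; split; [apply Dg1, Hs|]; apply pow_le, RInt_ge_0; [lra| |].
      - apply ex_RInt_cont; intros a; apply continuous_inv_gen_den, Hs.
      - intros a _; apply Rlt_le, Rinv_0_lt_compat.
        assert (H1 := gen_den_ge s (g s) a); assert (H2 := time_factor_pos s (proj2 Hs)); lra. }
    assert (P : forall s, s < / M -> 0 <= g s).
    { apply (mono g g1 Cg); [|intros; apply H0; assumption].
      intros s Hs; split; [apply Dg, Hs|apply P1, Hs]. }
    exists g, g1; split; [exact Cg|split; [exact Cg1|split; [exact H0|split; [exact P|split; [exact P1|split; [exact Dg|]]]]]].
    intros s Hs; rewrite (RInt_ext _ (fun a => / gen_den s (g s) a)); [apply Dg1, Hs|].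
    intros a _; unfold gen_den; rewrite (Rmax_right 0 (g s)) by (apply P, Hs); reflexivity. }
- intros v Hv s Hs; apply (cont2_fst (fun s (_ : R) => RInt (fun a => / gen_den s (v s) a) 0 1 ^ 3) s 0).
  apply (cont2_pow (fun s _ => RInt (fun a => / gen_den s (v s) a) 0 1)).
  apply (cont2_of_fst (fun s => RInt (fun a => / gen_den s (v s) a) 0 1)).
  apply (continuous_RInt_param (fun s a => / gen_den s (v s) a)).
  generalize (open_lt (/ M) s Hs); apply filter_imp; intros z Hz a; apply Hcont; assumption.
- intros s1 Hs1; destruct (continuous_cl_bounded r r_cont) as (B & HB0 & HB).
  set (m := 1 - s1 * M).
  assert (Hm : 0 < m).
  { assert (H := time_factor_pos s1 (proj2 Hs1)); rewrite Rmax_right in H by lra; exact H. }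
  assert (Hm' : 0 < / m) by (apply Rinv_0_lt_compat, Hm).
  exists (3 * (/ m * / m) * (B * / m * / m) + 1); split.
  { assert (0 <= 3 * (/ m * / m) * (B * / m * / m)); [|lra].
    repeat apply Rmult_le_pos; lra. }
  intros s y z Hs.
  assert (Hden : forall y a, m <= gen_den s y a).
  { intros y' a; eapply Rle_trans; [|apply gen_den_ge]; rewrite Rmax_right by lra; unfold m.
    assert (s * M <= s1 * M) by (apply Rmult_le_compat_r; lra); lra. }
  assert (Cv : forall y a, continuous (fun a => / gen_den s y a) a).
  { intros y' a; apply (cont2_snd (fun z a => / gen_den z y' a) s a).
    apply (Hcont (fun _ => y')); [intros w _; apply continuous_const|lra]. }
  assert (Ex : forall y, ex_RInt (fun a => / gen_den s y a) 0 1) by (intros; apply ex_RInt_cont, Cv).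
  assert (Hinv : forall y a, 0 < / gen_den s y a <= / m).
  { intros y' a; assert (H := Hden y' a); split; [apply Rinv_0_lt_compat; lra|apply Rinv_le_contravar; lra]. }
  set (k := fun y => RInt (fun a => / gen_den s y a) 0 1).
  assert (Hk : forall y, 0 <= k y <= / m).
  { intros y'; unfold k; split.
    - apply RInt_ge_0; [lra|apply Ex|intros a _; apply Rlt_le, Hinv].
    - replace (/ m) with (RInt (fun _ => / m) 0 1) by (rewrite RInt_cst; ring_R).
      apply RInt_le; [lra|apply Ex|apply ex_RInt_const|intros a _; apply Hinv]. }
  assert (Hkd : Rabs (k y - k z) <= B * / m * / m * Rabs (y - z)).
  { unfold k.
    replace (RInt (fun a => / gen_den s y a) 0 1 - RInt (fun a => / gen_den s z a) 0 1)
      with (RInt (fun a => / gen_den s y a - / gen_den s z a) 0 1)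
      by (apply (RInt_minusR (fun a => / gen_den s y a)); apply Ex).
    replace (B * / m * / m * Rabs (y - z)) with ((1 - 0) * (B * / m * / m * Rabs (y - z))) by ring.
    apply abs_RInt_le_const; [lra|apply (ex_RInt_minusR (fun a => / gen_den s y a)); apply Ex|].
    intros a _.
    assert (h1 := Hden y a); assert (h2 := Hden z a).
    replace (/ gen_den s y a - / gen_den s z a)
      with ((Rmax 0 z - Rmax 0 y) * (r (cl a) * / gen_den s y a * / gen_den s z a))
      by (unfold gen_den in *; field; lra).
    rewrite Rabs_mult, (Rmult_comm (Rabs _)), !Rabs_mult.
    rewrite !(Rabs_pos_eq (/ _)) by (apply Rlt_le, Hinv).
    apply Rmult_le_compat; [|apply Rabs_pos| |].
    - repeat apply Rmult_le_pos; [apply Rabs_pos|apply Rlt_le, Hinv|apply Rlt_le, Hinv].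
    - apply Rmult_le_compat; [apply Rmult_le_pos; [apply Rabs_pos|apply Rlt_le, Hinv]|apply Rlt_le, Hinv| |apply Hinv].
      apply Rmult_le_compat; [apply Rabs_pos|apply Rlt_le, Hinv|apply HB|apply Hinv].
    - rewrite (Rabs_minus_sym y z); unfold Rmax; repeat destruct (Rle_dec _ _);
        unfold Rabs; repeat destruct (Rcase_abs _); lra. }
  change (Rabs (k y ^ 3 - k z ^ 3) <= (3 * (/ m * / m) * (B * / m * / m) + 1) * Rabs (y - z)).
  replace (k y ^ 3 - k z ^ 3) with ((k y * k y + k y * k z + k z * k z) * (k y - k z)) by ring.
  assert (Hky := Hk y); assert (Hkz := Hk z).
  assert (hA : 0 <= k y * k y + k y * k z + k z * k z <= 3 * (/ m * / m)).
  { assert (0 <= k y * k y <= / m * / m) by (split; [apply Rmult_le_pos|apply Rmult_le_compat]; lra).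
    assert (0 <= k y * k z <= / m * / m) by (split; [apply Rmult_le_pos|apply Rmult_le_compat]; lra).
    assert (0 <= k z * k z <= / m * / m) by (split; [apply Rmult_le_pos|apply Rmult_le_compat]; lra).
    lra. }
  rewrite Rabs_mult, (Rabs_pos_eq _ (proj1 hA)).
  apply Rle_trans with (3 * (/ m * / m) * (B * / m * / m * Rabs (y - z))).
  + apply Rmult_le_compat; [apply hA|apply Rabs_pos|apply hA|exact Hkd].
  + assert (H := Rabs_pos (y - z)); lra.
Qed.

Variables g g1 : R -> R.
Hypothesis g_cont : cont_below (/ M) g.
Hypothesis g1_cont : cont_below (/ M) g1.
Hypothesis g_nonpos : forall s, s <= 0 -> g s = 0 /\ g1 s = 0.
Hypothesis g_ge : forall s, s < / M -> 0 <= g s.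

Definition den (s a : R) : R := 1 - Rmax 0 s * u (cl a) + g s * r (cl a).
Definition num (s a : R) : R := u (cl a) - g1 s * r (cl a).
(** As a function of the physical time, the solution of [K'' + I K = 0] with
    [K = 1], [K' = 0] initially. *)
Definition K (s : R) : R := RInt (fun a => / den s a) 0 1.

Hypothesis g_derive : forall s, 0 < s < / M -> is_derive g s (g1 s).
Hypothesis g1_derive : forall s, 0 < s < / M -> is_derive g1 s (K s ^ 3).

Definition K1 (s : R) : R := RInt (fun a => num s a / den s a ^ 2) 0 1.
Definition mean_r (s : R) : R := RInt (fun a => r (cl a) / den s a ^ 2) 0 1.
Definition mean_sq (s : R) : R := RInt (fun a => num s a ^ 2 / den s a ^ 3) 0 1.

(** The Jacobian of the particle flow; the factor [K] gives it mean 1. *)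
Definition jac (s a : R) : R := / (K s * den s a).

(** The logarithmic derivative of [jac] in physical time, which is [f_x] seen
    by the particle. *)
Definition stretch (s a : R) : R := - K1 s / K s ^ 3 + num s a / (K s ^ 2 * den s a).

Definition flow (s x : R) : R := RInt (jac s) 0 x.

(** The velocity seen by the particle: its derivative in the label is the time
    derivative of [jac]. *)
Definition label_vel (s x : R) : R := RInt (fun a => stretch s a * jac s a) 0 x.

Let b_pos : 0 < / M := Rinv_0_lt_compat M M_pos.

Lemma den_ge (s a : R) : s < / M -> 1 - Rmax 0 s * M <= den s a.
Proof.
intros Hs; eapply Rle_trans; [apply (gen_den_ge s (g s) a)|].
unfold gen_den, den; rewrite (Rmax_right 0 (g s)) by (apply g_ge, Hs); apply Rle_refl.
Qed.

Lemma den_pos (s a : R) : s < / M -> 0 < den s a.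
Proof.
intros Hs; assert (H := den_ge s a Hs).
assert (H2 := time_factor_pos s Hs); lra.
Qed.

Lemma cont2_den (s a : R) : s < / M -> cont2 den s a.
Proof.
intros Hs.
assert (C1 := cont2_of_fst (Rmax 0) s a (continuous_Rmax_0 s)).
assert (C2 := cont2_of_fst g s a (g_cont s Hs)).
assert (C3 := cont2_of_snd _ s a (u_cont a)); assert (C4 := cont2_of_snd _ s a (r_cont a)).
unfold den; cont2_tac.
Qed.

Lemma cont2_num (s a : R) : s < / M -> cont2 num s a.
Proof.
intros Hs.
assert (C2 := cont2_of_fst g1 s a (g1_cont s Hs)).
assert (C3 := cont2_of_snd _ s a (u_cont a)); assert (C4 := cont2_of_snd _ s a (r_cont a)).
unfold num; cont2_tac.
Qed.

Lemma den_neq_0 (s a : R) : s < / M -> den s a <> 0.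
Proof. intros Hs; apply Rgt_not_eq, den_pos, Hs. Qed.

Lemma cont_below_RInt (w : R -> R -> R) :
  (forall s, s < / M -> forall a, cont2 w s a) ->
  cont_below (/ M) (fun s => RInt (w s) 0 1).
Proof.
intros H s Hs; apply continuous_RInt_param.
generalize (open_lt (/ M) s Hs); apply filter_imp; intros z Hz; apply H, Hz.
Qed.

Lemma cont2_inv_den (s a : R) : s < / M -> cont2 (fun s a => / den s a) s a.
Proof. intros Hs; apply cont2_inv; [apply cont2_den, Hs|apply den_neq_0, Hs]. Qed.

Lemma cont_K : cont_below (/ M) K.
Proof. apply (cont_below_RInt (fun s a => / den s a)); intros; apply cont2_inv_den; assumption. Qed.

Lemma cont2_K1_density (s a : R) : s < / M -> cont2 (fun s a => num s a / den s a ^ 2) s a.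
Proof.
intros Hs; assert (C1 := cont2_den s a Hs); assert (C2 := cont2_num s a Hs); cont2_tac.
apply pow_nonzero, den_neq_0, Hs.
Qed.

Lemma cont_K1 : cont_below (/ M) K1.
Proof. apply (cont_below_RInt (fun s a => num s a / den s a ^ 2)); intros; apply cont2_K1_density; assumption. Qed.

Lemma K_pos (s : R) : s < / M -> 0 < K s.
Proof.
intros Hs; apply RInt_gt_0; [lra| |].
- intros a _; apply Rinv_0_lt_compat, den_pos, Hs.
- intros a _; apply (cont2_snd (fun s a => / den s a)), cont2_inv_den, Hs.
Qed.

Lemma K_neq_0 (s : R) : s < / M -> K s <> 0.
Proof. intros Hs; apply Rgt_not_eq, K_pos, Hs. Qed.

Lemma jac_pos (s a : R) : s < / M -> 0 < jac s a.
Proof.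
intros Hs; apply Rinv_0_lt_compat, Rmult_lt_0_compat; [apply K_pos, Hs|apply den_pos, Hs].
Qed.

Lemma cont2_jac (s a : R) : s < / M -> cont2 jac s a.
Proof.
intros Hs; assert (C1 := cont2_den s a Hs); assert (C2 := cont2_of_fst K s a (cont_K s Hs)).
unfold jac; cont2_tac.
apply Rmult_integral_contrapositive; split; [apply K_neq_0|apply den_neq_0]; exact Hs.
Qed.

Lemma cont2_stretch (s a : R) : s < / M -> cont2 stretch s a.
Proof.
intros Hs; assert (C1 := cont2_den s a Hs); assert (C2 := cont2_of_fst K s a (cont_K s Hs)).
assert (C3 := cont2_num s a Hs); assert (C4 := cont2_of_fst K1 s a (cont_K1 s Hs)).
unfold stretch; cont2_tac.
- apply pow_nonzero, K_neq_0, Hs.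
- apply Rmult_integral_contrapositive; split; [apply pow_nonzero, K_neq_0|apply den_neq_0]; exact Hs.
Qed.

Lemma cont2_stretch_jac (s a : R) : s < / M -> cont2 (fun s a => stretch s a * jac s a) s a.
Proof. intros Hs; apply cont2_mult; [apply cont2_stretch|apply cont2_jac]; exact Hs. Qed.

Lemma cont2_flow (s x : R) : s < / M -> cont2 flow s x.
Proof.
intros Hs; apply (cont2_RInt jac).
generalize (open_lt (/ M) s Hs); apply filter_imp; intros z Hz a; apply cont2_jac, Hz.
Qed.

Lemma cont2_label_vel (s x : R) : s < / M -> cont2 label_vel s x.
Proof.
intros Hs; apply (cont2_RInt (fun s a => stretch s a * jac s a)).
generalize (open_lt (/ M) s Hs); apply filter_imp; intros z Hz a; apply cont2_stretch_jac, Hz.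
Qed.

Lemma flow_derive_x (s x : R) : s < / M -> is_derive (flow s) x (jac s x).
Proof. intros Hs; apply is_derive_RInt_cont; intros y; apply cont2_snd, cont2_jac, Hs. Qed.

Lemma label_vel_derive_x (s x : R) : s < / M -> is_derive (label_vel s) x (stretch s x * jac s x).
Proof.
intros Hs; apply (is_derive_RInt_cont (fun a => stretch s a * jac s a)); intros y.
apply (cont2_snd (fun s a => stretch s a * jac s a)), cont2_stretch_jac, Hs.
Qed.

Lemma flow_0 (s : R) : flow s 0 = 0.
Proof. exact (RInt_pointR 0 (jac s)). Qed.

Lemma label_vel_0 (s : R) : label_vel s 0 = 0.
Proof. exact (RInt_pointR 0 (fun a => stretch s a * jac s a)). Qed.

Lemma RInt_inv_den (s : R) : s < / M -> is_RInt (fun a => / den s a) 0 1 (K s).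
Proof.
intros Hs; apply RInt_correctR, ex_RInt_cont; intros a.
apply (cont2_snd (fun s a => / den s a)), cont2_inv_den, Hs.
Qed.

Lemma RInt_K1 (s : R) : s < / M -> is_RInt (fun a => num s a / den s a ^ 2) 0 1 (K1 s).
Proof.
intros Hs; apply RInt_correctR, ex_RInt_cont; intros a.
apply (cont2_snd (fun s a => num s a / den s a ^ 2)), cont2_K1_density, Hs.
Qed.

Lemma RInt_mean_r (s : R) : s < / M -> is_RInt (fun a => r (cl a) / den s a ^ 2) 0 1 (mean_r s).
Proof.
intros Hs; apply RInt_correctR, ex_RInt_cont; intros a.
assert (C1 := cont2_den s a Hs); assert (C2 := cont2_of_snd _ s a (r_cont a)).
apply (cont2_snd (fun s a => r (cl a) / den s a ^ 2)); cont2_tac.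
apply pow_nonzero, den_neq_0, Hs.
Qed.

Lemma RInt_mean_sq (s : R) : s < / M -> is_RInt (fun a => num s a ^ 2 / den s a ^ 3) 0 1 (mean_sq s).
Proof.
intros Hs; apply RInt_correctR, ex_RInt_cont; intros a.
assert (C1 := cont2_den s a Hs); assert (C2 := cont2_num s a Hs).
apply (cont2_snd (fun s a => num s a ^ 2 / den s a ^ 3)); cont2_tac.
apply pow_nonzero, den_neq_0, Hs.
Qed.

Lemma is_RInt_lin2 (h1 h2 : R -> R) (c1 c2 i1 i2 : R) :
  is_RInt h1 0 1 i1 -> is_RInt h2 0 1 i2 ->
  is_RInt (fun a => c1 * h1 a + c2 * h2 a) 0 1 (c1 * i1 + c2 * i2).
Proof.
intros H1 H2; apply (@is_RInt_plus R_NormedModule (fun a => c1 * h1 a) (fun a => c2 * h2 a)).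
- apply (@is_RInt_scal R_NormedModule h1 _ _ c1), H1.
- apply (@is_RInt_scal R_NormedModule h2 _ _ c2), H2.
Qed.

Lemma RInt_eq (h h' : R -> R) (i : R) :
  (forall a, h' a = h a) -> is_RInt h 0 1 i -> RInt h' 0 1 = i.
Proof.
intros E H; rewrite (RInt_ext h' h) by (intros; apply E).
apply is_RInt_uniqueR, H.
Qed.

Lemma flow_1 (s : R) : s < / M -> flow s 1 = 1.
Proof.
intros Hs; assert (HK := K_neq_0 s Hs).
unfold flow; rewrite (RInt_eq (fun a => / K s * / den s a + 0 * / den s a) _ (/ K s * K s + 0 * K s)).
- field; exact HK.
- intros a; unfold jac; field; split; [apply den_neq_0, Hs|exact HK].
- apply is_RInt_lin2; apply RInt_inv_den, Hs.
Qed.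

Lemma label_vel_1 (s : R) : s < / M -> label_vel s 1 = 0.
Proof.
intros Hs; assert (HK := K_neq_0 s Hs).
unfold label_vel; rewrite (RInt_eq (fun a => (- K1 s / K s ^ 4) * / den s a + (/ K s ^ 3) * (num s a / den s a ^ 2)) _
  ((- K1 s / K s ^ 4) * K s + (/ K s ^ 3) * K1 s)).
- field; exact HK.
- intros a; unfold stretch, jac; field; split; [apply den_neq_0, Hs|exact HK].
- apply is_RInt_lin2; [apply RInt_inv_den, Hs|apply RInt_K1, Hs].
Qed.

(** * Derivatives in the slow time *)

Lemma locally_range (s : R) : 0 < s < / M -> locally s (fun z => 0 < z < / M).
Proof.
intros Hs; apply (open_and (fun z => 0 < z) (fun z => z < / M)); [apply open_gt|apply open_lt|exact Hs].
Qed.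

Lemma den_derive (s a : R) : 0 < s < / M -> is_derive (fun s => den s a) s (- num s a).
Proof.
intros Hs; apply (is_derive_ext_loc (fun z => 1 - z * u (cl a) + g z * r (cl a))).
- generalize (locally_range s Hs); apply filter_imp; intros z Hz.
  unfold den; rewrite Rmax_right by lra; reflexivity.
- assert (D := g_derive s Hs); auto_derive; [exists (g1 s); exact D|].
  replace (Derive _ s) with (g1 s) by (symmetry; apply is_derive_unique, D); unfold num; ring.
Qed.

Lemma num_derive (s a : R) : 0 < s < / M -> is_derive (fun s => num s a) s (- K s ^ 3 * r (cl a)).
Proof.
intros Hs; unfold num; assert (D := g1_derive s Hs); auto_derive; [exists (K s ^ 3); exact D|].
replace (Derive _ s) with (K s ^ 3) by (symmetry; apply is_derive_unique, D); ring.
Qed.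

Lemma K_derive (s : R) : 0 < s < / M -> is_derive K s (K1 s).
Proof.
intros Hs; apply (is_derive_RInt_param_cont (fun s a => / den s a) (fun s a => num s a / den s a ^ 2)).
generalize (locally_range s Hs); apply filter_imp; intros z Hz a; split; [|split].
- assert (D := den_derive z a Hz); assert (N := den_neq_0 z a (proj2 Hz)).
  evar_last; [apply is_derive_inv; [exact D|exact N]|simpl; field; exact N].
- apply cont2_inv_den, Hz.
- apply cont2_K1_density, Hz.
Qed.

Definition K2 (s : R) : R := - K s ^ 3 * mean_r s + 2 * mean_sq s.

Lemma K1_derive (s : R) : 0 < s < / M -> is_derive K1 s (K2 s).
Proof.
intros Hs.
replace (K2 s) with (RInt (fun a => - K s ^ 3 * (r (cl a) / den s a ^ 2) + 2 * (num s a ^ 2 / den s a ^ 3)) 0 1).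
2:{ apply RInt_eq with (1 := fun a => eq_refl); apply is_RInt_lin2; [apply RInt_mean_r|apply RInt_mean_sq]; apply Hs. }
apply (is_derive_RInt_param_cont (fun s a => num s a / den s a ^ 2)
  (fun s a => - K s ^ 3 * (r (cl a) / den s a ^ 2) + 2 * (num s a ^ 2 / den s a ^ 3))).
generalize (locally_range s Hs); apply filter_imp; intros z Hz a; split; [|split].
- assert (D := den_derive z a Hz); assert (D2 := num_derive z a Hz); assert (N := den_neq_0 z a (proj2 Hz)).
  auto_derive.
  + split; [eexists; exact D2|split; [eexists; exact D|split; [|trivial]]].
    rewrite Rmult_1_r; apply Rmult_integral_contrapositive; tauto.
  + replace (Derive (fun x : R => num x a) z) with (- K z ^ 3 * r (cl a)) by (symmetry; apply is_derive_unique, D2).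
    replace (Derive (fun x : R => den x a) z) with (- num z a) by (symmetry; apply is_derive_unique, D).
    field; exact N.
- apply cont2_K1_density, Hz.
- assert (C1 := cont2_den z a (proj2 Hz)); assert (C2 := cont2_of_fst K z a (cont_K z (proj2 Hz))).
  assert (C3 := cont2_num z a (proj2 Hz)); assert (C4 := cont2_of_snd _ z a (r_cont a)).
  cont2_tac; apply pow_nonzero, den_neq_0, Hz.
Qed.

Lemma jac_derive (s a : R) : 0 < s < / M -> is_derive (fun s => jac s a) s (K s ^ 2 * (stretch s a * jac s a)).
Proof.
intros Hs; assert (N := den_neq_0 s a (proj2 Hs)); assert (NK := K_neq_0 s (proj2 Hs)).
assert (D := den_derive s a Hs); assert (D2 := K_derive s Hs); unfold jac, stretch.
evar_last; [apply is_derive_inv; [apply (is_derive_mult K (fun s => den s a)); [exact D2|exact D|apply Rmult_comm]|]|].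
- apply Rmult_integral_contrapositive; tauto.
- unfold plus, mult; simpl; field; tauto.
Qed.

Lemma flow_derive_s (s x : R) : 0 < s < / M -> is_derive (fun s => flow s x) s (K s ^ 2 * label_vel s x).
Proof.
intros Hs.
replace (K s ^ 2 * label_vel s x) with (RInt (fun a => K s ^ 2 * (stretch s a * jac s a)) 0 x).
2:{ apply (RInt_scalR (fun a => stretch s a * jac s a)), ex_RInt_cont; intros a.
    apply (cont2_snd (fun s a => stretch s a * jac s a)), cont2_stretch_jac, Hs. }
apply (is_derive_RInt_param_cont jac (fun s a => K s ^ 2 * (stretch s a * jac s a))).
generalize (locally_range s Hs); apply filter_imp; intros z Hz a; split; [|split].
- apply jac_derive, Hz.
- apply cont2_jac, Hz.
- apply (cont2_mult (fun z _ => K z ^ 2)); [|apply cont2_stretch_jac, Hz].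
  apply (cont2_pow (fun z _ => K z)), (cont2_of_fst K), cont_K, Hz.
Qed.

(** The nonlocal term is the value that keeps the total length [flow s 1]
    equal to 1. Expanding both integrals in the moments of [/ den] expresses it
    by the derivatives of [K] that appear when [stretch] is differentiated. *)
Lemma nonlocal_label_identity (s : R) : 0 < s < / M ->
  K s ^ 2 * (RInt (fun a => r (cl a) * jac s a ^ 2) 0 1 - 2 * RInt (fun a => stretch s a ^ 2 * jac s a) 0 1)
  = - K2 s / K s ^ 3 + 3 * K1 s ^ 2 / K s ^ 4 - K1 s ^ 2 / K s ^ 4.
Proof.
intros [_ Hs]; assert (NK := K_neq_0 s Hs).
rewrite (RInt_eq (fun a => / K s ^ 2 * (r (cl a) / den s a ^ 2) + 0 * (r (cl a) / den s a ^ 2)) _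
  (/ K s ^ 2 * mean_r s + 0 * mean_r s)).
2:{ intros a; assert (N := den_neq_0 s a Hs); unfold jac; field; tauto. }
2:{ apply is_RInt_lin2; apply RInt_mean_r, Hs. }
rewrite (RInt_eq (fun a => 1 * ((K1 s ^ 2 / K s ^ 7) * / den s a + (- 2 * K1 s / K s ^ 6) * (num s a / den s a ^ 2))
    + (/ K s ^ 5) * (num s a ^ 2 / den s a ^ 3)) _
  (1 * ((K1 s ^ 2 / K s ^ 7) * K s + (- 2 * K1 s / K s ^ 6) * K1 s) + (/ K s ^ 5) * mean_sq s)).
2:{ intros a; assert (N := den_neq_0 s a Hs); unfold jac, stretch; field; tauto. }
2:{ apply (is_RInt_lin2 (fun a => (K1 s ^ 2 / K s ^ 7) * / den s a + (- 2 * K1 s / K s ^ 6) * (num s a / den s a ^ 2))).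
    - apply is_RInt_lin2; [apply RInt_inv_den, Hs|apply RInt_K1, Hs].
    - apply RInt_mean_sq, Hs. }
unfold K2; field; exact NK.
Qed.

(** * The inverse flow *)

Lemma jac_lower (s : R) : s < / M -> exists m, 0 < m /\ forall a, m <= jac s a.
Proof.
intros Hs.
destruct (continuous_cl_bounded u u_cont) as (U & HU0 & HU).
destruct (continuous_cl_bounded r r_cont) as (B & HB0 & HB).
assert (HK := K_pos s Hs); assert (Hg := g_ge s Hs); assert (H0 := Rmax_l 0 s).
set (C := 1 + Rmax 0 s * U + g s * B).
assert (HC : forall a, den s a <= C).
{ intros a; unfold den, C.
  assert (hu := HU a); assert (hr := HB a); apply Rabs_le_between in hu; apply Rabs_le_between in hr.
  assert (Rmax 0 s * - u (cl a) <= Rmax 0 s * U) by (apply Rmult_le_compat_l; lra).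
  assert (g s * r (cl a) <= g s * B) by (apply Rmult_le_compat_l; lra).
  lra. }
assert (HCp : 0 < C) by (eapply Rlt_le_trans; [apply (den_pos s 0 Hs)|apply HC]).
exists (/ (K s * C)); split; [apply Rinv_0_lt_compat, Rmult_lt_0_compat; assumption|].
intros a; apply Rinv_le_contravar.
- apply Rmult_lt_0_compat; [exact HK|apply den_pos, Hs].
- apply Rmult_le_compat_l; [lra|apply HC].
Qed.

Definition label (s x : R) : R := epsilon (inhabits 0) (fun y => flow s y = x).

Lemma flow_label (s x : R) : s < / M -> flow s (label s x) = x.
Proof.
intros Hs; apply (epsilon_spec (inhabits 0) (fun y => flow s y = x)).
destruct (jac_lower s Hs) as (m & Hm & HJ).
apply (surjective_of_derive (flow s) (jac s) m Hm); intros y; split; [apply flow_derive_x, Hs|apply HJ].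
Qed.

Lemma flow_increasing (s y z : R) : s < / M -> y < z -> flow s y < flow s z.
Proof.
intros Hs; apply (increasing_of_derive (flow s) (jac s) (fun _ => True)); trivial.
intros w _; split; [apply flow_derive_x, Hs|apply jac_pos, Hs].
Qed.

Lemma label_lt (s x y : R) : s < / M -> x < flow s y -> label s x < y.
Proof.
intros Hs H; rewrite <- (flow_label s x Hs) in H at 1.
destruct (Rlt_or_le (label s x) y) as [L|[L|E]]; [exact L| |].
- apply (flow_increasing s) in L; [lra|exact Hs].
- rewrite E in H; lra.
Qed.

Lemma label_gt (s x y : R) : s < / M -> flow s y < x -> y < label s x.
Proof.
intros Hs H; rewrite <- (flow_label s x Hs) in H at 1.
destruct (Rlt_or_le y (label s x)) as [L|[L|E]]; [exact L| |].
- apply (flow_increasing s) in L; [lra|exact Hs].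
- rewrite E in H; lra.
Qed.

Lemma label_flow (s y : R) : s < / M -> label s (flow s y) = y.
Proof.
intros Hs; destruct (Rtotal_order (label s (flow s y)) y) as [L|[E|L]]; [|exact E|];
  apply (flow_increasing s) in L; trivial; rewrite flow_label in L by exact Hs; lra.
Qed.

Lemma label_at_0 (s : R) : s < / M -> label s 0 = 0.
Proof. intros Hs; rewrite <- (flow_0 s) at 1; apply label_flow, Hs. Qed.

Lemma label_at_1 (s : R) : s < / M -> label s 1 = 1.
Proof. intros Hs; rewrite <- (flow_1 s Hs) at 1; apply label_flow, Hs. Qed.

Lemma label_I01 (s x : R) : s < / M -> I01 x -> I01 (label s x).
Proof.
intros Hs [H0 H1]; split.
- destruct (Rle_lt_dec 0 (label s x)) as [L|L]; [exact L|].
  apply (flow_increasing s) in L; trivial; rewrite flow_label, flow_0 in L by exact Hs; lra.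
- destruct (Rle_lt_dec (label s x) 1) as [L|L]; [exact L|].
  apply (flow_increasing s) in L; trivial; rewrite flow_label, flow_1 in L by exact Hs; lra.
Qed.

Lemma cont2_label (s x : R) : s < / M -> cont2 label s x.
Proof.
intros Hs; apply cont2_iff; intros eps.
set (y0 := label s x).
assert (He : 0 < eps) by apply cond_pos.
assert (L1 : flow s (y0 - eps) < x) by (rewrite <- (flow_label s x Hs); apply flow_increasing; fold y0; lra).
assert (L2 : x < flow s (y0 + eps)) by (rewrite <- (flow_label s x Hs) at 1; apply flow_increasing; fold y0; lra).
(* for nearby [z] the barriers [y0 - eps], [y0 + eps] still enclose [x] *)
set (k := Rmin ((x - flow s (y0 - eps)) / 2) ((flow s (y0 + eps) - x) / 2)).
assert (Hk : 0 < k) by (apply Rmin_pos; lra).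
assert (k1 : k <= (x - flow s (y0 - eps)) / 2) by apply Rmin_l.
assert (k2 : k <= (flow s (y0 + eps) - x) / 2) by apply Rmin_r.
assert (C1 := cont2_fst _ _ _ (cont2_flow s (y0 - eps) Hs)).
assert (C2 := cont2_fst _ _ _ (cont2_flow s (y0 + eps) Hs)).
destruct (filter_and _ _ (open_lt (/ M) s Hs)
  (filter_and _ _ (proj1 (filterlim_locally _ _) C1 (mkposreal _ Hk))
     (proj1 (filterlim_locally _ _) C2 (mkposreal _ Hk)))) as [d Hd].
assert (Hdk : 0 < Rmin d k) by (apply Rmin_pos; [apply cond_pos|exact Hk]).
exists (mkposreal _ Hdk); simpl; intros z w Hz Hw.
destruct (Hd z (Rlt_le_trans _ _ _ Hz (Rmin_l _ _))) as (Hzb & B1 & B2).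
change (Rabs (flow z (y0 - eps) - flow s (y0 - eps)) < k) in B1.
change (Rabs (flow z (y0 + eps) - flow s (y0 + eps)) < k) in B2.
assert (Hw2 : Rabs (w - x) < k) by (eapply Rlt_le_trans; [exact Hw|apply Rmin_r]).
apply Rabs_lt_between in B1; apply Rabs_lt_between in B2; apply Rabs_lt_between in Hw2.
assert (y0 - eps < label z w) by (apply label_gt; [exact Hzb|lra]).
assert (label z w < y0 + eps) by (apply label_lt; [exact Hzb|lra]).
apply Rabs_lt_between; lra.
Qed.

Lemma label_derive_x (s x : R) : s < / M -> is_derive (label s) x (/ jac s (label s x)).
Proof.
intros Hs; apply (is_derive_inverse (flow s) (jac s)).
- apply filter_forall; intros z; apply flow_label, Hs.
- apply cont2_snd, cont2_label, Hs.
- apply flow_derive_x, Hs.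
- apply Rgt_not_eq, jac_pos, Hs.
Qed.

Lemma label_derive_s (s x : R) : 0 < s < / M ->
  is_derive (fun z => label z x) s (- (K s ^ 2 * label_vel s (label s x)) / jac s (label s x)).
Proof.
intros Hs; apply (is_derive_implicit flow jac (fun z => label z x) s x).
- generalize (locally_range s Hs); apply filter_imp; intros z Hz; split.
  + apply flow_label, Hz.
  + intros y; apply flow_derive_x, Hz.
- apply (cont2_fst label), cont2_label, Hs.
- apply flow_derive_s, Hs.
- apply cont2_jac, Hs.
- apply Rgt_not_eq, jac_pos, Hs.
Qed.

(** * Velocity and density over the slow time *)

Definition stretch_a (s a : R) : R :=
  (du (cl a) - g1 s * dr (cl a)) / (K s ^ 2 * den s a)
  - num s a * (- Rmax 0 s * du (cl a) + g s * dr (cl a)) / (K s ^ 2 * den s a ^ 2).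
Definition jac_a (s a : R) : R :=
  - (- Rmax 0 s * du (cl a) + g s * dr (cl a)) / (K s * den s a ^ 2).

Definition vel (s x : R) : R := label_vel s (label s x).
Definition vel_x (s x : R) : R := stretch s (label s x).
Definition vel_xx (s x : R) : R := stretch_a s (label s x) / jac s (label s x).
Definition dens (s x : R) : R := r (cl (label s x)) * jac s (label s x).
Definition dens_x (s x : R) : R :=
  (dr (cl (label s x)) * jac s (label s x) + r (cl (label s x)) * jac_a s (label s x)) / jac s (label s x).
Definition label_nonlocal (s : R) : R :=
  RInt (fun a => r (cl a) * jac s a ^ 2) 0 1 - 2 * RInt (fun a => stretch s a ^ 2 * jac s a) 0 1.

(** Along a curve of labels [u] and [r] become functions [p] and [q] of one
    variable. Freezing the slow time gives the space derivative, freezing the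
    position gives the time derivative. *)
Lemma stretch_curve_derive (K1' K' g' g1' p q sg : R -> R) (t k1 k k1' dk dg dg1 dp dq ds : R) :
  K1' t = k1 -> K' t = k -> k <> 0 ->
  is_derive K1' t k1' -> is_derive K' t dk -> is_derive g' t dg -> is_derive g1' t dg1 ->
  is_derive p t dp -> is_derive q t dq -> is_derive sg t ds ->
  1 - sg t * p t + g' t * q t <> 0 ->
  is_derive (fun z => - K1' z / K' z ^ 3 + (p z - g1' z * q z) / (K' z ^ 2 * (1 - sg z * p z + g' z * q z))) t
    (- k1' / k ^ 3 + 3 * k1 * dk / k ^ 4
     + (dp - dg1 * q t - g1' t * dq) / (k ^ 2 * (1 - sg t * p t + g' t * q t))
     - (p t - g1' t * q t) * (2 * k * dk * (1 - sg t * p t + g' t * q t)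
         + k ^ 2 * (- ds * p t - sg t * dp + dg * q t + g' t * dq))
       / (k ^ 2 * (1 - sg t * p t + g' t * q t)) ^ 2).
Proof.
intros <- <- Hk D1 D2 D3 D4 D5 D6 D7 Hd.
auto_derive.
- repeat split; try (eexists; eassumption).
  + repeat apply Rmult_integral_contrapositive_currified; try exact Hk; apply R1_neq_R0.
  + repeat apply Rmult_integral_contrapositive_currified; try exact Hk; try exact R1_neq_R0; exact Hd.
- replace (Derive (fun x : R => K1' x) t) with k1' by (symmetry; apply is_derive_unique, D1).
  replace (Derive (fun x : R => K' x) t) with dk by (symmetry; apply is_derive_unique, D2).
  replace (Derive (fun x : R => g' x) t) with dg by (symmetry; apply is_derive_unique, D3).
  replace (Derive (fun x : R => g1' x) t) with dg1 by (symmetry; apply is_derive_unique, D4).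
  replace (Derive (fun x : R => p x) t) with dp by (symmetry; apply is_derive_unique, D5).
  replace (Derive (fun x : R => q x) t) with dq by (symmetry; apply is_derive_unique, D6).
  replace (Derive (fun x : R => sg x) t) with ds by (symmetry; apply is_derive_unique, D7).
  field; split; [exact Hd|exact Hk].
Qed.

Lemma jac_curve_derive (K' g' p q sg : R -> R) (t k dk dg dp dq ds : R) :
  K' t = k -> k <> 0 ->
  is_derive K' t dk -> is_derive g' t dg ->
  is_derive p t dp -> is_derive q t dq -> is_derive sg t ds ->
  1 - sg t * p t + g' t * q t <> 0 ->
  is_derive (fun z => q z * / (K' z * (1 - sg z * p z + g' z * q z))) t
    (dq / (k * (1 - sg t * p t + g' t * q t))
     - q t * (dk * (1 - sg t * p t + g' t * q t)
         + k * (- ds * p t - sg t * dp + dg * q t + g' t * dq))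
       / (k * (1 - sg t * p t + g' t * q t)) ^ 2).
Proof.
intros <- Hk D2 D3 D5 D6 D7 Hd.
auto_derive.
- repeat split; try (eexists; eassumption).
  repeat apply Rmult_integral_contrapositive_currified; try exact Hk; exact Hd.
- replace (Derive (fun x : R => K' x) t) with dk by (symmetry; apply is_derive_unique, D2).
  replace (Derive (fun x : R => g' x) t) with dg by (symmetry; apply is_derive_unique, D3).
  replace (Derive (fun x : R => p x) t) with dp by (symmetry; apply is_derive_unique, D5).
  replace (Derive (fun x : R => q x) t) with dq by (symmetry; apply is_derive_unique, D6).
  replace (Derive (fun x : R => sg x) t) with ds by (symmetry; apply is_derive_unique, D7).
  field; split; [exact Hd|exact Hk].
Qed.

Lemma vel_derive_x (s x : R) : s < / M -> is_derive (vel s) x (vel_x s x).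
Proof.
intros Hs; assert (NJ := Rgt_not_eq _ _ (jac_pos s (label s x) Hs)); unfold vel, vel_x.
evar_last; [apply (is_derive_comp (label_vel s) (label s)); [apply label_vel_derive_x, Hs|apply label_derive_x, Hs]|].
unfold scal; simpl; unfold mult; simpl; field; exact NJ.
Qed.

Lemma is_derive_comp_label (h dh : R -> R) (alpha : R -> R) (t l : R) :
  (forall x, I01 x -> is_derive h x (dh x)) -> I01 (alpha t) -> is_derive alpha t l ->
  is_derive (fun z => h (alpha z)) t (dh (cl (alpha t)) * l).
Proof.
intros Hh Ht D; rewrite clamp_id by exact Ht.
rewrite Rmult_comm; apply (is_derive_comp h alpha); [apply Hh, Ht|exact D].
Qed.

Lemma vel_x_is_dx (s x : R) : s < / M -> I01 x -> is_dx (vel_x s) x (vel_xx s x).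
Proof.
intros Hs Hx; assert (HA := label_I01 s x Hs Hx); assert (NK := K_neq_0 s Hs).
assert (ND := den_neq_0 s (label s x) Hs); assert (EA := clamp_id 0 1 _ HA).
assert (DA := label_derive_x s x Hs).
apply (is_dx_ext (fun z => - K1 s / K s ^ 3
  + (u (label s z) - g1 s * r (label s z)) / (K s ^ 2 * (1 - Rmax 0 s * u (label s z) + g s * r (label s z))))); [exact Hx| |].
{ intros y Hy; unfold vel_x, stretch, num, den; rewrite (clamp_id 0 1 (label s y)) by (apply label_I01; assumption); reflexivity. }
apply is_dx_of_derive; [exact Hx|]; evar_last.
- eapply (stretch_curve_derive (fun _ => K1 s) (fun _ => K s) (fun _ => g s) (fun _ => g1 s)
    (fun z => u (label s z)) (fun z => r (label s z)) (fun _ => Rmax 0 s) x (K1 s) (K s) 0 0 0 0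
    _ _ 0 eq_refl eq_refl NK (is_derive_cst _ _) (is_derive_cst _ _) (is_derive_cst _ _) (is_derive_cst _ _)).
  + apply (is_derive_comp_label u du (label s) x _ u_derive HA DA).
  + apply (is_derive_comp_label r dr (label s) x _ r_derive HA DA).
  + apply is_derive_cst.
  + unfold den in ND; rewrite EA in ND; exact ND.
- unfold vel_xx, stretch_a, jac, num, den in *; rewrite EA in *; field; tauto.
Qed.

Lemma dens_is_dx (s x : R) : s < / M -> I01 x -> is_dx (dens s) x (dens_x s x).
Proof.
intros Hs Hx; assert (HA := label_I01 s x Hs Hx); assert (NK := K_neq_0 s Hs).
assert (ND := den_neq_0 s (label s x) Hs); assert (EA := clamp_id 0 1 _ HA).
assert (DA := label_derive_x s x Hs).
apply (is_dx_ext (fun z => r (label s z) * / (K s * (1 - Rmax 0 s * u (label s z) + g s * r (label s z))))); [exact Hx| |].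
{ intros y Hy; unfold dens, jac, den; rewrite (clamp_id 0 1 (label s y)) by (apply label_I01; assumption); reflexivity. }
apply is_dx_of_derive; [exact Hx|]; evar_last.
- eapply (jac_curve_derive (fun _ => K s) (fun _ => g s)
    (fun z => u (label s z)) (fun z => r (label s z)) (fun _ => Rmax 0 s) x (K s) 0 0
    _ _ 0 eq_refl NK (is_derive_cst _ _) (is_derive_cst _ _)).
  + apply (is_derive_comp_label u du (label s) x _ u_derive HA DA).
  + apply (is_derive_comp_label r dr (label s) x _ r_derive HA DA).
  + apply is_derive_cst.
  + unfold den in ND; rewrite EA in ND; exact ND.
- unfold dens_x, jac_a, jac, num, den in *; rewrite EA in *; field; tauto.
Qed.

(** The first equation of the system; [K s ^ 2] is the rate [dt / ds]. The
    transport term comes from the motion of the label at a fixed position. *)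
Lemma vel_x_derive_s (s x : R) : 0 < s < / M -> I01 x ->
  is_derive (fun z => vel_x z x) s
    (K s ^ 2 * (vel_x s x ^ 2 - dens s x + label_nonlocal s - vel s x * vel_xx s x)).
Proof.
intros Hs Hx; assert (Hs2 := proj2 Hs).
assert (HA := label_I01 s x Hs2 Hx); assert (NK := K_neq_0 s Hs2).
assert (ND := den_neq_0 s (label s x) Hs2); assert (EA := clamp_id 0 1 _ HA).
assert (DA := label_derive_s s x Hs).
apply (is_derive_ext_loc (fun z => - K1 z / K z ^ 3
  + (u (label z x) - g1 z * r (label z x)) / (K z ^ 2 * (1 - z * u (label z x) + g z * r (label z x))))).
{ generalize (locally_range s Hs); apply filter_imp; intros z Hz.
  unfold vel_x, stretch, num, den; rewrite (clamp_id 0 1 (label z x)) by (apply label_I01; [apply Hz|exact Hx]).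
  rewrite Rmax_right by lra; reflexivity. }
assert (HN := nonlocal_label_identity s Hs); fold (label_nonlocal s) in HN.
evar_last.
- eapply (stretch_curve_derive K1 K g g1 (fun z => u (label z x)) (fun z => r (label z x)) (fun z => z)
    s (K1 s) (K s) (K2 s) (K1 s) (g1 s) (K s ^ 3) _ _ 1 eq_refl eq_refl NK).
  + apply K1_derive, Hs.
  + apply K_derive, Hs.
  + apply g_derive, Hs.
  + apply g1_derive, Hs.
  + apply (is_derive_comp_label u du (fun z => label z x) s _ u_derive HA DA).
  + apply (is_derive_comp_label r dr (fun z => label z x) s _ r_derive HA DA).
  + apply (@is_derive_id R_AbsRing).
  + unfold den in ND; rewrite EA, Rmax_right in ND by lra; exact ND.
- transitivity (K s ^ 2 * (vel_x s x ^ 2 - dens s x - vel s x * vel_xx s x)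
    + K s ^ 2 * label_nonlocal s); [|ring].
  rewrite HN; unfold vel, vel_x, vel_xx, dens, stretch, stretch_a, jac, num, den in *; rewrite EA in *.
  rewrite Rmax_right in * by lra; field; tauto.
Qed.

Lemma dens_derive_s (s x : R) : 0 < s < / M -> I01 x ->
  is_derive (fun z => dens z x) s
    (K s ^ 2 * (dens s x * vel_x s x - vel s x * dens_x s x)).
Proof.
intros Hs Hx; assert (Hs2 := proj2 Hs).
assert (HA := label_I01 s x Hs2 Hx); assert (NK := K_neq_0 s Hs2).
assert (ND := den_neq_0 s (label s x) Hs2); assert (EA := clamp_id 0 1 _ HA).
assert (DA := label_derive_s s x Hs).
apply (is_derive_ext_loc (fun z => r (label z x) * / (K z * (1 - z * u (label z x) + g z * r (label z x))))).
{ generalize (locally_range s Hs); apply filter_imp; intros z Hz.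
  unfold dens, jac, den; rewrite (clamp_id 0 1 (label z x)) by (apply label_I01; [apply Hz|exact Hx]).
  rewrite Rmax_right by lra; reflexivity. }
evar_last.
- eapply (jac_curve_derive K g (fun z => u (label z x)) (fun z => r (label z x)) (fun z => z)
    s (K s) (K1 s) (g1 s) _ _ 1 eq_refl NK).
  + apply K_derive, Hs.
  + apply g_derive, Hs.
  + apply (is_derive_comp_label u du (fun z => label z x) s _ u_derive HA DA).
  + apply (is_derive_comp_label r dr (fun z => label z x) s _ r_derive HA DA).
  + apply (@is_derive_id R_AbsRing).
  + unfold den in ND; rewrite EA, Rmax_right in ND by lra; exact ND.
- unfold vel, vel_x, dens_x, dens, stretch, jac_a, jac, num, den in *; rewrite EA in *.
  rewrite Rmax_right in * by lra; field; tauto.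
Qed.

(** The change of variables [x = flow s a]. *)
Lemma RInt_position (h : R -> R) (s : R) : s < / M ->
  (forall a, continuous h a) ->
  RInt (fun x => h (label s x)) 0 1 = RInt (fun a => h a * jac s a) 0 1.
Proof.
intros Hs Hh.
assert (CJ : forall a, continuous (jac s) a) by (intros; apply cont2_snd, cont2_jac, Hs).
rewrite <- (label_at_0 s Hs) at 2; rewrite <- (label_at_1 s Hs) at 2.
rewrite <- (RInt_comp (fun a => h a * jac s a) (label s) (fun x => / jac s (label s x))).
- apply RInt_ext; intros x _; unfold scal; simpl; unfold mult; simpl.
  assert (NJ := Rgt_not_eq _ _ (jac_pos s (label s x) Hs)); eq_R; field; exact NJ.
- intros x _; apply continuous_multR; [apply Hh|apply CJ].
- intros x _; split; [apply label_derive_x, Hs|].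
  apply (continuous_comp (label s) (fun a => / jac s a)); [apply cont2_snd, cont2_label, Hs|].
  apply (continuous_comp (jac s) Rinv); [apply CJ|apply continuous_Rinv, Rgt_not_eq, jac_pos, Hs].
Qed.

Lemma nonlocal_eq (s : R) : s < / M ->
  RInt (dens s) 0 1 - 2 * RInt (fun x => vel_x s x ^ 2) 0 1 = label_nonlocal s.
Proof.
intros Hs; unfold label_nonlocal.
assert (CJ : forall a, continuous (jac s) a) by (intros; apply cont2_snd, cont2_jac, Hs).
unfold dens; rewrite (RInt_position (fun a => r (cl a) * jac s a)); trivial.
- unfold vel_x; rewrite (RInt_position (fun a => stretch s a ^ 2)); trivial.
  + f_equal; apply RInt_ext; intros a _; ring_R.
  + intros a; apply (cont2_snd (fun s a => stretch s a ^ 2)), cont2_pow, cont2_stretch, Hs.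
- intros a; apply continuous_multR; [apply r_cont|apply CJ].
Qed.

Lemma cont2_comp_label (w : R -> R -> R) (s x : R) :
  s < / M -> (forall a, cont2 w s a) -> cont2 (fun s x => w s (label s x)) s x.
Proof.
intros Hs Hw; apply (cont2_comp w (fun s _ => s) label); [|apply cont2_label, Hs|apply Hw].
apply (cont2_of_fst (fun s => s)), continuous_id.
Qed.

Lemma cont2_vel (s x : R) : s < / M -> cont2 vel s x.
Proof. intros Hs; apply cont2_comp_label; trivial; intros; apply cont2_label_vel, Hs. Qed.

Lemma cont2_vel_x (s x : R) : s < / M -> cont2 vel_x s x.
Proof. intros Hs; apply cont2_comp_label; trivial; intros; apply cont2_stretch, Hs. Qed.

Lemma cont2_vel_xx (s x : R) : s < / M -> cont2 vel_xx s x.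
Proof.
intros Hs; apply (cont2_comp_label (fun s a => stretch_a s a / jac s a)); trivial; intros a.
assert (C1 := cont2_den s a Hs); assert (C2 := cont2_of_fst K s a (cont_K s Hs)).
assert (C3 := cont2_num s a Hs); assert (C4 := cont2_jac s a Hs).
assert (C5 := cont2_of_fst g s a (g_cont s Hs)); assert (C6 := cont2_of_fst g1 s a (g1_cont s Hs)).
assert (C7 := cont2_of_snd _ s a (du_cont a)); assert (C8 := cont2_of_snd _ s a (dr_cont a)).
assert (C9 := cont2_of_fst (Rmax 0) s a (continuous_Rmax_0 s)).
assert (NK := K_neq_0 s Hs); assert (ND := den_neq_0 s a Hs).
unfold stretch_a; cont2_tac.
- apply Rmult_integral_contrapositive; split; [apply pow_nonzero|]; assumption.
- apply Rmult_integral_contrapositive; split; apply pow_nonzero; assumption.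
- apply Rgt_not_eq, jac_pos, Hs.
Qed.

Lemma cont2_dens (s x : R) : s < / M -> cont2 dens s x.
Proof.
intros Hs; apply (cont2_comp_label (fun s a => r (cl a) * jac s a)); trivial; intros a.
apply cont2_mult; [apply (cont2_of_snd _ s a (r_cont a))|apply cont2_jac, Hs].
Qed.

Lemma cont2_dens_x (s x : R) : s < / M -> cont2 dens_x s x.
Proof.
intros Hs; apply (cont2_comp_label (fun s a => (dr (cl a) * jac s a + r (cl a) * jac_a s a) / jac s a)); trivial; intros a.
assert (C1 := cont2_den s a Hs); assert (C2 := cont2_of_fst K s a (cont_K s Hs)).
assert (C4 := cont2_jac s a Hs).
assert (C5 := cont2_of_fst g s a (g_cont s Hs)); assert (C6 := cont2_of_snd _ s a (r_cont a)).
assert (C7 := cont2_of_snd _ s a (du_cont a)); assert (C8 := cont2_of_snd _ s a (dr_cont a)).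
assert (C9 := cont2_of_fst (Rmax 0) s a (continuous_Rmax_0 s)).
assert (NK := K_neq_0 s Hs); assert (ND := den_neq_0 s a Hs).
unfold jac_a; cont2_tac.
- apply Rmult_integral_contrapositive; split; [|apply pow_nonzero]; assumption.
- apply Rgt_not_eq, jac_pos, Hs.
Qed.

(** * The physical time *)

(** The physical time as a function of the slow time. *)
Definition tau (s : R) : R := RInt (fun z => K z ^ 2) 0 s.

Lemma cont_K_sq : cont_below (/ M) (fun z => K z ^ 2).
Proof.
intros s Hs; apply (cont2_fst (fun z (_ : R) => K z ^ 2) s 0), (cont2_pow (fun z _ => K z)).
apply (cont2_of_fst K), cont_K, Hs.
Qed.

Lemma tau_derive (s : R) : s < / M -> is_derive tau s (K s ^ 2).
Proof. intros Hs; apply (is_derive_RInt_below (/ M) (fun z => K z ^ 2)); [exact b_pos|apply cont_K_sq|exact Hs]. Qed.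

Lemma tau_increasing (s z : R) : s < z -> z < / M -> tau s < tau z.
Proof.
intros H Hz; apply (increasing_of_derive tau (fun s => K s ^ 2) (fun s => s < / M)); try lra.
{ intros; lra. }
intros x Hx; split; [apply tau_derive, Hx|apply pow_lt, K_pos, Hx].
Qed.

Lemma den_nonpos (s a : R) : s <= 0 -> den s a = 1.
Proof. intros Hs; unfold den; rewrite Rmax_left, (proj1 (g_nonpos s Hs)) by exact Hs; ring. Qed.

Lemma K_nonpos (s : R) : s <= 0 -> K s = 1.
Proof.
intros Hs; unfold K; rewrite (RInt_ext _ (fun _ => 1)).
- rewrite RInt_cst; ring_R.
- intros a _; rewrite den_nonpos by exact Hs; apply Rinv_1.
Qed.

Lemma tau_0 : tau 0 = 0.
Proof. exact (RInt_pointR 0 (fun z => K z ^ 2)). Qed.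

Lemma tau_nonpos (s : R) : s <= 0 -> tau s = s.
Proof.
intros Hs; unfold tau; rewrite (RInt_ext _ (fun _ => 1)).
- rewrite RInt_cst; ring_R.
- rewrite Rmin_right, Rmax_left by exact Hs; intros z Hz.
  rewrite K_nonpos by lra; ring_R.
Qed.

Variable c : R.
Hypothesis c_pos : 0 < c.
Hypothesis gap : forall x, I01 x -> c * (x * (1 - x)) <= M - u x.

(** Once [s] exceeds half of [/ M], the denominator is at least
    [(1 - s M) + k a (1 - a)], so that [K] is at most logarithmic in
    [1 - s M]. The weaker bound by an inverse fourth root is stated because it
    makes both [K^2] integrable and [K (1 - s M)] tend to zero. *)
Lemma K_bound : exists C, 0 < C /\
  forall s, 0 <= s < / M -> K s * sqrt (sqrt (1 - s * M)) <= C.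
Proof.
set (k := c / M / 2).
assert (Hk : 0 < k) by (unfold k; repeat apply Rdiv_lt_0_compat; lra).
exists (2 + 4 / k * (k / 2 + 4)); split.
{ assert (0 < 4 / k * (k / 2 + 4)) by (apply Rmult_lt_0_compat; [apply Rdiv_lt_0_compat|]; lra); lra. }
intros s Hs.
assert (Hsg : 0 < 1 - s * M).
{ assert (H := time_factor_pos s (proj2 Hs)); rewrite Rmax_right in H by lra; exact H. }
set (sg := 1 - s * M) in *.
assert (Hsg1 : sg <= 1) by (unfold sg; assert (0 <= s * M) by (apply Rmult_le_pos; lra); lra).
set (q := sqrt (sqrt sg)).
assert (Hq : 0 < q) by (do 2 apply sqrt_lt_R0; exact Hsg).
assert (Hqq : q * q * (q * q) = sg).
{ unfold q; rewrite sqrt_sqrt by apply sqrt_pos; apply sqrt_sqrt; lra. }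
assert (Hq1 : q <= 1).
{ unfold q; rewrite <- sqrt_1; apply sqrt_le_1; [apply sqrt_pos|lra|].
  rewrite <- sqrt_1; apply sqrt_le_1; lra. }
assert (Hpos : 0 <= 4 / k * (k / 2 + 4)) by (apply Rmult_le_pos; [apply Rlt_le, Rdiv_lt_0_compat|]; lra).
assert (Ei : ex_RInt (fun a => / den s a) 0 1) by (eexists; apply RInt_inv_den, Hs).
destruct (Rle_dec s (/ M / 2)) as [Hle|Hgt].
- assert (Hh : / 2 <= sg).
  { unfold sg; assert (s * M <= / M / 2 * M) by (apply Rmult_le_compat_r; lra).
    replace (/ M / 2 * M) with (/ 2) in H by (field; lra); lra. }
  assert (HK : K s <= 2).
  { replace 2 with (RInt (fun _ => 2) 0 1) by (rewrite RInt_cst; ring_R).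
    apply RInt_le; [lra|exact Ei|apply ex_RInt_const|]; intros a _.
    rewrite <- (Rinv_inv 2); apply Rinv_le_contravar; [lra|].
    eapply Rle_trans; [exact Hh|]; assert (H := den_ge s a (proj2 Hs)); rewrite Rmax_right in H by lra; exact H. }
  assert (HK0 := K_pos s (proj2 Hs)); nra.
- (* [1 / (sg + k a (1 - a))] is at most the sum of the two one-sided bounds *)
  pose (h := fun a => / (sg + k * cl a / 2) + / (sg + k * (1 - cl a) / 2)).
  pose (P := fun a => 2 / k * (ln (sg + k * a / 2) - ln (sg + k * (1 - a) / 2))).
  assert (Hp : forall a, I01 a -> 0 < sg + k * a / 2 /\ 0 < sg + k * (1 - a) / 2).
  { intros a Ha; unfold I01 in Ha; assert (0 <= k * a) by (apply Rmult_le_pos; lra).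
    assert (0 <= k * (1 - a)) by (apply Rmult_le_pos; lra); lra. }
  assert (Ch : forall a, continuous h a).
  { intros a; apply (continuous_comp (clamp 0 1) (fun a => / (sg + k * a / 2) + / (sg + k * (1 - a) / 2)));
      [apply continuous_clamp|].
    destruct (Hp _ (cl_I01 a)); apply ex_derive_continuousR.
    auto_derive; repeat split; apply Rgt_not_eq; unfold Rdiv in *; lra. }
  assert (HKh : K s <= RInt h 0 1).
  { apply RInt_le; [lra|exact Ei|apply ex_RInt_cont, Ch|]; intros a Ha.
    assert (Ha' : I01 a) by (unfold I01; lra); destruct (Hp a Ha') as [p1 p2].
    assert (Hden : sg + k * (a * (1 - a)) <= den s a).
    { unfold den; rewrite Rmax_right, clamp_id by (lra || exact Ha').
      assert (G := gap a Ha'); assert (Hr := r_ge a Ha'); assert (Hg := g_ge s (proj2 Hs)).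
      assert (0 <= g s * r a) by (apply Rmult_le_pos; assumption).
      assert (0 <= c * (a * (1 - a))) by (apply Rmult_le_pos; [lra|apply Rmult_le_pos; lra]).
      assert (s * (c * (a * (1 - a))) <= s * (M - u a)) by (apply Rmult_le_compat_l; lra).
      assert (/ M / 2 * (c * (a * (1 - a))) <= s * (c * (a * (1 - a)))) by (apply Rmult_le_compat_r; lra).
      replace (k * (a * (1 - a))) with (/ M / 2 * (c * (a * (1 - a)))) by (unfold k; field; lra).
      unfold sg; lra. }
    unfold h; rewrite clamp_id by exact Ha'.
    assert (i1 := Rinv_0_lt_compat _ p1); assert (i2 := Rinv_0_lt_compat _ p2).
    destruct (Rle_dec a (1 / 2)) as [La|La].
    - apply Rle_trans with (/ (sg + k * a / 2)); [|lra]; apply Rinv_le_contravar; [exact p1|].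
      eapply Rle_trans; [|exact Hden].
      assert (0 <= k * a * (1 - a - 1 / 2)) by (apply Rmult_le_pos; [apply Rmult_le_pos|]; lra); lra.
    - apply Rle_trans with (/ (sg + k * (1 - a) / 2)); [|lra]; apply Rinv_le_contravar; [exact p2|].
      eapply Rle_trans; [|exact Hden].
      assert (0 <= k * (1 - a) * (a - 1 / 2)) by (apply Rmult_le_pos; [apply Rmult_le_pos|]; lra); lra. }
  assert (HI : RInt h 0 1 = 4 / k * (ln (sg + k / 2) - ln sg)).
  { rewrite (RInt_derive_open P h 0 1); [|lra| |exact Ch|].
    - unfold P; rewrite Rmult_1_r, Rmult_0_r, Rminus_diag, Rmult_0_r, Rminus_0_r, Rmult_1_r.
      replace (sg + 0 / 2) with sg by field; eq_R; field; lra.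
    - intros a Ha; destruct (Hp a Ha); apply ex_derive_continuousR.
      unfold P; auto_derive; repeat split; unfold Rdiv in *; lra.
    - intros a Ha; assert (Ha' : I01 a) by (unfold I01; lra); destruct (Hp a Ha').
      unfold P, h; rewrite clamp_id by exact Ha'; auto_derive; [repeat split; unfold Rdiv in *; lra|].
      field; unfold Rdiv in *; repeat split; lra. }
  assert (Hl1 : ln (sg + k / 2) <= k / 2).
  { assert (He := exp_ineq1_le (k / 2)).
    rewrite <- (ln_exp (k / 2)) at 2; apply ln_le; lra. }
  assert (Hl2 : - ln sg * q <= 4).
  { assert (E : ln sg = 4 * ln q) by (rewrite <- Hqq, !ln_mult by (try apply Rmult_lt_0_compat; assumption); ring).
    assert (Hi := exp_ineq1_le (- ln q)).
    rewrite <- ln_Rinv, exp_ln in Hi by (try apply Rinv_0_lt_compat; assumption).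
    rewrite ln_Rinv in Hi by exact Hq.
    assert (- ln q * q <= / q * q) by (apply Rmult_le_compat_r; lra).
    rewrite Rinv_l in H by lra; rewrite E; lra. }
  assert (H4 : 0 < 4 / k) by (apply Rdiv_lt_0_compat; lra).
  apply Rle_trans with (4 / k * (ln (sg + k / 2) - ln sg) * q); [apply Rmult_le_compat_r; lra|].
  rewrite Rmult_assoc; apply Rle_trans with (4 / k * (k / 2 + 4)); [|lra].
  apply Rmult_le_compat_l; [lra|].
  assert (ln (sg + k / 2) * q <= k / 2 * q) by (apply Rmult_le_compat_r; lra).
  assert (k / 2 * q <= k / 2 * 1) by (apply Rmult_le_compat_l; lra); lra.
Qed.

(** [K^2] is dominated by the derivative of a multiple of
    [- sqrt (1 - s M)]. *)
Lemma tau_bounded : exists B, forall s, s < / M -> tau s <= B.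
Proof.
destruct K_bound as (C & HC & HK).
exists (2 * C ^ 2 / M); intros s Hs.
assert (HB : 0 <= 2 * C ^ 2 / M).
{ apply Rmult_le_pos; [assert (H := pow2_ge_0 C); lra|apply Rlt_le, Rinv_0_lt_compat, M_pos]. }
destruct (Rle_dec s 0) as [H0|H0]; [rewrite tau_nonpos; lra|].
assert (Hf : forall z, 0 <= z <= s -> 0 < 1 - z * M).
{ intros z Hz; assert (H := time_factor_pos z ltac:(lra)); rewrite Rmax_right in H by lra; exact H. }
assert (H : tau s + 2 * C ^ 2 / M * sqrt (1 - s * M) <= tau 0 + 2 * C ^ 2 / M * sqrt (1 - 0 * M)).
{ apply (nonincreasing_of_derive (fun z => tau z + 2 * C ^ 2 / M * sqrt (1 - z * M))
    (fun z => K z ^ 2 - C ^ 2 / sqrt (1 - z * M)) 0 s); [lra| | |].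
  - intros z Hz; apply continuous_plusR.
    + apply continuous_of_is_derive with (K z ^ 2), tau_derive; lra.
    + apply ex_derive_continuousR; auto_derive.
      exact (Hf z Hz).
  - intros z Hz; assert (Hz' := Hf z ltac:(lra)); assert (Hsq := sqrt_lt_R0 _ Hz'); evar_last.
    + apply is_derive_plusR; [apply tau_derive; lra|].
      auto_derive; [exact Hz'|reflexivity].
    + unfold plus; simpl; change (1 + - (z * M)) with (1 - z * M); field; lra.
  - intros z Hz; assert (Hz' := Hf z ltac:(lra)); assert (Hsq := sqrt_lt_R0 _ Hz').
    assert (H := HK z ltac:(lra)); assert (HK0 := K_pos z ltac:(lra)).
    assert (Hq := sqrt_lt_R0 _ Hsq).
    assert (E := sqrt_sqrt _ (Rlt_le _ _ Hsq)).
    set (q := sqrt (sqrt (1 - z * M))) in *.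
    assert (H2 : K z ^ 2 * sqrt (1 - z * M) <= C ^ 2).
    { rewrite <- E; replace (K z ^ 2 * (q * q)) with ((K z * q) ^ 2) by ring.
      apply pow_incr; split; [apply Rmult_le_pos; lra|exact H]. }
    apply Rle_minus; apply Rmult_le_reg_r with (sqrt (1 - z * M)); [exact Hsq|].
    unfold Rdiv; rewrite Rmult_assoc, Rinv_l by lra; lra. }
assert (Hsq := sqrt_pos (1 - s * M)).
rewrite tau_0 in H; replace (1 - 0 * M) with 1 in H by ring; rewrite sqrt_1 in H.
assert (0 <= 2 * C ^ 2 / M * sqrt (1 - s * M)) by (apply Rmult_le_pos; assumption); lra.
Qed.

Lemma final_time_exists : exists tstar,
  (forall s, s < / M -> tau s < tstar) /\
  (forall t, t < tstar -> exists s, s < / M /\ t < tau s).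
Proof.
destruct tau_bounded as (B & HB).
destruct (completeness (fun y => exists s, s < / M /\ y = tau s)) as [T [HT1 HT2]].
- exists B; intros y (s & Hs & ->); apply HB, Hs.
- exists (tau 0), 0; split; [exact b_pos|reflexivity].
- exists T; split.
  + intros s Hs; apply Rlt_le_trans with (tau ((s + / M) / 2)); [apply tau_increasing; lra|].
    apply HT1; exists ((s + / M) / 2); split; [lra|reflexivity].
  + intros t Ht; apply Classical_Prop.NNPP; intros Hn.
    enough (T <= t) by lra.
    apply HT2; intros y (s & Hs & ->); apply Rnot_lt_le; intros L; apply Hn; exists s; tauto.
Qed.

Variable tstar : R.
Hypothesis tau_lt : forall s, s < / M -> tau s < tstar.
Hypothesis tau_sup : forall t, t < tstar -> exists s, s < / M /\ t < tau s.

Lemma tstar_pos : 0 < tstar.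
Proof. rewrite <- tau_0; apply tau_lt, b_pos. Qed.

Definition slow (t : R) : R := epsilon (inhabits 0) (fun s => s < / M /\ tau s = t).

Lemma slow_spec (t : R) : t < tstar -> slow t < / M /\ tau (slow t) = t.
Proof.
intros Ht; apply (epsilon_spec (inhabits 0) (fun s => s < / M /\ tau s = t)).
destruct (Rle_dec t 0) as [H0|H0].
{ exists t; split; [generalize b_pos; lra|apply tau_nonpos, H0]. }
destruct (tau_sup t Ht) as (s1 & Hs1 & Hts1).
assert (Hs0 : 0 < s1).
{ destruct (Rlt_dec 0 s1) as [L|L]; [exact L|]; rewrite tau_nonpos in Hts1; lra. }
assert (C : continuity (fun s => tau (clamp 0 s1 s))).
{ intros s; apply continuous_continuity_pt, (continuous_comp (clamp 0 s1) tau); [apply continuous_clamp|].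
  apply continuous_of_is_derive with (K (clamp 0 s1 s) ^ 2), tau_derive.
  assert (H := clamp_bound 0 s1 s); lra. }
destruct (IVT_gen _ 0 s1 t C) as [s [Hs E]].
- rewrite !clamp_id, tau_0, Rmin_left, Rmax_right by lra; lra.
- rewrite Rmin_left, Rmax_right in Hs by lra; rewrite clamp_id in E by exact Hs.
  exists s; split; [lra|exact E].
Qed.

Lemma slow_lt (t : R) : t < tstar -> slow t < / M.
Proof. intros Ht; apply slow_spec, Ht. Qed.

Lemma slow_between (s t z : R) : z < / M -> tau s < t < tau z -> s < / M -> s < slow t < z.
Proof.
intros Hz [H1 H2] Hs.
destruct (slow_spec t) as [H3 H4]; [generalize (tau_lt z Hz); lra|].
rewrite <- H4 in H1, H2; split.
- destruct (Rlt_or_le s (slow t)) as [L|[L|E]]; [exact L|apply tau_increasing in L; lra|rewrite E in H1; lra].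
- destruct (Rlt_or_le (slow t) z) as [L|[L|E]]; [exact L|apply tau_increasing in L; lra|rewrite E in H2; lra].
Qed.

Lemma slow_gt (s t : R) : s < / M -> tau s < t < tstar -> s < slow t.
Proof.
intros Hs [H1 H2]; destruct (tau_sup t H2) as (z & Hz & Htz).
apply (slow_between s t z); lra.
Qed.

Lemma slow_0 : slow 0 = 0.
Proof.
destruct (slow_spec 0 tstar_pos) as [H1 H2]; assert (H3 := tau_0).
destruct (Rtotal_order (slow 0) 0) as [L|[E|L]]; [|exact E|]; apply tau_increasing in L;
  generalize b_pos; lra.
Qed.

Lemma slow_pos (t : R) : 0 < t < tstar -> 0 < slow t < / M.
Proof.
intros Ht; split; [apply slow_gt; [exact b_pos|rewrite tau_0; exact Ht]|apply slow_lt; lra].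
Qed.

Lemma slow_cont (t : R) : t < tstar -> continuous slow t.
Proof.
intros Ht; destruct (slow_spec t Ht) as [H1 H2]; apply filterlim_locally; intros eps.
set (e := Rmin eps ((/ M - slow t) / 2)).
assert (He : 0 < e) by (apply Rmin_pos; [apply cond_pos|lra]).
assert (He1 : e <= eps) by apply Rmin_l; assert (He2 : e <= (/ M - slow t) / 2) by apply Rmin_r.
assert (L1 : tau (slow t - e) < t) by (rewrite <- H2 at 2; apply tau_increasing; lra).
assert (L2 : t < tau (slow t + e)) by (rewrite <- H2 at 1; apply tau_increasing; lra).
assert (Hl : locally t (fun z => tau (slow t - e) < z /\ z < tau (slow t + e))).
{ apply (open_and (fun z => tau (slow t - e) < z) (fun z => z < tau (slow t + e)));
    [apply open_gt|apply open_lt|split; assumption]. }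
revert Hl; apply filter_imp; intros z Hz.
assert (B : slow t - e < slow z < slow t + e) by (apply slow_between; lra).
change (Rabs (slow z - slow t) < eps); apply Rabs_lt_between; lra.
Qed.

Lemma slow_derive (t : R) : t < tstar -> is_derive slow t (/ K (slow t) ^ 2).
Proof.
intros Ht; apply (is_derive_inverse tau (fun s => K s ^ 2)).
- generalize (open_lt tstar t Ht); apply filter_imp; intros z Hz; apply slow_spec, Hz.
- apply slow_cont, Ht.
- apply tau_derive, slow_lt, Ht.
- apply pow_nonzero, K_neq_0, slow_lt, Ht.
Qed.

Definition sol_f (t x : R) : R := vel (slow t) x.
Definition sol_rho (t x : R) : R := dens (slow t) x.

Lemma cont2_slow (w : R -> R -> R) (t x : R) : t < tstar ->
  (forall s, s < / M -> cont2 w s x) -> cont2 (fun t x => w (slow t) x) t x.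
Proof.
intros Ht Hw; apply (cont2_comp w (fun t _ => slow t) (fun _ y => y)).
- apply cont2_of_fst, slow_cont, Ht.
- apply (cont2_of_snd (fun y => y)), continuous_id.
- apply Hw, slow_lt, Ht.
Qed.

Lemma sol_f_dx (t x : R) : t < tstar -> I01 x ->
  is_dx (sol_f t) x (vel_x (slow t) x) /\ dx (sol_f t) x = vel_x (slow t) x.
Proof. intros Ht Hx; apply dx_of_derive with (sol_f t); trivial; apply vel_derive_x, slow_lt, Ht. Qed.

Lemma sol_f_dxx (t x : R) : t < tstar -> I01 x ->
  is_dx (dx (sol_f t)) x (vel_xx (slow t) x) /\ dx (dx (sol_f t)) x = vel_xx (slow t) x.
Proof.
intros Ht Hx.
assert (H : is_dx (dx (sol_f t)) x (vel_xx (slow t) x)).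
{ apply (is_dx_ext (vel_x (slow t))); trivial.
  - intros y Hy; symmetry; apply sol_f_dx; assumption.
  - apply vel_x_is_dx; [apply slow_lt, Ht|exact Hx]. }
split; [exact H|apply is_dx_unique; assumption].
Qed.

Lemma sol_rho_dx (t x : R) : t < tstar -> I01 x ->
  is_dx (sol_rho t) x (dens_x (slow t) x) /\ dx (sol_rho t) x = dens_x (slow t) x.
Proof.
intros Ht Hx; assert (H := dens_is_dx (slow t) x (slow_lt t Ht) Hx).
split; [exact H|apply is_dx_unique; assumption].
Qed.

Lemma sol_f_dt (t x : R) : 0 < t < tstar -> I01 x ->
  is_derive (fun s : R => dx (sol_f s) x) t
    (vel_x (slow t) x ^ 2 - dens (slow t) x + label_nonlocal (slow t) - vel (slow t) x * vel_xx (slow t) x).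
Proof.
intros Ht Hx.
apply (is_derive_ext_loc (fun s => vel_x (slow s) x)).
{ generalize (open_lt tstar t (proj2 Ht)); apply filter_imp; intros s Hs; symmetry; apply sol_f_dx; assumption. }
evar_last.
- apply (is_derive_comp (fun s => vel_x s x) slow); [apply vel_x_derive_s; [apply slow_pos, Ht|exact Hx]|apply slow_derive, Ht].
- unfold scal; simpl; unfold mult; simpl; field; apply K_neq_0, slow_lt, Ht.
Qed.

Lemma sol_rho_dt (t x : R) : 0 < t < tstar -> I01 x ->
  is_derive (fun s : R => sol_rho s x) t
    (dens (slow t) x * vel_x (slow t) x - vel (slow t) x * dens_x (slow t) x).
Proof.
intros Ht Hx; evar_last.
- apply (is_derive_comp (fun s => dens s x) slow); [apply dens_derive_s; [apply slow_pos, Ht|exact Hx]|apply slow_derive, Ht].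
- unfold scal; simpl; unfold mult; simpl; field; apply K_neq_0, slow_lt, Ht.
Qed.

Lemma sol_nonlocal (t : R) : t < tstar -> nonlocal_term sol_f sol_rho t = label_nonlocal (slow t).
Proof.
intros Ht; rewrite <- nonlocal_eq by (apply slow_lt, Ht); unfold nonlocal_term.
f_equal; f_equal; apply RInt_ext; rewrite Rmin_left, Rmax_right by lra; intros x Hx.
rewrite (proj2 (sol_f_dx t x Ht ltac:(unfold I01; lra))); reflexivity.
Qed.

Hypothesis u_mean : RInt (fun a => u (cl a)) 0 1 = 0.
Hypothesis r_0 : r 0 = 0.
Hypothesis r_1 : r 1 = 0.

Lemma jac_at_0 (a : R) : jac 0 a = 1.
Proof. unfold jac; rewrite K_nonpos, den_nonpos by lra; field. Qed.

Lemma label_0_id (x : R) : label 0 x = x.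
Proof.
rewrite <- (label_flow 0 x b_pos) at 2; f_equal; symmetry.
unfold flow; rewrite (RInt_ext _ (fun _ => 1)) by (intros; apply jac_at_0).
rewrite RInt_cst; ring_R.
Qed.

Lemma vel_0 (x : R) : vel 0 x = RInt (fun a => u (cl a)) 0 x.
Proof.
assert (N : forall a, num 0 a = u (cl a)) by (intros; unfold num; rewrite (proj2 (g_nonpos 0 (Rle_refl 0))); ring).
assert (HK1 : K1 0 = 0).
{ transitivity (RInt (fun a => u (cl a)) 0 1); [|exact u_mean]; apply RInt_ext; intros a _; rewrite N, den_nonpos by lra; eq_R; field. }
unfold vel; rewrite label_0_id; apply RInt_ext; intros a _.
unfold stretch; rewrite jac_at_0, HK1, N, K_nonpos, den_nonpos by lra; eq_R; field.
Qed.

Lemma dens_0 (x : R) : I01 x -> dens 0 x = r x.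
Proof. intros Hx; unfold dens; rewrite jac_at_0, label_0_id, clamp_id by exact Hx; ring. Qed.

Lemma flow_is_solution (f0 rho0 : R -> R) :
  (forall x, I01 x -> f0 x = RInt (fun a => u (cl a)) 0 x) ->
  (forall x, I01 x -> rho0 x = r x) ->
  is_solution dirichlet f0 rho0 tstar sol_f sol_rho.
Proof.
intros Hf0 Hr0; split.
- exact tstar_pos.
- intros t x (_ & Ht & Hx); simpl in *; split; [|split]; eexists;
    [apply sol_f_dx|apply sol_f_dxx|apply sol_rho_dx]; assumption.
- apply slab_continuous_ext with sol_f; trivial; intros t x (_ & Ht & _).
  apply (cont2_slow vel); trivial; intros; apply cont2_vel; assumption.
- apply slab_continuous_ext with (fun t x => vel_x (slow t) x); intros t x (_ & Ht & Hx).
  + symmetry; apply sol_f_dx; assumption.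
  + apply (cont2_slow vel_x); trivial; intros; apply cont2_vel_x; assumption.
- apply slab_continuous_ext with (fun t x => vel_xx (slow t) x); intros t x (_ & Ht & Hx).
  + symmetry; apply sol_f_dxx; assumption.
  + apply (cont2_slow vel_xx); trivial; intros; apply cont2_vel_xx; assumption.
- apply slab_continuous_ext with sol_rho; trivial; intros t x (_ & Ht & _).
  apply (cont2_slow dens); trivial; intros; apply cont2_dens; assumption.
- apply slab_continuous_ext with (fun t x => dens_x (slow t) x); intros t x (_ & Ht & Hx).
  + symmetry; apply sol_rho_dx; assumption.
  + apply (cont2_slow dens_x); trivial; intros; apply cont2_dens_x; assumption.
- intros t x H0 (_ & Ht & Hx); simpl in *; split; eexists;
    [apply sol_f_dt|apply sol_rho_dt]; first [exact Hx|exact (conj H0 Ht)].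
- intros t x H0 (_ & Ht & Hx); simpl in *.
  rewrite (is_derive_unique _ _ _ (sol_f_dt t x (conj H0 Ht) Hx)), sol_nonlocal by exact Ht.
  rewrite (proj2 (sol_f_dx t x Ht Hx)), (proj2 (sol_f_dxx t x Ht Hx)).
  unfold sol_f, sol_rho; ring.
- intros t x H0 (_ & Ht & Hx); simpl in *.
  rewrite (is_derive_unique _ _ _ (sol_rho_dt t x (conj H0 Ht) Hx)).
  rewrite (proj2 (sol_f_dx t x Ht Hx)), (proj2 (sol_rho_dx t x Ht Hx)).
  unfold sol_f, sol_rho; ring.
- intros x Hx; unfold sol_f, sol_rho; rewrite slow_0, vel_0, dens_0, Hf0, Hr0 by exact Hx; tauto.
- intros t _ Ht; simpl in Ht; assert (Hs := slow_lt t Ht).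
  assert (c0 : cl 0 = 0) by (apply clamp_id; lra); assert (c1 : cl 1 = 1) by (apply clamp_id; lra).
  unfold dirichlet, sol_f, sol_rho, vel, dens; rewrite label_at_0, label_at_1, c0, c1, r_0, r_1, label_vel_0, label_vel_1 by exact Hs.
  repeat split; ring.
Qed.

(** * Behaviour at an end point where [u] attains its maximum *)

Variable xs : R.
Hypothesis xs_end : xs = 0 \/ xs = 1.
Hypothesis u_xs : u xs = M.

(** The reciprocal of [jac] at [xs], where [r] vanishes. *)
Definition recip_jac (s : R) : R := K s * (1 - Rmax 0 s * M).

Let xs_I01 : I01 xs.
Proof. unfold I01; destruct xs_end; lra. Qed.

Let r_xs : r xs = 0.
Proof. destruct xs_end as [-> | ->]; assumption. Qed.

Lemma label_xs (s : R) : s < / M -> label s xs = xs.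
Proof. intros Hs; destruct xs_end as [-> | ->]; [apply label_at_0|apply label_at_1]; exact Hs. Qed.

Lemma den_xs (s : R) : den s xs = 1 - Rmax 0 s * M.
Proof. unfold den; rewrite clamp_id, u_xs, r_xs by exact xs_I01; ring. Qed.

Lemma recip_jac_pos (s : R) : s < / M -> 0 < recip_jac s.
Proof. intros Hs; unfold recip_jac; rewrite <- den_xs; apply Rmult_lt_0_compat; [apply K_pos|apply den_pos]; exact Hs. Qed.

Lemma vel_x_xs (s : R) : s < / M -> vel_x s xs = - K1 s / K s ^ 3 + M / (K s ^ 2 * (1 - Rmax 0 s * M)).
Proof.
intros Hs; unfold vel_x, stretch; rewrite label_xs, den_xs by exact Hs; unfold num.
rewrite clamp_id, u_xs, r_xs by exact xs_I01; do 2 f_equal; ring.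
Qed.

(** The end point does not move, so [f_x] there is the logarithmic derivative of
    the Jacobian. *)
Lemma RInt_vel_x_xs (t : R) : 0 <= t < tstar ->
  RInt (fun z => dx (sol_f z) xs) 0 t = - ln (recip_jac (slow t)).
Proof.
intros Ht.
rewrite (RInt_ext _ (fun z => vel_x (slow (Rmin z t)) xs)).
2:{ rewrite Rmin_left, Rmax_right by lra; intros z Hz; rewrite Rmin_left by lra.
    apply sol_f_dx; [lra|exact xs_I01]. }
assert (Cw : cont_below (/ M) recip_jac).
{ intros s Hs; apply (cont2_fst (fun s (_ : R) => recip_jac s) s 0).
  assert (C1 := cont2_of_fst (Rmax 0) s 0 (continuous_Rmax_0 s)); assert (C2 := cont2_of_fst K s 0 (cont_K s Hs)).
  unfold recip_jac; cont2_tac. }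
rewrite (RInt_derive_open (fun z => - ln (recip_jac (slow z)))).
- rewrite slow_0; unfold recip_jac at 2; rewrite K_nonpos, Rmax_left by lra.
  replace (1 * (1 - 0 * M)) with 1 by ring; rewrite ln_1; ring_R.
- lra.
- intros z Hz; apply continuous_oppR.
  assert (Hs := slow_lt z ltac:(lra)).
  apply (continuous_comp (fun z => recip_jac (slow z)) ln).
  + apply (continuous_comp slow recip_jac); [apply slow_cont; lra|apply Cw, Hs].
  + apply continuous_of_is_derive with (/ recip_jac (slow z)), is_derive_ln, recip_jac_pos, Hs.
- intros z.
  assert (Hm : Rmin z t < tstar) by (apply Rle_lt_trans with t; [apply Rmin_r|apply Ht]).
  apply (continuous_comp (fun z => Rmin z t) (fun z => vel_x (slow z) xs)).
  + apply continuous_of_lipschitz; intros y; unfold Rmin; repeat destruct (Rle_dec _ _);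
      unfold Rabs; repeat destruct (Rcase_abs _); lra.
  + apply (continuous_comp slow (fun s => vel_x s xs)); [apply slow_cont, Hm|].
    apply cont2_fst, cont2_vel_x, slow_lt, Hm.
- intros z Hz; rewrite Rmin_left by lra.
  assert (Hz' : 0 < z < tstar) by lra; assert (Hs := slow_pos z Hz').
  assert (Hw := recip_jac_pos _ (proj2 Hs)); assert (NK := K_neq_0 _ (proj2 Hs)).
  assert (ND := den_neq_0 (slow z) xs (proj2 Hs)); rewrite den_xs in ND.
  assert (D1 : is_derive recip_jac (slow z) (K1 (slow z) * (1 - slow z * M) - K (slow z) * M)).
  { apply (is_derive_ext_loc (fun s => K s * (1 - s * M))).
    - generalize (locally_range _ Hs); apply filter_imp; intros s Hs'; unfold recip_jac; rewrite Rmax_right by lra; reflexivity.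
    - assert (DK := K_derive _ Hs); auto_derive; [eexists; exact DK|].
      replace (Derive _ (slow z)) with (K1 (slow z)) by (symmetry; apply is_derive_unique, DK); ring. }
  rewrite vel_x_xs by apply Hs; evar_last.
  + apply (is_derive_oppR (fun z => ln (recip_jac (slow z)))).
    apply (is_derive_comp ln (fun z => recip_jac (slow z))); [apply is_derive_ln, Hw|].
    apply (is_derive_comp recip_jac slow); [exact D1|apply slow_derive; lra].
  + unfold opp, scal; simpl; unfold mult; simpl; unfold recip_jac in *.
    rewrite Rmax_right in * by lra; field; tauto.
Qed.

Lemma recip_jac_small (eps : R) : 0 < eps ->
  exists s0, 0 <= s0 < / M /\ forall s, s0 < s < / M -> recip_jac s < eps.
Proof.
intros He; destruct K_bound as (C & HC & HK).
(* [recip_jac s <= C * sqrt (1 - s M)], which is less than [eps] as soon as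
   [1 - s M < d] *)
set (d := (eps / C) ^ 2).
assert (Hd : 0 < d) by (apply pow_lt, Rdiv_lt_0_compat; assumption).
exists (Rmax 0 ((1 - d) / M)); split.
{ split; [apply Rmax_l|]; apply Rmax_lub_lt; [exact b_pos|].
  apply Rmult_lt_reg_r with M; [exact M_pos|]; rewrite Rinv_l by lra.
  unfold Rdiv; rewrite Rmult_assoc, Rinv_l by lra; lra. }
intros s [H1 H2].
assert (Hs0 : 0 < s) by (eapply Rle_lt_trans; [apply Rmax_l|exact H1]).
assert (H3 : (1 - d) / M < s) by (eapply Rle_lt_trans; [apply Rmax_r|exact H1]).
apply (Rmult_lt_compat_r M) in H3; [|exact M_pos].
unfold Rdiv in H3; rewrite Rmult_assoc, Rinv_l, Rmult_1_r in H3 by lra.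
assert (Hf := time_factor_pos s H2); rewrite Rmax_right in Hf by lra.
unfold recip_jac; rewrite Rmax_right by lra.
specialize (HK s ltac:(lra)); assert (HK0 := K_pos s H2).
set (sg := 1 - s * M) in *.
assert (p1 := sqrt_lt_R0 _ Hf); assert (p2 := sqrt_lt_R0 _ p1).
assert (E1 := sqrt_sqrt _ (Rlt_le _ _ Hf)); assert (E2 := sqrt_sqrt _ (Rlt_le _ _ p1)).
assert (Hsg1 : sg <= 1) by (unfold sg; assert (0 <= s * M) by (apply Rmult_le_pos; lra); lra).
assert (q1 : sqrt sg <= 1) by (rewrite <- sqrt_1; apply sqrt_le_1; lra).
assert (q2 : sqrt (sqrt sg) <= 1) by (rewrite <- sqrt_1; apply sqrt_le_1; lra).
assert (H5 : K s * sqrt sg <= C).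
{ rewrite <- E2, <- Rmult_assoc; eapply Rle_trans; [|exact HK].
  rewrite <- (Rmult_1_r (K s * sqrt (sqrt sg))) at 2; apply Rmult_le_compat_l; [apply Rmult_le_pos; lra|exact q2]. }
assert (H6 : sqrt sg < eps / C).
{ assert (Hec : 0 < eps / C) by (apply Rdiv_lt_0_compat; assumption).
  rewrite <- (sqrt_pow2 (eps / C)) by lra; apply sqrt_lt_1; unfold sg, d in *; lra. }
rewrite <- E1, <- Rmult_assoc.
apply Rle_lt_trans with (C * sqrt sg); [apply Rmult_le_compat_r; lra|].
apply Rlt_le_trans with (C * (eps / C)); [apply Rmult_lt_compat_l; assumption|].
right; field; lra.
Qed.

Lemma recip_jac_slow_small (eps : R) : 0 < eps ->
  at_left tstar (fun t => 0 <= t < tstar /\ recip_jac (slow t) < eps).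
Proof.
intros He; destruct (recip_jac_small eps He) as (s0 & Hs0 & Hw).
unfold at_left, within.
assert (Ht0 : 0 <= tau s0).
{ destruct (Req_dec s0 0) as [->|Hn]; [rewrite tau_0; lra|].
  left; rewrite <- tau_0; apply tau_increasing; lra. }
generalize (open_gt (tau s0) tstar (tau_lt s0 (proj2 Hs0))); apply filter_imp; intros t H1 H2.
split; [lra|]; apply Hw; split; [apply slow_gt; lra|apply slow_lt, H2].
Qed.

Lemma stretch_diverges :
  filterlim (fun t => RInt (fun s => dx (sol_f s) xs) 0 t) (at_left tstar) (Rbar_locally p_infty).
Proof.
intros P [B HB]; unfold filtermap.
generalize (recip_jac_slow_small (exp (- B)) (exp_pos _)); apply filter_imp; intros t [Ht Hw].
apply HB; rewrite RInt_vel_x_xs by exact Ht.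
assert (Hp := recip_jac_pos (slow t) (slow_lt t (proj2 Ht))).
apply ln_increasing in Hw; [rewrite ln_exp in Hw; lra|exact Hp].
Qed.

Hypothesis g1_ge : forall s, s < / M -> 0 <= g1 s.
Hypothesis du_xs : du xs <> 0.
Hypothesis slopes_opposite : du xs * dr xs <= 0.

(** [vel_xx s xs = (du xs - k * dr xs) / recip_jac s] with [k >= 0]. Since
    [du xs * dr xs <= 0], the density can only enlarge the numerator. *)
Lemma vel_xx_xs (s : R) : s < / M -> Rabs (du xs) / recip_jac s <= Rabs (vel_xx s xs).
Proof.
intros Hs; assert (Hw := recip_jac_pos s Hs); assert (ND := den_neq_0 s xs Hs); assert (NK := K_neq_0 s Hs).
set (k := g1 s * (1 - Rmax 0 s * M) + M * g s).
assert (Hk : 0 <= k).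
{ apply Rplus_le_le_0_compat; apply Rmult_le_pos; [apply g1_ge, Hs|apply Rlt_le, time_factor_pos; assumption|lra|apply g_ge, Hs]. }
assert (E : vel_xx s xs = (du xs - dr xs * k) / recip_jac s).
{ unfold vel_xx, stretch_a, jac; rewrite label_xs by exact Hs; rewrite den_xs in *; unfold num, recip_jac, k.
  rewrite clamp_id, u_xs, r_xs by exact xs_I01; field; tauto. }
rewrite E; unfold Rdiv; rewrite Rabs_mult, (Rabs_pos_eq (/ recip_jac s)) by (apply Rlt_le, Rinv_0_lt_compat, Hw).
apply Rmult_le_compat_r; [apply Rlt_le, Rinv_0_lt_compat, Hw|].
apply Rsqr_le_abs_0; unfold Rsqr.
assert (0 <= k * - (du xs * dr xs)) by (apply Rmult_le_pos; lra).
assert (0 <= (dr xs * k) * (dr xs * k)) by apply Rle_0_sqr; lra.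
Qed.

Lemma vorticity_diverges :
  filterlim (fun t => Rabs (dx (dx (sol_f t)) xs)) (at_left tstar) (Rbar_locally p_infty).
Proof.
assert (Hd : 0 < Rabs (du xs)) by (apply Rabs_pos_lt, du_xs).
intros P [B HB]; unfold filtermap.
set (B' := Rmax 1 B).
assert (HB' : 0 < B') by (eapply Rlt_le_trans; [apply Rlt_0_1|apply Rmax_l]).
generalize (recip_jac_slow_small (Rabs (du xs) / B') (Rdiv_lt_0_compat _ _ Hd HB')); apply filter_imp; intros t [Ht Hw].
assert (Hs := slow_lt t (proj2 Ht)); assert (Hp := recip_jac_pos (slow t) Hs).
apply HB; rewrite (proj2 (sol_f_dxx t xs (proj2 Ht) xs_I01)).
eapply Rle_lt_trans; [apply (Rmax_r 1 B)|]; eapply Rlt_le_trans; [|apply vel_xx_xs, Hs].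
fold B'; apply Rmult_lt_reg_r with (recip_jac (slow t)); [exact Hp|].
unfold Rdiv in *; rewrite Rmult_assoc, Rinv_l by lra.
apply (Rmult_lt_compat_r B') in Hw; [|exact HB'].
rewrite Rmult_assoc, Rinv_l in Hw by lra; lra.
Qed.

End Lagrangian.

(** * Finite time blowup *)

Lemma slope_at_min_0 (h : R -> R) (l : R) :
  is_derive h 0 l -> (forall x, I01 x -> h 0 <= h x) -> 0 <= l.
Proof.
intros D H; destruct (Rle_lt_dec 0 l) as [L|L]; [exact L|exfalso].
assert (He : 0 < - l / 2) by lra.
destruct (proj1 (is_derive_eps h 0 l) D (mkposreal _ He)) as [d Hd]; simpl in Hd.
set (x := Rmin (d / 2) 1).
assert (Hx : 0 < x) by (apply Rmin_pos; [destruct d; simpl|]; lra).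
assert (Hx1 : x <= d / 2) by apply Rmin_l; assert (Hx2 : x <= 1) by apply Rmin_r.
assert (Hd0 := cond_pos d).
specialize (H x ltac:(unfold I01; lra)); specialize (Hd x).
rewrite !Rminus_0_r, (Rabs_pos_eq x) in Hd by lra.
specialize (Hd ltac:(lra)); apply Rabs_le_between in Hd; nra.
Qed.

Lemma slope_at_min_1 (h : R -> R) (l : R) :
  is_derive h 1 l -> (forall x, I01 x -> h 1 <= h x) -> l <= 0.
Proof.
intros D H; enough (0 <= - l) by lra.
apply (slope_at_min_0 (fun x => h (1 - x))).
- evar_last.
  + apply (is_derive_comp h (fun x => 1 - x)); [rewrite Rminus_0_r; exact D|].
    auto_derive; [trivial|reflexivity].
  + unfold scal; simpl; unfold mult; simpl; ring.
- intros x Hx; rewrite Rminus_0_r; apply H; unfold I01 in *; lra.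
Qed.

Lemma linear_lower_bound_at_0 (v : R -> R) (l : R) :
  (forall x, I01 x -> 0 <= v x) -> is_derive v 0 l -> (v 0 = 0 -> l <> 0) ->
  exists d k, 0 < d <= 1 / 3 /\ 0 < k /\ forall x, 0 <= x <= d -> k * x <= v x.
Proof.
intros Hv D Hl.
assert (H0 : 0 <= v 0) by (apply Hv; unfold I01; lra).
destruct H0 as [Hp|H0].
- assert (He : 0 < v 0 / 2) by lra.
  destruct (proj1 (filterlim_locally _ _) (continuous_of_is_derive v 0 l D) (mkposreal _ He)) as [d Hd].
  exists (Rmin (d / 2) (1 / 3)), (v 0 / 2).
  assert (h1 := Rmin_l (d / 2) (1 / 3)); assert (h2 := Rmin_r (d / 2) (1 / 3)); assert (Hd0 := cond_pos d).
  split; [split; [apply Rmin_pos; lra|exact h2]|split; [exact He|]].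
  intros x Hx; assert (B : Rabs (v x - v 0) < v 0 / 2).
  { apply (Hd x); change (Rabs (x - 0) < d); rewrite Rminus_0_r, Rabs_pos_eq; lra. }
  apply Rabs_lt_between in B.
  assert (v 0 / 2 * x <= v 0 / 2 * 1) by (apply Rmult_le_compat_l; lra); lra.
- assert (Hlp : 0 < l).
  { assert (0 <= l); [|assert (l <> 0) by (apply Hl; lra); lra].
    apply (slope_at_min_0 v); [exact D|intros x Hx; rewrite <- H0; apply Hv, Hx]. }
  assert (He : 0 < l / 2) by lra.
  destruct (proj1 (is_derive_eps v 0 l) D (mkposreal _ He)) as [d Hd]; simpl in Hd.
  exists (Rmin (d / 2) (1 / 3)), (l / 2).
  assert (h1 := Rmin_l (d / 2) (1 / 3)); assert (h2 := Rmin_r (d / 2) (1 / 3)); assert (Hd0 := cond_pos d).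
  split; [split; [apply Rmin_pos; lra|exact h2]|split; [exact He|]].
  intros x Hx; specialize (Hd x); rewrite <- H0, !Rminus_0_r, Rabs_pos_eq in Hd by lra.
  specialize (Hd ltac:(lra)); apply Rabs_le_between in Hd; lra.
Qed.

(** At an end point where [v] vanishes the nonzero slope gives linear growth;
    elsewhere [v] is bounded below by compactness. *)
Lemma parabola_lower_bound (v dv : R -> R) :
  (forall x, I01 x -> 0 <= v x) -> (forall x, I01 x -> is_derive v x (dv x)) ->
  (forall x, I01 x -> v x = 0 -> (x = 0 \/ x = 1) /\ dv x <> 0) ->
  exists c, 0 < c /\ forall x, I01 x -> c * (x * (1 - x)) <= v x.
Proof.
intros Hv D Hz.
assert (I0 : I01 0) by (unfold I01; lra); assert (I1 : I01 1) by (unfold I01; lra).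
destruct (linear_lower_bound_at_0 v (dv 0) Hv (D 0 I0) (fun e => proj2 (Hz 0 I0 e)))
  as (d0 & k0 & Hd0 & Hk0 & B0).
destruct (linear_lower_bound_at_0 (fun x => v (1 - x)) (- dv 1)) as (d1 & k1 & Hd1 & Hk1 & B1).
{ intros x Hx; apply Hv; unfold I01 in *; lra. }
{ evar_last.
  - apply (is_derive_comp v (fun x => 1 - x)); [rewrite Rminus_0_r; apply D, I1|].
    auto_derive; [trivial|reflexivity].
  - unfold scal; simpl; unfold mult; simpl; ring. }
{ rewrite Rminus_0_r; intros e; assert (H := proj2 (Hz 1 I1 e)); lra. }
destruct (continuity_ab_min v d0 (1 - d1)) as [xm [Hmin Hxm]]; [lra| |].
{ intros x Hx; apply continuous_continuity_pt, continuous_of_is_derive with (dv x), D; unfold I01; lra. }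
assert (Hm : 0 < v xm).
{ assert (Ixm : I01 xm) by (unfold I01; lra).
  destruct (Hv xm Ixm) as [L|E]; [exact L|].
  destruct (Hz xm Ixm (eq_sym E)) as [[?|?] _]; lra. }
set (c := Rmin k0 (Rmin k1 (v xm))).
assert (c1 : c <= k0) by apply Rmin_l.
assert (c2 : c <= k1) by (eapply Rle_trans; [apply Rmin_r|apply Rmin_l]).
assert (c3 : c <= v xm) by (eapply Rle_trans; [apply Rmin_r|apply Rmin_r]).
assert (Hc : 0 < c) by (repeat apply Rmin_pos; assumption).
exists c; split; [exact Hc|]; intros x Hx; unfold I01 in Hx.
assert (p0 : 0 <= x * (1 - x)) by (apply Rmult_le_pos; lra).
assert (p1 : x * (1 - x) <= x) by nra; assert (p2 : x * (1 - x) <= 1 - x) by nra.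
destruct (Rle_dec x d0) as [L|L]; [|destruct (Rle_dec (1 - x) d1) as [L'|L']].
- apply Rle_trans with (k0 * x); [apply Rmult_le_compat; lra|apply B0; lra].
- apply Rle_trans with (k1 * (1 - x)); [apply Rmult_le_compat; lra|].
  assert (H := B1 (1 - x)); simpl in H; replace (1 - (1 - x)) with x in H by ring; apply H; lra.
- apply Rle_trans with (v xm * 1); [apply Rmult_le_compat; lra|].
  rewrite Rmult_1_r; apply Hmin; lra.
Qed.

(** A longer-lived solution would agree with [f] before [tstar] and have
    bounded second derivative up to [tstar]. *)
Lemma is_the_solution_of_blowup (f0 rho0 : R -> R) (tstar x : R) (f rho : R -> R -> R) :
  is_solution dirichlet f0 rho0 tstar f rho -> I01 x ->
  filterlim (fun t => Rabs (dx (dx (f t)) x)) (at_left tstar) (Rbar_locally p_infty) ->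
  is_the_solution dirichlet f0 rho0 tstar f rho.
Proof.
intros Hf Hx Hbl; split; [exact Hf|]; intros T' g sig Hg.
assert (Hd : dirichlet = dirichlet \/ dirichlet = periodic) by (left; reflexivity).
assert (HT : Rbar_le T' tstar).
{ apply Rbar_not_lt_le; intros HT'.
  assert (Hts : 0 < tstar) by exact (sol_lifespan Hf).
  assert (C : continuous (fun s => dx (dx (g (clamp 0 tstar s))) (cl x)) tstar)
    by exact (cont2_fst _ _ _ (cont2_of_slab T' _ tstar (sol_cont_fxx Hg) (Rlt_le _ _ Hts) HT' tstar x)).
  rewrite (clamp_id 0 1 x Hx) in C.
  assert (Hnear := proj1 (filterlim_locally _ _) C (mkposreal 1 Rlt_0_1)).
  set (y0 := dx (dx (g (clamp 0 tstar tstar))) x) in Hnear.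
  assert (HB : at_left tstar (fun t => Rabs y0 + 1 < Rabs (dx (dx (f t)) x))).
  { apply (Hbl (fun y => Rabs y0 + 1 < y)); exists (Rabs y0 + 1); auto. }
  assert (HF : at_left tstar (fun t => False)).
  { unfold at_left, within in *.
    generalize (filter_and _ _ HB (filter_and _ _ Hnear (open_gt 0 tstar Hts))).
    apply filter_imp; intros t (H1 & H2 & H3) Ht; specialize (H1 Ht).
    change (Rabs (dx (dx (g (clamp 0 tstar t))) x - y0) < 1) in H2.
    rewrite (clamp_id 0 tstar t) in H2 by lra.
    assert (S1 : forall y, I01 y -> time_slab tstar (t, y)) by (intros y Hy; repeat split; simpl; try apply Hy; lra).
    assert (S2 : forall y, I01 y -> time_slab T' (t, y)).
    { intros y Hy; split; [simpl; lra|split; [|exact Hy]].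
      apply (Rbar_lt_trans (Finite t) (Finite tstar) T'); [exact Ht|exact HT']. }
    assert (E1 : forall y, I01 y -> dx (f t) y = dx (g t) y).
    { intros y Hy; apply dx_ext; [exact Hy| |exact (proj1 (sol_ex_dx Hf t y (S1 y Hy)))].
      intros z Hz; exact (proj1 (solutions_agree _ _ _ _ _ _ _ _ _ Hd Hf Hg t z (S1 z Hz) (S2 z Hz))). }
    assert (E2 : dx (dx (f t)) x = dx (dx (g t)) x).
    { apply dx_ext; [exact Hx|exact E1|exact (proj1 (proj2 (sol_ex_dx Hf t x (S1 x Hx))))]. }
    rewrite E2 in H1.
    assert (H4 := Rabs_triang (dx (dx (g t)) x - y0) y0).
    replace (dx (dx (g t)) x - y0 + y0) with (dx (dx (g t)) x) in H4 by ring; lra. }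
  destruct (@filter_ex R (at_left tstar) (at_left_proper_filter tstar) _ HF) as [? []]. }
split; [exact HT|]; intros t y Hs.
assert (Hs' : time_slab tstar (t, y)).
{ destruct Hs as (H0 & H1 & H2); split; [exact H0|split; [|exact H2]].
  apply (Rbar_lt_le_trans _ _ _ H1 HT). }
apply (solutions_agree _ _ _ _ _ _ _ _ _ Hd Hg Hf t y Hs Hs').
Qed.

(** The flow is driven by [u = f0'] and [r = rho0], extended beyond [[0,1]]. At a
    maximum point [M - u] and [r] are both minimal with value zero, which fixes
    the signs of their one-sided slopes. *)
Lemma blowup_at_boundary_maximum (f0 rho0 : R -> R) (xs : list R) :
  smooth f0 -> smooth rho0 -> nontrivial f0 -> dirichlet f0 rho0 ->
  (forall x, I01 x -> 0 <= rho0 x) ->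
  (forall x, In x xs <-> is_max_point f0 x) ->
  (forall x, In x xs -> x = 0 \/ x = 1) ->
  (forall x, In x xs -> dx (dx f0) x <> 0) ->
  exists (tstar : R) (f rho : R -> R -> R),
    0 < tstar /\
    is_the_solution dirichlet f0 rho0 (Finite tstar) f rho /\
    forall x, In x xs ->
      filterlim (fun t => RInt (fun s => dx (f s) x) 0 t)
        (at_left tstar) (Rbar_locally p_infty) /\
      filterlim (fun t => Rabs (dx (dx (f t)) x))
        (at_left tstar) (Rbar_locally p_infty).
Proof.
intros Sf Sr (x0 & Hx0 & Hnt) (Hf0 & Hf1 & Hr0 & Hr1) Hrho Hxs Hend Hvort.
assert (I0 : I01 0) by (unfold I01; lra); assert (I1 : I01 1) by (unfold I01; lra).
set (u := affine_extension (dx f0)); set (du := dx (dx f0)).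
set (r := affine_extension rho0); set (dr := dx rho0).
assert (Cdu : forall x, continuous (fun a => du (cl a)) x) by apply (continuous_cl_of_dx _ (Sf 2%nat)).
assert (Cdr : forall x, continuous (fun a => dr (cl a)) x) by apply (continuous_cl_of_dx _ (Sr 1%nat)).
assert (Du : forall x, I01 x -> is_derive u x (du x)).
{ intros x Hx; apply is_derive_affine_extension; [apply (Sf 1%nat)|exact Cdu|exact Hx]. }
assert (Dr : forall x, I01 x -> is_derive r x (dr x)).
{ intros x Hx; apply is_derive_affine_extension; [apply (Sr 0%nat)|exact Cdr|exact Hx]. }
assert (Eu : forall x, I01 x -> u x = dx f0 x) by (intros; apply affine_extension_id; assumption).
assert (Er : forall x, I01 x -> r x = rho0 x) by (intros; apply affine_extension_id; assumption).
assert (Cu : forall x, continuous (fun a => u (cl a)) x) by exact (cont_cl_of_derive u du Du).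
assert (Hprim : forall x y, 0 <= x -> x <= y -> y <= 1 -> RInt (fun a => u (cl a)) x y = f0 y - f0 x).
{ intros x y Hx Hxy Hy.
  rewrite (RInt_derive_open (fun a => f0 (cl a)) (fun a => u (cl a)) x y); trivial.
  - rewrite !clamp_id by lra; reflexivity.
  - intros z _; apply (continuous_cl_of_dx _ (Sf 0%nat)).
  - intros z Hz; assert (Iz : I01 z) by (unfold I01; lra).
    rewrite clamp_id by exact Iz; apply is_derive_of_dx; [lra|].
    apply (is_dx_ext f0); [exact Iz|intros w Hw; rewrite clamp_id by exact Hw; reflexivity|].
    rewrite Eu by exact Iz; apply dx_correct, (Sf 0%nat), Iz. }
destruct (continuity_ab_maj (fun a => u (cl a)) 0 1) as [xm [Hmax Ixm]]; [lra| |].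
{ intros x _; apply continuous_continuity_pt, Cu. }
set (M := u xm).
assert (u_le : forall x, I01 x -> u x <= M).
{ intros x Hx; specialize (Hmax x Hx); rewrite !clamp_id in Hmax by assumption; exact Hmax. }
(* otherwise [f0] is nonincreasing with equal values at both ends, hence zero *)
assert (M_pos : 0 < M).
{ destruct (Rlt_le_dec 0 M) as [L|L]; [exact L|exfalso; apply Hnt].
  assert (Hneg : forall x y, 0 <= x -> x <= y -> y <= 1 -> f0 y - f0 x <= 0).
  { intros x y Hx Hxy Hy; rewrite <- Hprim by assumption.
    apply Rle_trans with (RInt (fun _ => 0) x y).
    2:{ rewrite RInt_cst; lra. }
    apply RInt_le; [exact Hxy|apply ex_RInt_cont, Cu|apply ex_RInt_const|].
    intros a _; assert (H := u_le _ (cl_I01 a)); lra. }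
  unfold I01 in Hx0; assert (h1 := Hneg 0 x0); assert (h2 := Hneg x0 1); lra. }
assert (Hin : forall x, I01 x -> u x = M -> In x xs).
{ intros x Hx E; apply Hxs; split; [exact Hx|]; rewrite <- Eu, E by exact Hx; split; [exact M_pos|].
  intros y Hy; rewrite <- Eu by exact Hy; apply u_le, Hy. }
assert (Hxm : In xm xs) by (apply Hin; [exact Ixm|reflexivity]).
assert (r_ge : forall x, I01 x -> 0 <= r x) by (intros x Hx; rewrite Er by exact Hx; apply Hrho, Hx).
assert (r_0 : r 0 = 0) by (rewrite Er; assumption).
assert (r_1 : r 1 = 0) by (rewrite Er; assumption).
assert (Dv : forall x, I01 x -> is_derive (fun x => M - u x) x (- du x)).
{ intros x Hx; assert (D := Du x Hx); auto_derive; [eexists; exact D|].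
  replace (Derive _ x) with (du x) by (symmetry; apply is_derive_unique, D); ring. }
destruct (parabola_lower_bound (fun x => M - u x) (fun x => - du x)) as (c & c_pos & gap).
{ intros x Hx; assert (H := u_le x Hx); lra. }
{ exact Dv. }
{ intros x Hx E; assert (Hi : In x xs) by (apply Hin; [exact Hx|lra]).
  split; [apply Hend, Hi|apply Ropp_neq_0_compat; exact (Hvort x Hi)]. }
destruct (coefficient_exists u du r dr M M_pos u_le r_ge Du Dr)
  as (g & g1 & Cg & Cg1 & Hg0 & g_ge & g1_ge & Dg & Dg1).
destruct (final_time_exists u du r dr M M_pos u_le r_ge Du Dr g g1 Cg Hg0 g_ge c c_pos gap)
  as (tstar & Htau & Hsup).
assert (u_mean : RInt (fun a => u (cl a)) 0 1 = 0) by (rewrite Hprim by lra; lra).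
assert (Hsol : is_solution dirichlet f0 rho0 tstar (sol_f u r M g g1) (sol_rho u r M g)).
{ apply (flow_is_solution u du r dr); trivial.
  - intros x Hx; unfold I01 in Hx; rewrite Hprim by lra; lra.
  - intros x Hx; symmetry; apply Er, Hx. }
assert (Hmaxpt : forall x, In x xs -> (x = 0 \/ x = 1) /\ u x = M /\ du x * dr x <= 0 /\ du x <> 0).
{ intros x Hx; assert (He := Hend x Hx); split; [exact He|].
  assert (Ix : I01 x) by (unfold I01; lra).
  assert (Ex : u x = M).
  { apply Rle_antisym; [apply u_le, Ix|]; unfold M; rewrite !Eu by assumption.
    apply Hxs in Hx; apply Hx, Ixm. }
  split; [exact Ex|split; [|exact (Hvort x Hx)]].
  assert (Hmin : forall y, I01 y -> M - u x <= M - u y) by (intros y Hy; assert (H := u_le y Hy); lra).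
  destruct He as [-> | ->].
  - assert (h1 := slope_at_min_0 _ _ (Dv 0 I0) Hmin).
    assert (h2 : 0 <= dr 0) by (apply (slope_at_min_0 r _ (Dr 0 I0)); intros y Hy; rewrite r_0; apply r_ge, Hy).
    nra.
  - assert (h1 := slope_at_min_1 _ _ (Dv 1 I1) Hmin).
    assert (h2 : dr 1 <= 0) by (apply (slope_at_min_1 r _ (Dr 1 I1)); intros y Hy; rewrite r_1; apply r_ge, Hy).
    nra. }
assert (Hblow : forall x, In x xs ->
  filterlim (fun t => Rabs (dx (dx (sol_f u r M g g1 t)) x)) (at_left tstar) (Rbar_locally p_infty)).
{ intros x Hx; destruct (Hmaxpt x Hx) as (He & Ex & Hsl & Hne).
  apply (vorticity_diverges u du r dr) with (c := c); assumption. }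
exists tstar, (sol_f u r M g g1), (sol_rho u r M g); split; [|split].
- exact (sol_lifespan Hsol).
- apply (is_the_solution_of_blowup f0 rho0 tstar xm); [exact Hsol|exact Ixm|apply Hblow, Hxm].
- intros x Hx; destruct (Hmaxpt x Hx) as (He & Ex & _ & _); split; [|apply Hblow, Hx].
  apply (stretch_diverges u du r dr) with (c := c); assumption.
Qed.

Theorem theorem1p2 :
  (forall (f0 rho0 : R -> R) (xs : list R),
     smooth f0 -> smooth rho0 -> nontrivial f0 -> nontrivial rho0 ->
     dirichlet f0 rho0 ->
     (forall x, I01 x -> 0 <= rho0 x) ->
     (forall x, In x xs <-> is_max_point f0 x) ->
     (forall x, In x xs -> x = 0 \/ x = 1) ->
     (forall x, In x xs -> dx (dx f0) x <> 0) ->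
     exists (tstar : R) (f rho : R -> R -> R),
       0 < tstar /\
       is_the_solution dirichlet f0 rho0 (Finite tstar) f rho /\
       forall x, In x xs ->
         filterlim (fun t => RInt (fun s => dx (f s) x) 0 t)
           (at_left tstar) (Rbar_locally p_infty) /\
         filterlim (fun t => Rabs (dx (dx (f t)) x))
           (at_left tstar) (Rbar_locally p_infty))
  /\
  (forall bc : boundary_condition, bc = dirichlet \/ bc = periodic ->
     exists (f0 rho0 : R -> R) (xs : list R) (f rho : R -> R -> R),
       smooth f0 /\ smooth rho0 /\ nontrivial f0 /\ nontrivial rho0 /\
       bc f0 rho0 /\
       (forall x, I01 x -> 0 <= rho0 x) /\
       (forall x, In x xs <-> is_max_point f0 x) /\
       (exists x, In x xs /\ dx (dx f0) x = 0) /\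
       is_the_solution bc f0 rho0 p_infty f rho).
Proof.
split.
- intros f0 rho0 xs Sf Sr Nf _; exact (blowup_at_boundary_maximum f0 rho0 xs Sf Sr Nf).
- exact global_solution_exists.
Qed.
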